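(* Let $\mathcal T$ be a triangulation of a surface $S$ of topological type $(g,n)$ and let $\Theta:E\to[0,\pi)$ satisfy $\mathbf{(C1)}$. Let $K=(k_1,\dots,k_{|V|})$ be a hyperbolic (resp. Euclidean) curvature vector. Then for any $r(0)\in\mathbb R_+^{|V|}$ the flow $$\frac{dr_i}{dt}=(k_i-K_i)\sinh r_i\qquad\Big(\text{resp. }\frac{dr_i}{dt}=(k_i-K_i)r_i\Big),\quad i=1,\dots,|V|,$$ with $K_i$ computed in hyperbolic (resp. Euclidean) background geometry, has a unique solution $r(t)$ existing for all $t\ge0$, and $r(t)$ converges if and only if $K$ is attainable. Moreover, if $r(t)$ converges, it converges exponentially fast to a radius vector producing a hyperbolic (resp. Euclidean) cone metric $\mu$ on $S$ whose vertex curvatures are given by $K$, and $(S,\mu)$ supports a $\mathcal T$-type circle pattern with exterior intersection angles given by $\Theta$.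
   Context: $S$: compact oriented surface of genus $g$ with $n\ge0$ boundary circles, $\chi(S)=2-2g-n$. $\mathcal T$: vertices $V=\{v_1,\dots,v_{|V|}\}$, edges $E$, triangles $F$, boundary vertices $V_\partial$. $\mathbf{(C1)}$: whenever $e_1,e_2,e_3$ bound a triangle, $I(e_1)+I(e_2)I(e_3)\ge0$ and cyclic analogues, $I=\cos\Theta$. For $r\in\mathbb R_+^{|V|}$, each triangle $v_iv_jv_k$ is realized as the hyperbolic triangle with sides $l_{ij}=\cosh^{-1}(\cosh r_i\cosh r_j+\sinh r_i\sinh r_j\cos\Theta([v_i,v_j]))$ etc. (resp. the Euclidean triangle with sides $l_{ij}=\sqrt{r_i^2+r_j^2+2r_ir_j\cos\Theta([v_i,v_j])}$ etc.), glued into a cone metric; $\sigma(v_i)$ is the total angle at $v_i$; $K_i=2\pi-\sigma(v_i)$ for interior and $\pi-\sigma(v_i)$ for boundary vertices. A vector $K\in\mathbb R^{|V|}$ is hyperbolic (resp. Euclidean) if $k_i<2\pi$ for interior $v_i$, $k_i<\pi$ for $v_i\in V_\partial$, and $\sum_i k_i>2\pi\chi(S)$ (resp. $\sum_ik_i=2\pi\chi(S)$). $K$ is attainable if for every proper non-empty $A\subsetneq V$, $\sum_{v_i\in A}k_i>-\sum_{(e,v)\in Lk(A)}(\pi-\Theta(e))+2\pi\chi(G(A)\setminus\partial S)+\pi\chi(G(A)\cap\partial S)$, where $G(A)$ is the union of open cells of $\mathcal T$ having a vertex in $A$, $\chi$ of a union of open cells is #0-cells − #1-cells + #2-cells, and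 $Lk(A)$ is the set of pairs $(e,v)$, $v\in A$, $e\in E$ with no endpoint in $A$, forming a triangle with $v$. A $\mathcal T$-type circle pattern: circles centered at the vertices with radii $r_i$, intersecting along each edge $e$ at exterior angle $\Theta(e)$. *)

(* Defs.v *)
From HB Require Import structures.
From mathcomp Require Import all_boot all_order all_algebra.
From mathcomp Require Import all_classical all_reals all_analysis.
Set Implicit Arguments. Unset Strict Implicit. Unset Printing Implicit Defensive.
Import Order.TTheory GRing.Theory Num.Theory.
Import numFieldNormedType.Exports.
Local Open Scope ring_scope.

(** * Combinatorial triangulated surfaces
   A triangulation is given by finite types of vertices [V], edges [E],
   triangles [F], and, for every triangle [f] and corner index [i : 'I_3],
   the vertex [tv f i] at corner [i] and the edge [te f i] forming the side
   of [f] opposite to corner [i].  The side [(f,i)] runs (in the orientation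
   of [f]) from corner [i+1] to corner [i+2] (indices mod 3).
   Loops / multiple edges are allowed (general, not necessarily simplicial,
   triangulations). *)

Definition nx (i : 'I_3) : 'I_3 := inord (i.+1 %% 3).

Section Triangulation.
Context {V E F : finType} (tv : F -> 'I_3 -> V) (te : F -> 'I_3 -> E).

(* sides and corners are both indexed by F * 'I_3 *)
Definition sedge (s : F * 'I_3) : E := te s.1 s.2.
Definition ssrc (s : F * 'I_3) : V := tv s.1 (nx s.2).
Definition stgt (s : F * 'I_3) : V := tv s.1 (nx (nx s.2)).
Definition cvert (c : F * 'I_3) : V := tv c.1 c.2.

Definition glued (s s' : F * 'I_3) : bool := (s != s') && (sedge s == sedge s').

(* corners adjacent across a glued side (generates the vertex identification) *)
Definition cadj : rel (F * 'I_3) := fun c c' =>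
  [exists s, exists s', glued s s' &&
     (((c == (s.1, nx s.2)) && (c' == (s'.1, nx (nx s'.2)))) ||
      ((c == (s.1, nx (nx s.2))) && (c' == (s'.1, nx s'.2))))].

Definition fadj : rel F := fun f f' => [exists i, exists j, te f i == te f' j].

(** Finite, connected, oriented triangulated surface (possibly with boundary):
   every edge is a side of one or two triangles, glued sides are identified
   orientation-reversingly (consistent orientation), the link of each vertex is
   connected (all corners at a vertex are identified through gluings: no
   pinched points), every vertex is a corner, and the surface is connected and
   nonempty. *)
Definition is_tri_surface : Prop :=
  [/\ (forall e : E, 1 <= #|[set s | sedge s == e]| <= 2)%N,
      (forall s s', glued s s' -> ssrc s = stgt s' /\ stgt s = ssrc s'),
      (forall c c', cvert c = cvert c' -> connect cadj c c'),
      (forall v : V, exists c, cvert c = v) &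
      (forall f f', connect fadj f f') /\
      (0 < #|F|)%N].

Definition bedge (e : E) : bool := #|[set s | sedge s == e]| == 1%N.
Definition bside (s : F * 'I_3) : bool := bedge (sedge s).
Definition bvert (v : V) : bool := [exists s, bside s && ((ssrc s == v) || (stgt s == v))].
Definition incident (v : V) (e : E) : bool :=
  [exists s, (sedge s == e) && ((ssrc s == v) || (stgt s == v))].

Definition tri_chi : int := (#|V|%:Z - #|E|%:Z + #|F|%:Z)%R.

(* number of boundary circles = connected components of the boundary graph *)
Definition bnbr : rel V := fun u v =>
  [exists s, bside s && (((ssrc s == u) && (stgt s == v)) || ((ssrc s == v) && (stgt s == u)))].
Definition nbdry : nat := n_comp bnbr bvert.

End Triangulation.

Definition euler_char (g n : nat) : int := (2 - 2 * g%:Z - n%:Z)%R.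

Inductive geom := Hyperbolic | Euclidean.

Section Geometry.
Context {R : realType}.

Definition coshR (x : R) : R := (expR x + expR (- x)) / 2.
Definition sinhR (x : R) : R := (expR x - expR (- x)) / 2.
Definition acoshR (x : R) : R := ln (x + Num.sqrt (x ^+ 2 - 1)).

Definition edge_len (G : geom) (ri rj th : R) : R :=
  match G with
  | Hyperbolic => acoshR (coshR ri * coshR rj + sinhR ri * sinhR rj * cos th)
  | Euclidean => Num.sqrt (ri ^+ 2 + rj ^+ 2 + 2 * ri * rj * cos th)
  end.

Definition tri_angle (G : geom) (a b c : R) : R :=
  match G with
  | Hyperbolic => acos ((coshR b * coshR c - coshR a) / (sinhR b * sinhR c))
  | Euclidean => acos ((b ^+ 2 + c ^+ 2 - a ^+ 2) / (2 * b * c))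
  end.

Context {V E F : finType} (tv : F -> 'I_3 -> V) (te : F -> 'I_3 -> E).

Definition side_len (G : geom) (Th : E -> R) (r : V -> R) (s : F * 'I_3) : R :=
  edge_len G (r (ssrc tv s)) (r (stgt tv s)) (Th (sedge te s)).

Definition corner_angle (G : geom) (Th : E -> R) (r : V -> R) (c : F * 'I_3) : R :=
  tri_angle G (side_len G Th r c) (side_len G Th r (c.1, nx c.2))
    (side_len G Th r (c.1, nx (nx c.2))).

Definition cone_angle (G : geom) (Th : E -> R) (r : V -> R) (v : V) : R :=
  \sum_(c : F * 'I_3 | cvert tv c == v) corner_angle G Th r c.

Definition curv (G : geom) (Th : E -> R) (r : V -> R) (v : V) : R :=
  (if bvert tv te v then pi else 2 * pi) - cone_angle G Th r v.

Definition C1 (Th : E -> R) : Prop :=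
  forall (f : F) (i : 'I_3),
    0 <= cos (Th (te f i)) + cos (Th (te f (nx i))) * cos (Th (te f (nx (nx i)))).

End Geometry.

Section Flow.
Context {R : realType} {V E F : finType} (tv : F -> 'I_3 -> V) (te : F -> 'I_3 -> E).

Local Open Scope ring_scope.

Definition curvature_vector (G : geom) (chi : int) (k : V -> R) : Prop :=
  (forall v, k v < (if bvert tv te v then pi else 2 * pi)) /\
  match G with
  | Hyperbolic => 2 * pi * chi%:~R < \sum_v k v
  | Euclidean => \sum_v k v = 2 * pi * chi%:~R
  end.

(* chi(G(A) \ boundary) and chi(G(A) cap boundary), G(A) = open cells with a vertex in A *)
Definition chi_GA_int (A : {set V}) : int :=
  (#|[set v in A | ~~ bvert tv te v]|%:Z
   - #|[set e | [exists v in A, incident tv te v e] && ~~ bedge te e]|%:Z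
   + #|[set f | [exists i, tv f i \in A]]|%:Z)%R.
Definition chi_GA_bdry (A : {set V}) : int :=
  (#|[set v in A | bvert tv te v]|%:Z
   - #|[set e | [exists v in A, incident tv te v e] && bedge te e]|%:Z)%R.

(* Lk(A): pairs (e, v), v in A, e opposite to v in a triangle, e with no endpoint in A;
   enumerated through the corners c = (f, i) *)
Definition in_link (A : {set V}) (c : F * 'I_3) : bool :=
  (cvert tv c \in A) && [forall v in A, ~~ incident tv te v (sedge te c)].

Definition attainable (Th : E -> R) (k : V -> R) : Prop :=
  forall A : {set V}, A != finset.set0 -> A != [set: V] ->
    \sum_(v in A) k v >
      - (\sum_(c | in_link A c) (pi - Th (sedge te c)))
      + 2 * pi * (chi_GA_int A)%:~R + pi * (chi_GA_bdry A)%:~R.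

Local Open Scope classical_set_scope.

Definition flow_rhs (G : geom) (Th : E -> R) (k : V -> R) (x : V -> R) (v : V) : R :=
  (k v - curv tv te G Th x v) *
  match G with Hyperbolic => sinhR (x v) | Euclidean => x v end.

Definition flow_sol_on (G : geom) (Th : E -> R) (k : V -> R) (r0 : V -> R)
    (T : \bar R) (r : R -> V -> R) : Prop :=
  [/\ r 0 = r0,
      (forall t : R, 0 <= t -> (t%:E < T)%E -> forall v, 0 < r t v),
      (forall v, (fun s => r s v) @ 0^'+ --> r0 v) &
      (forall t : R, 0 < t -> (t%:E < T)%E -> forall v,
         derivable (fun s => r s v) t 1 /\
         (fun s => r s v)^`() t = flow_rhs G Th k (r t) v)].

Definition converges_pos (r : R -> V -> R) (rs : V -> R) : Prop :=
  (forall v, 0 < rs v) /\ (forall v, (fun t => r t v) @ +oo --> rs v).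

End Flow.

(* Main.v *)
Require Import Defs.
From HB Require Import structures.
From mathcomp Require Import all_boot all_order all_algebra.
From mathcomp Require Import all_classical all_reals all_analysis.
From mathcomp Require Import ring lra.
Set Implicit Arguments. Unset Strict Implicit. Unset Printing Implicit Defensive.
Import Order.TTheory GRing.Theory Num.Theory.
Import numFieldNormedType.Exports.
Local Open Scope ring_scope.

(** In the coordinate u with du = dr / s(r), where s is sinh or the identity,
   the flow reads u' = f(u), and on each triangle the derivative of the angles
   is a symmetric weighted graph Laplacian minus a nonnegative diagonal (zero in
   the Euclidean case).  Condition (C1) makes the weights nonnegative, with at
   most one of them zero in each triangle.  Hence the squared distance in u
   between two solutions decreases: this gives uniqueness, and exponential
   convergence to an equilibrium as soon as there is one.  Since f is bounded
   and Lipschitz, Picard iteration gives global solutions; in the hyperbolic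
   case radii stay bounded because the angles at a large disc are small.

   An equilibrium is found by Perron's method, as the infimum w of the radius
   vectors bounded by M at which f <= 0 wherever the bound M is not reached.
   If w vanished exactly on a nonempty set A, then the sum of f over A would
   tend to the slack in the inequality of attainability for A or, when A = V, in
   the condition on the total curvature; this slack is positive, except in the
   Euclidean case with A = V, where some radius vector below M has f <= 0
   everywhere, and f = 0 because the sum of f vanishes.  Conversely, the
   angles of a triangle at the corners in A are strictly dominated by their
   limits as the radii in A shrink to 0, so that every equilibrium forces
   attainability. *)

(** Everything local rests on polynomial identities. The determinant [Dtri] whose positivity makes
    three lengths the sides of a triangle, the weights [Wtri] and the diagonal [Ztri] are sums of
    products of positive functions of the radii with one of 1 - I_i^2, I_i + I_j I_l and 1 + I_i I_j
    I_l. All three are nonnegative under (C1), so that triangle inequalities, signs and bounds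
    follow term by term.

    Two noncompact directions remain. When radii tend to 0, the weights stay bounded and so does the
    speed of u; hence u cannot reach -oo in finite time. When hyperbolic radii grow, the field is
    cut off at a level that the flow never passes, and the cut-off field is globally Lipschitz.

    In the Euclidean case f is invariant under scaling, so constant vectors lie in the kernel of the
    Laplacian and an equilibrium is never isolated. By Gauss-Bonnet the flow preserves the sum of
    the u_v; an equilibrium is rescaled to have the same sum, and on the differences, which have
    mean zero, a Poincaré inequality on the connected surface replaces the missing diagonal. *)

Section Calculus.
Context {R : realType}.
Implicit Types (f g : R -> R) (x a b : R).

Lemma isdD f g x a b : is_derive x 1 f a -> is_derive x 1 g b ->
  is_derive x 1 (fun t => f t + g t) (a + b).
Proof. by move=> *; exact: is_deriveD. Qed.

Lemma isdB f g x a b : is_derive x 1 f a -> is_derive x 1 g b ->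
  is_derive x 1 (fun t => f t - g t) (a - b).
Proof. by move=> *; exact: is_deriveB. Qed.

Lemma isdN f x a : is_derive x 1 f a -> is_derive x 1 (fun t => - f t) (- a).
Proof. by move=> *; exact: is_deriveN. Qed.

Lemma isdM f g x a b : is_derive x 1 f a -> is_derive x 1 g b ->
  is_derive x 1 (fun t => f t * g t) (f x * b + g x * a).
Proof. by move=> *; exact: is_deriveM. Qed.

Lemma isdC (c : R) x : is_derive x 1 (fun=> c) 0.
Proof. exact: is_derive_cst. Qed.

Lemma isdcM (c : R) f x a : is_derive x 1 f a ->
  is_derive x 1 (fun t => c * f t) (c * a).
Proof.
by move=> h; apply: is_derive_eq (isdM (isdC c x) h) _; rewrite mulr0 addr0.
Qed.

Lemma isd_comp f g x a b : is_derive (g x) 1 f a -> is_derive x 1 g b ->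
  is_derive x 1 (fun t => f (g t)) (a * b).
Proof. by move=> *; exact: is_derive1_comp. Qed.

Lemma isdV f x a : f x != 0 -> is_derive x 1 f a ->
  is_derive x 1 (fun t => (f t)^-1) (- (f x ^- 2 * a)).
Proof. by move=> h1 h2; apply: is_derive_eq (is_deriveV h1 h2) _; rewrite scaleNr. Qed.

Lemma isd_sum (T : finType) (P : pred T) (f : T -> R -> R) x (a : T -> R) :
  (forall i, P i -> is_derive x 1 (f i) (a i)) ->
  is_derive x 1 (fun t => \sum_(i | P i) f i t) (\sum_(i | P i) a i).
Proof.
move=> h; rewrite unlock /=; elim: (index_enum T) => [|i r ih] /=.
  exact: isdC.
by case: ifP => // Pi; apply: isdD => //; exact: h.
Qed.

Lemma isd_line (a b : R) x : is_derive x 1 (fun t => a + t * b) b.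
Proof.
apply: is_derive_eq (isdD (isdC a x) (isdM (is_derive_id x 1) (isdC b x))) _.
by rewrite mulr0 mulr1 !add0r.
Qed.

Lemma isd_cont f x a : is_derive x 1 f a -> {for x, continuous f}.
Proof.
by move=> [h _]; apply/differentiable_continuous/derivable1_diffP.
Qed.

Lemma mvt f (df : R -> R) a b : a < b ->
  (forall x, a <= x <= b -> is_derive x 1 f (df x)) ->
  exists2 c, a < c < b & f b - f a = df c * (b - a).
Proof.
move=> ab h; have [||c] := @MVT R f df a b ab.
- by move=> x; rewrite in_itv /= => /andP[/ltW xa /ltW xb]; apply: h; rewrite xa.
- apply: continuous_in_subspaceT => x /set_mem /=; rewrite in_itv /= => xab.
  exact: isd_cont (h x xab).
by rewrite in_itv /= => ? ?; exists c.
Qed.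

Lemma isd_nincr f (df : R -> R) a b : a <= b ->
  (forall x, a <= x <= b -> is_derive x 1 f (df x)) ->
  (forall x, a < x < b -> df x <= 0) -> f b <= f a.
Proof.
rewrite le_eqVlt => /predU1P[->//|ab] h h0.
have [c cab e] := mvt ab h; rewrite -subr_le0 e pmulr_lle0 ?subr_gt0 //.
exact: h0.
Qed.

End Calculus.

Unset Implicit Arguments.

(** * Limits of real functions along a filter *)

Section Limits.
Context {R : realType} {T : Type} {F : set_system T} {FF : Filter F}.
Implicit Types (f g : T -> R) (a b : R).
Local Open Scope classical_set_scope.

Lemma cvC a : (fun=> a) @ F --> a.
Proof. exact: cvg_cst. Qed.

Lemma cvD {f g a b} : f @ F --> a -> g @ F --> b -> (fun t => f t + g t) @ F --> a + b.
Proof. by move=> *; exact: cvgD. Qed.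

Lemma cvB {f g a b} : f @ F --> a -> g @ F --> b -> (fun t => f t - g t) @ F --> a - b.
Proof. by move=> *; exact: cvgB. Qed.

Lemma cvM {f g a b} : f @ F --> a -> g @ F --> b -> (fun t => f t * g t) @ F --> a * b.
Proof. by move=> *; exact: cvgM. Qed.

Lemma cvV {f a} : a != 0 -> f @ F --> a -> (fun t => (f t)^-1) @ F --> a^-1.
Proof. by move=> *; exact: cvgV. Qed.

Lemma cvK {h : R -> R} {f a} : {for a, continuous h} -> f @ F --> a ->
  (fun t => h (f t)) @ F --> h a.
Proof. by move=> *; exact: (@continuous_cvg _ _ _ _ _ f h). Qed.

Lemma cv_near {f g a} : f @ F --> a -> (\forall t \near F, f t = g t) -> g @ F --> a.
Proof. by move=> fa fg; apply: cvg_trans fa; exact: near_eq_cvg. Qed.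

Lemma cv_sum {I : finType} {P : pred I} {f : I -> T -> R} {a : I -> R} :
  (forall i, P i -> f i @ F --> a i) ->
  (fun t => \sum_(i | P i) f i t) @ F --> \sum_(i | P i) a i.
Proof.
move=> h; rewrite unlock /=; elim: (index_enum I) => [|i r ih] /=.
  exact: cvC.
by case: ifP => // Pi; apply: cvD => //; exact: h.
Qed.

End Limits.

Set Implicit Arguments.

Lemma nxE (i : 'I_3) : nx i = (i.+1 %% 3)%N :> nat.
Proof. by rewrite /nx inordK // ltn_mod. Qed.

Lemma nx3 (i : 'I_3) : nx (nx (nx i)) = i.
Proof. by apply/val_inj; rewrite /= !nxE; case: i => [[|[|[|]]]]. Qed.

(** * Angles of a triangle of discs and their derivatives *)

(* Both geometries at once: (k, p, s) = (1, cosh r - 1, sinh r) in the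
   hyperbolic case and (0, r^2 / 2, r) in the Euclidean one.  For the length l
   of the side opposite to a corner, [mlen] is then cosh l - 1, resp. l^2 / 2,
   and [nlen] is sinh^2 l, resp. l^2. *)
Section Triple.
Context {R : realType} (k : R) (p s I : 'I_3 -> R).
Implicit Type i : 'I_3.

(** This is cosh r, resp. 1, the derivative of s in r. *)
Definition gfac i := 1 + k * p i.
Definition mlen i :=
  p (nx i) + p (nx (nx i)) + k * p (nx i) * p (nx (nx i)) +
  s (nx i) * s (nx (nx i)) * I i.
Definition nlen i := mlen i * (2 + k * mlen i).
(** Numerator of the law of cosines: cosh b cosh c - cosh a, resp. (b^2 + c^2 - a^2) / 2, for the
    side a opposite to corner i. *)
Definition Nang i := mlen (nx i) + mlen (nx (nx i)) - mlen i
  + k * mlen (nx i) * mlen (nx (nx i)).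
(** The squared sine of an angle, cleared of denominators. It is the same at all corners ([DtriE]);
    in the Euclidean case it is (2 area)^2. *)
Definition Dtri := nlen (nx ord0) * nlen (nx (nx ord0)) - Nang ord0 ^+ 2.
Definition ang i := acos (Nang i / Num.sqrt (nlen (nx i) * nlen (nx (nx i)))).

Definition sinI2 i := 1 - I i ^+ 2.
Definition C1term i := I i + I (nx i) * I (nx (nx i)).
(** Numerator of the Laplacian weight of the side opposite to corner i. Each term carries a factor
    [sinI2] or [C1term], whence its sign. *)
Definition Wtri i :=
  let j := nx i in let l := nx j in
  s j * s l * (gfac i * s j * s l * sinI2 i + gfac j * s l * s i * C1term l
               + gfac l * s j * s i * C1term j).

Hypothesis hs : forall i, s i ^+ 2 = p i * (2 + k * p i).

Lemma Dtri_nx i : nlen (nx i) * nlen (nx (nx i)) - Nang i ^+ 2 =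
  nlen (nx (nx i)) * nlen i - Nang (nx i) ^+ 2.
Proof. rewrite /Nang nx3 /nlen; ring. Qed.

Lemma nx_ind (P : 'I_3 -> Prop) :
  P ord0 -> (forall i, P i -> P (nx i)) -> forall i, P i.
Proof.
move=> P0 PS i.
have e : i = iter i nx ord0.
  by apply/val_inj; case: i => [[|[|[|]]]] //= _; rewrite ?nxE.
by rewrite e; elim: (nat_of_ord i) => //= n; exact: PS.
Qed.

Lemma DtriE i : nlen (nx i) * nlen (nx (nx i)) - Nang i ^+ 2 = Dtri.
Proof. by elim/nx_ind: i => // i <-; rewrite nx3 -Dtri_nx. Qed.

(** An expansion in which (C1) makes every term nonnegative. Dropping terms gives the lower bounds
    on [Dtri]; conversely every single term is at most [Dtri]. *)
Lemma Dtri_gram i : let j := nx i in let l := nx j in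
  Dtri = s j ^+ 2 * s l ^+ 2 * sinI2 i + s l ^+ 2 * s i ^+ 2 * sinI2 j
       + s i ^+ 2 * s j ^+ 2 * sinI2 l
       + 2 * (gfac j * gfac l * s j * s l * s i ^+ 2 * C1term i
            + gfac l * gfac i * s l * s i * s j ^+ 2 * C1term j
            + gfac i * gfac j * s i * s j * s l ^+ 2 * C1term l)
       + 2 * k * s i ^+ 2 * s j ^+ 2 * s l ^+ 2 * (1 + I i * I j * I l).
Proof.
move=> j l; rewrite -(DtriE i) /Nang /nlen /mlen /sinI2 /C1term /gfac !nx3 -/j -/l.
have h0 := hs i; have h1 := hs j; have h2 := hs l.
ring: h0 h1 h2.
Qed.

Hypotheses (k0 : 0 <= k) (p_gt0 : forall i, 0 < p i) (s_gt0 : forall i, 0 < s i).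
Hypotheses (I_gtN1 : forall i, -1 < I i) (I_le1 : forall i, I i <= 1).
Hypothesis C1term_ge0 : forall i, 0 <= C1term i.

Lemma gam_gt0 i : 0 < gfac i.
Proof. by rewrite ltr_wpDr ?mulr_ge0 // ltW. Qed.

Lemma sinI2_ge0 i : 0 <= sinI2 i.
Proof. by have := I_gtN1 i; have := I_le1 i; rewrite /sinI2; nra. Qed.

Lemma III_ge0 i : 0 <= 1 + I i * I (nx i) * I (nx (nx i)).
Proof.
have h j : `|I j| <= 1 by rewrite ler_norml I_le1 ltW.
have : `|I i * I (nx i) * I (nx (nx i))| <= 1.
  by rewrite !normrM !mulr_ile1 // mulr_ge0.
by rewrite ler_norml => /andP[? _]; lra.
Qed.

(** For [I i = -1] the length would be the difference of the two radii, whose [mlen] is nonnegative;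
    what remains is the left side. *)
Lemma mlen_ge i : (1 + I i) * (s (nx i) * s (nx (nx i))) <= mlen i.
Proof.
set a := nx i; set b := nx a.
suff h : s a * s b <= p a + p b + k * p a * p b by rewrite /mlen -/a -/b; lra.
have pa := p_gt0 a; have pb := p_gt0 b.
have pab : 0 <= k * p a * p b by rewrite !mulr_ge0 ?(ltW pa) ?(ltW pb).
rewrite -(@ler_pXn2r _ 2%N) ?nnegrE //; last 2 first.
- by rewrite mulr_ge0 // ltW.
- by rewrite !addr_ge0 // ltW.
rewrite exprMn !hs.
rewrite -subr_ge0.
have e x y : (x + y + k * x * y) ^+ 2 - x * (2 + k * x) * (y * (2 + k * y))
  = (x - y) ^+ 2 by ring.
by rewrite e sqr_ge0.
Qed.

Lemma mlen_gt0 i : 0 < mlen i.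
Proof.
apply: lt_le_trans (mlen_ge i).
by rewrite !mulr_gt0 // -ltrBlDl sub0r.
Qed.

Lemma nlen_ge i : 2 * mlen i <= nlen i.
Proof.
have := mlen_gt0 i; rewrite /nlen => m0.
have : 0 <= k * (mlen i * mlen i) by rewrite !mulr_ge0 // ltW.
lra.
Qed.

Lemma nlen_gt0 i : 0 < nlen i.
Proof. by apply: lt_le_trans (nlen_ge i); rewrite mulr_gt0 // mlen_gt0. Qed.

(** What is left of [Wtri i] when all factors that depend on the radii are replaced by 1: if s is at
    least c, then [Wtri i] is at least c ^+ 4 times this. *)
Definition EE i := sinI2 i + C1term (nx i) + C1term (nx (nx i)).

Lemma EE_ge0 i : 0 <= EE i.
Proof.
have := sinI2_ge0 i; have := C1term_ge0 (nx i); have := C1term_ge0 (nx (nx i)).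
rewrite /EE; lra.
Qed.

(* [EE i = (1 + I i) (1 - I i + I j + I l)], and no two of these can vanish
   together because [I j + I l - I i + 1 = I i + I l - I j + 1 = 0] forces
   [I l = -1]. *)
Lemma EE_gt0 i : 0 < EE i + EE (nx i).
Proof.
have e j : EE j = (1 + I j) * (1 - I j + I (nx j) + I (nx (nx j))).
  by rewrite /EE /sinI2 /C1term !nx3; ring.
have := EE_ge0 i; have := EE_ge0 (nx i).
rewrite !e !nx3; have := I_gtN1 i; have := I_gtN1 (nx i).
have := I_gtN1 (nx (nx i)).
move: (I i) (I (nx i)) (I (nx (nx i))) => x y z hz hy hx.
have x0 : 0 < 1 + x by lra.
have y0 : 0 < 1 + y by lra.
rewrite (pmulr_rge0 _ x0) (pmulr_rge0 _ y0) => b0 a0.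
have [a1|a1] := ltP 0 (1 - x + y + z).
  by rewrite ltr_pwDl ?mulr_ge0 ?mulr_gt0 // ltW.
by rewrite ltr_wpDl ?mulr_ge0 ?mulr_gt0 ?(ltW x0) //; lra.
Qed.

(** If both [sinI2] vanish, the two cosines are 1 and [C1term i] becomes I i + 1. *)
Lemma sinI2_C1term_gt0 i : 0 < sinI2 (nx i) + sinI2 (nx (nx i)) + 2 * C1term i.
Proof.
have J1 := sinI2_ge0 (nx i); have J2 := sinI2_ge0 (nx (nx i)); have P0 := C1term_ge0 i.
have [h1|h1] := ltP (I (nx i)) 1.
  suff : 0 < sinI2 (nx i) by lra.
  by have := I_gtN1 (nx i); rewrite /sinI2; nra.
have [h2|h2] := ltP (I (nx (nx i))) 1.
  suff : 0 < sinI2 (nx (nx i)) by lra.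
  by have := I_gtN1 (nx (nx i)); rewrite /sinI2; nra.
suff : 0 < C1term i by lra.
have -> : C1term i = I i + 1.
  by rewrite /C1term (le_anti (introT andP (conj (I_le1 (nx i)) h1)))
             (le_anti (introT andP (conj (I_le1 (nx (nx i))) h2))) mulr1.
by have := I_gtN1 i; lra.
Qed.

Lemma gam_ge1 i : 1 <= gfac i.
Proof. by rewrite lerDl mulr_ge0 // ltW. Qed.

Lemma term_ge0 i j l : 0 <= s j * s l * s i ^+ 2.
Proof. by rewrite !mulr_ge0 ?exprn_ge0 ?ltW. Qed.

Lemma gamM_ge1 i j : 1 <= gfac i * gfac j.
Proof. by rewrite -[1]mulr1 ler_pM ?gam_ge1. Qed.

Lemma Dtri_ge i :
  s i ^+ 2 * (s (nx (nx i)) ^+ 2 * sinI2 (nx i) + s (nx i) ^+ 2 * sinI2 (nx (nx i))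
    + 2 * (s (nx i) * s (nx (nx i)) * C1term i)) <= Dtri.
Proof.
rewrite (Dtri_gram i); set j := nx i; set l := nx j.
have h1 : 0 <= s j ^+ 2 * s l ^+ 2 * sinI2 i.
  by rewrite mulr_ge0 ?sinI2_ge0 // mulr_ge0 // sqr_ge0.
have h2 : 0 <= 2 * k * s i ^+ 2 * s j ^+ 2 * s l ^+ 2 * (1 + I i * I j * I l).
  by rewrite mulr_ge0 ?III_ge0 // !(mulr_ge0, exprn_ge0) // ltW.
have h3 : s j * s l * s i ^+ 2 * C1term i <= gfac j * gfac l * s j * s l * s i ^+ 2 * C1term i.
  rewrite ler_wpM2r // -!mulrA [leRHS]mulrA ler_peMl ?gamM_ge1 //.
  by rewrite mulrA term_ge0.
have h4 : 0 <= gfac l * gfac i * s l * s i * s j ^+ 2 * C1term j.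
  by rewrite !mulr_ge0 ?sqr_ge0 ?(ltW (gam_gt0 _)) ?(ltW (s_gt0 _)).
have h5 : 0 <= gfac i * gfac j * s i * s j * s l ^+ 2 * C1term l.
  by rewrite !mulr_ge0 ?sqr_ge0 ?(ltW (gam_gt0 _)) ?(ltW (s_gt0 _)).
lra.
Qed.

Lemma Dtri_min i (c : R) : 0 <= c -> c <= s (nx i) -> c <= s (nx (nx i)) ->
  s i ^+ 2 * c ^+ 2 * (sinI2 (nx i) + sinI2 (nx (nx i)) + 2 * C1term i) <= Dtri.
Proof.
move=> c0 cj cl; apply: le_trans (Dtri_ge i).
rewrite -mulrA ler_wpM2l ?sqr_ge0 //.
have h1 : c ^+ 2 <= s (nx i) ^+ 2 by rewrite lerXn2r ?nnegrE // ltW.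
have h2 : c ^+ 2 <= s (nx (nx i)) ^+ 2 by rewrite lerXn2r ?nnegrE // ltW.
have h3 : c ^+ 2 <= s (nx i) * s (nx (nx i)) by rewrite expr2 ler_pM.
have J1 := sinI2_ge0 (nx i); have J2 := sinI2_ge0 (nx (nx i)); have P0 := C1term_ge0 i.
have := ler_wpM2r J1 h2; have := ler_wpM2r J2 h1; have := ler_wpM2r P0 h3.
lra.
Qed.

Lemma Dtri_gt0 : 0 < Dtri.
Proof.
pose c := Num.min (s (nx ord0)) (s (nx (nx ord0))).
have c0 : 0 < c by rewrite lt_min !s_gt0.
apply: lt_le_trans (@Dtri_min ord0 c (ltW c0) _ _);
  rewrite ?ge_min ?lexx ?orbT //.
by rewrite !mulr_gt0 ?exprn_gt0 ?sinI2_C1term_gt0.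
Qed.

Local Notation q i := (Num.sqrt (nlen i)).
Local Notation d := (Num.sqrt Dtri).

Lemma sqrtn_gt0 i : 0 < q i. Proof. by rewrite sqrtr_gt0 nlen_gt0. Qed.
Lemma sqrtn_sqr i : q i ^+ 2 = nlen i.
Proof. by rewrite sqr_sqrtr // ltW ?nlen_gt0. Qed.
Lemma sqrtD_gt0 : 0 < d. Proof. by rewrite sqrtr_gt0 Dtri_gt0. Qed.
Lemma sqrtD_sqr : d ^+ 2 = Dtri.
Proof. by rewrite sqr_sqrtr // ltW ?Dtri_gt0. Qed.

Lemma angE i : ang i = acos (Nang i / (q (nx i) * q (nx (nx i)))).
Proof. by rewrite /ang sqrtrM // ltW ?nlen_gt0. Qed.

Lemma qq_gt0 i : 0 < q (nx i) * q (nx (nx i)).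
Proof. by rewrite mulr_gt0 ?sqrtn_gt0. Qed.

Lemma Nang_lt i : `|Nang i| < q (nx i) * q (nx (nx i)).
Proof.
rewrite -ltr_sqr ?nnegrE ?normr_ge0 ?ltW ?qq_gt0 // real_normK ?num_real //.
by rewrite exprMn !sqrtn_sqr -subr_gt0 DtriE Dtri_gt0.
Qed.

Lemma cosarg i : -1 < Nang i / (q (nx i) * q (nx (nx i))) < 1.
Proof.
have := Nang_lt i; rewrite ltr_norml => /andP[h1 h2].
by rewrite ltr_pdivrMr ?ltr_pdivlMr ?qq_gt0 // mul1r mulN1r h1.
Qed.

Lemma cos_ang i : cos (ang i) = Nang i / (q (nx i) * q (nx (nx i))).
Proof.
by rewrite angE acosK // in_itv /=; have /andP[/ltW -> /ltW ->] := cosarg i.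
Qed.

Lemma ang_gt0 i : 0 < ang i.
Proof. by rewrite angE acos_gt0 //; have /andP[/ltW -> ->] := cosarg i. Qed.

Lemma ang_ltpi i : ang i < pi.
Proof. by rewrite angE acos_ltpi //; have /andP[-> /ltW ->] := cosarg i. Qed.

Lemma sqrt1B_arg i : Num.sqrt (1 - (Nang i / (q (nx i) * q (nx (nx i)))) ^+ 2)
   = d / (q (nx i) * q (nx (nx i))).
Proof.
have h := qq_gt0 i.
apply: (@pexpIrn _ 2) => //; rewrite ?nnegrE ?sqrtr_ge0 ?divr_ge0 ?sqrtr_ge0 // ?ltW //.
have e : 1 - (Nang i / (q (nx i) * q (nx (nx i)))) ^+ 2 =
   (d / (q (nx i) * q (nx (nx i)))) ^+ 2.
  rewrite !exprMn exprVn sqrtD_sqr exprMn !sqrtn_sqr -(DtriE i).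
  have := nlen_gt0 (nx i); have := nlen_gt0 (nx (nx i)).
  by move=> h1 h2; field; rewrite !gt_eqF.
by rewrite e sqr_sqrtr ?sqr_ge0.
Qed.

Lemma sin_ang i : sin (ang i) = d / (q (nx i) * q (nx (nx i))).
Proof.
rewrite angE sin_acos ?sqrt1B_arg //.
by have /andP[/ltW -> /ltW ->] := cosarg i.
Qed.

(** The sine of the sum is a positive multiple of the sum of the two [Nang], in which the opposite
    linear terms cancel and only positive ones remain. As both angles lie below pi, a positive sine
    forces the sum below pi. *)
Lemma ang_pair i : ang i + ang (nx i) < pi.
Proof.
have s0 : 0 < sin (ang i + ang (nx i)).
  rewrite sinD !sin_ang !cos_ang !nx3.
  have -> : forall a b c d N M : R, d / (b * c) * (N / (c * a)) +
     M / (b * c) * (d / (c * a)) = d / (b * c) / (c * a) * (N + M).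
    by move=> a b c d' N M; rewrite !invfM; ring.
  rewrite mulr_gt0 ?divr_gt0 ?sqrtD_gt0 ?mulr_gt0 ?sqrtn_gt0 //.
  rewrite /Nang !nx3.
  have := mlen_gt0 i; have := mlen_gt0 (nx i); have := mlen_gt0 (nx (nx i)).
  move: (mlen i) (mlen (nx i)) (mlen (nx (nx i))) => x y z z0 y0 x0.
  have -> : z + x - y + k * z * x + (y + z - x + k * y * z) =
    2 * z + k * (z * (x + y)) by ring.
  by rewrite ltr_wpDr ?mulr_ge0 ?addr_ge0 ?mulr_gt0 // ltW.
rewrite ltNge; apply/negP => h.
have : 0 <= sin (ang i + ang (nx i) - pi).
  apply: sin_ge0_pi; rewrite subr_ge0 h /=.
  have := ang_ltpi i; have := ang_ltpi (nx i); lra.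
by rewrite sinB sinpi cospi mulr0 subr0 mulrN1; lra.
Qed.

Definition asum i := ang i + ang (nx i) + ang (nx (nx i)).
Definition msum i := mlen i + mlen (nx i) + mlen (nx (nx i)).
Definition mprod i := mlen i * mlen (nx i) * mlen (nx (nx i)).
Definition nprod i := nlen i * nlen (nx i) * nlen (nx (nx i)).

Lemma nprod_sqr i : nprod i = (q i * q (nx i) * q (nx (nx i))) ^+ 2.
Proof. by rewrite !exprMn !sqrtn_sqr. Qed.

Lemma cos_asum_aux i :
  cos (asum i) * nprod i = nprod i - mprod i * (4 + k * msum i) ^+ 2.
Proof.
have q1 := sqrtn_gt0 i; have q2 := sqrtn_gt0 (nx i).
have q3 := sqrtn_gt0 (nx (nx i)).
have e : cos (asum i) * nprod i =
  Nang i * Nang (nx i) * Nang (nx (nx i)) -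
  d ^+ 2 * (Nang i + Nang (nx i) + Nang (nx (nx i))).
  rewrite /asum !cosD !sinD !sin_ang !cos_ang !nx3 nprod_sqr; field.
  by rewrite !gt_eqF.
rewrite e sqrtD_sqr -(DtriE i) /mprod /nprod /msum /Nang /nlen !nx3; ring.
Qed.

Lemma mprod_gt0 i : 0 < mprod i.
Proof. exact: mulr_gt0 (mulr_gt0 (mlen_gt0 _) (mlen_gt0 _)) (mlen_gt0 _). Qed.
Lemma nprod_gt0 i : 0 < nprod i.
Proof. exact: mulr_gt0 (mulr_gt0 (nlen_gt0 _) (nlen_gt0 _)) (nlen_gt0 _). Qed.

Definition mden i :=
  (2 + k * mlen i) * (2 + k * mlen (nx i)) * (2 + k * mlen (nx (nx i))).

(** The right side is continuous in the [mlen], even where radii vanish and single angles have no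
    limit; [cvg_sum_angG] depends on this. For k = 0 it is -1. *)
Lemma cos_asum i : cos (asum i) = 1 - (4 + k * msum i) ^+ 2 / mden i.
Proof.
have h := cos_asum_aux i; have n0 := nprod_gt0 i; have m0 := mprod_gt0 i.
have np : nprod i = mprod i * mden i by rewrite /nprod /mprod /mden /nlen; ring.
have d0 : mden i != 0.
  by apply: contraTneq n0 => d0; rewrite np d0 mulr0 ltxx.
apply: (mulIf (lt0r_neq0 n0)); rewrite h np; field.
by rewrite d0.
Qed.

(** The sine of the angle sum is nonnegative and the sum is below 2 pi, hence it is at most pi. *)
Lemma sin_asum i : sin (asum i) * nprod i = d * (k * mprod i * (4 + k * msum i)).
Proof.
have q1 := sqrtn_gt0 i; have q2 := sqrtn_gt0 (nx i).
have q3 := sqrtn_gt0 (nx (nx i)).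
have e : sin (asum i) * nprod i =
  d * (Nang i * Nang (nx i) + Nang (nx i) * Nang (nx (nx i)) +
       Nang (nx (nx i)) * Nang i - d ^+ 2).
  rewrite /asum sinD cosD sinD !sin_ang !cos_ang !nx3 nprod_sqr; field.
  by rewrite !gt_eqF.
rewrite e sqrtD_sqr -(DtriE i) /mprod /msum /Nang /nlen !nx3; ring.
Qed.

Lemma msum_gt0 i : 0 < 4 + k * msum i.
Proof.
have := mlen_gt0 i; have := mlen_gt0 (nx i); have := mlen_gt0 (nx (nx i)).
by move=> ? ? ?; rewrite ltr_wpDr // mulr_ge0 // /msum; lra.
Qed.

Lemma asum_lt i : asum i < 2 * pi.
Proof.
have := ang_pair i; have := ang_ltpi (nx (nx i)); rewrite /asum; lra.
Qed.

Lemma asum_gt0 i : 0 < asum i.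
Proof. by rewrite !addr_gt0 ?ang_gt0. Qed.

Lemma asum_le i : asum i <= pi.
Proof.
have h : 0 <= sin (asum i).
  rewrite -(pmulr_lge0 _ (nprod_gt0 i)) sin_asum.
  apply: mulr_ge0; first exact: sqrtr_ge0.
  apply: mulr_ge0 (ltW (msum_gt0 i)).
  exact: mulr_ge0 k0 (ltW (mprod_gt0 i)).
rewrite leNgt; apply/negP => h1.
have : 0 < sin (asum i - pi).
  by apply: sin_gt0_pi; rewrite subr_gt0 h1 /=; have := asum_lt i; lra.
by rewrite sinB sinpi cospi mulr0 subr0 mulrN1; lra.
Qed.

Lemma asum_pi i : k = 0 -> asum i = pi.
Proof.
move=> kz; apply: (@cos_inj R); rewrite ?in_itv /= ?pi_ge0 ?lexx ?asum_le //.
  by rewrite ltW ?asum_gt0.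
rewrite cospi cos_asum /mden kz !mul0r !addr0.
by rewrite (_ : 2 * 2 * 2 = 8) -?expr2; [lra|ring].
Qed.

End Triple.

(** * Derivative of the angles in u: a weighted Laplacian and a diagonal *)

Section Jacobian.
Context {R : realType} (k : R) (p s I : 'I_3 -> R).
Implicit Type i : 'I_3.
Local Notation gam := (gfac k p).
Local Notation m := (mlen k p s I).
Local Notation n := (nlen k p s I).
Local Notation N := (Nang k p s I).
Local Notation JJ := (sinI2 I).
Local Notation PP := (C1term I).
Local Notation W := (Wtri k p s I).
Local Notation EE := (EE I).
Local Notation d := (Num.sqrt (Dtri k p s I)).

(** [dmr i] and [dml i] are the partial derivatives of [mlen i] in u at the corners nx i and nx (nx
    i), since in u the derivatives of p and s are s ^+ 2 and s * gfac. *)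
Definition dmr i := s (nx i) ^+ 2 * gam (nx (nx i))
  + s (nx i) * gam (nx i) * s (nx (nx i)) * I i.
Definition dml i := s (nx (nx i)) ^+ 2 * gam (nx i)
  + s (nx (nx i)) * gam (nx (nx i)) * s (nx i) * I i.

(** Determined by [ZtriE], and written as a sum of terms that are nonnegative under (C1). *)
Definition Ztri i :=
  let j := nx i in let l := nx j in
  2 * gam i * gam j * gam l * s i ^+ 2 * s j * s l * PP i
  + 2 * k * gam i * s i ^+ 2 * s j ^+ 2 * s l ^+ 2 * (1 + I i * I j * I l)
  + (gam i + gam l) * s i ^+ 2 * s j ^+ 2 * JJ l
  + (gam i + gam j) * s i ^+ 2 * s l ^+ 2 * JJ j
  + (gam i + gam l) * s i * s j ^+ 2 * s l * PP j
  + (gam i + gam j) * s i * s j * s l ^+ 2 * PP l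
  + (gam j + gam l) * s i ^+ 2 * s j * s l * PP i
  + 2 * k * gam j * s i ^+ 3 * s j * s l ^+ 2 * PP l
  + 2 * k * gam l * s i ^+ 3 * s j ^+ 2 * s l * PP j.

Definition wtri i := W i / (d * n i).
(** As the Laplacian part is symmetric and kills constants, this is the derivative in u_i of the
    defect pi - (sum of the angles). The factor k removes it in the Euclidean case. *)
Definition atri i :=
  k * Ztri i / (d * ((2 + k * m (nx i)) * (2 + k * m (nx (nx i))))).

Hypothesis hs : forall i, s i ^+ 2 = p i * (2 + k * p i).

(** This and [Wtri_pv] compute the derivatives of angle i in u at the two other corners. Both yield
    the [W] of the side joining the two corners concerned, which is the symmetry of the Jacobian. *)
Lemma Wtri_nx i : n (nx (nx i)) * dmr i - N (nx i) * dml (nx (nx i))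
  = W (nx (nx i)).
Proof.
rewrite /dmr /dml /Wtri /Nang /nlen /mlen /sinI2 /C1term /gfac !nx3.
set j := nx i; set l := nx j.
have h0 := hs i; have h1 := hs j; have h2 := hs l.
ring: h0 h1 h2.
Qed.

Lemma Wtri_pv i : n (nx i) * dml i - N (nx (nx i)) * dmr (nx i) = W (nx i).
Proof.
rewrite /dmr /dml /Wtri /Nang /nlen /mlen /sinI2 /C1term /gfac !nx3.
set j := nx i; set l := nx j.
have h0 := hs i; have h1 := hs j; have h2 := hs l.
ring: h0 h1 h2.
Qed.

Lemma ZtriE i : N (nx (nx i)) * n (nx (nx i)) * dml (nx i)
   + N (nx i) * n (nx i) * dmr (nx (nx i)) =
  W (nx (nx i)) * n (nx i) + W (nx i) * n (nx (nx i))
   + k * Ztri i * m (nx i) * m (nx (nx i)).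
Proof.
rewrite /dmr /dml /Wtri /Ztri /Nang /nlen /mlen /sinI2 /C1term /gfac !nx3.
set j := nx i; set l := nx j.
have h0 := hs i; have h1 := hs j; have h2 := hs l.
ring: h0 h1 h2.
Qed.

Hypotheses (k0 : 0 <= k) (p_gt0 : forall i, 0 < p i) (s_gt0 : forall i, 0 < s i).
Hypotheses (I_gtN1 : forall i, -1 < I i) (I_le1 : forall i, I i <= 1).
Hypothesis C1term_ge0 : forall i, 0 <= PP i.

Let gam0 i : 0 < gam i. Proof. exact: gam_gt0. Qed.
Let gam1 i : 1 <= gam i. Proof. exact: gam_ge1. Qed.
Let JJ0 i : 0 <= JJ i. Proof. exact: sinI2_ge0. Qed.
Let T0 i : 0 <= 1 + I i * I (nx i) * I (nx (nx i)). Proof. exact: III_ge0. Qed.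
Let d0 : 0 < d. Proof. exact: sqrtD_gt0. Qed.
Let n0 i : 0 < n i. Proof. exact: nlen_gt0. Qed.
Let m0 i : 0 < m i. Proof. exact: mlen_gt0. Qed.

Lemma mul_lb (c x y z : R) : 0 <= c -> 1 <= x -> c <= y -> 0 <= z ->
  c * z <= x * y * z.
Proof.
by move=> c0 x1 cy z0; rewrite ler_wpM2r // -[c]mul1r ler_pM.
Qed.

Section LowerBound.
Variable c : R.
Hypotheses (c0 : 0 <= c) (cs : forall i, c <= s i).

Lemma s4_ge i j l h : c ^+ 4 <= s i * s j * s l * s h.
Proof.
have -> : c ^+ 4 = c * c * c * c by ring.
by do 3 ![rewrite ler_pM ?mulr_ge0 //].
Qed.

Lemma Wtri_ge i : c ^+ 4 * EE i <= W i.
Proof.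
rewrite /EE /W; set j := nx i; set l := nx j.
have := mul_lb (exprn_ge0 4 c0) (gam1 i) (s4_ge j l j l) (JJ0 i).
have := mul_lb (exprn_ge0 4 c0) (gam1 j) (s4_ge j l l i) (C1term_ge0 l).
have := mul_lb (exprn_ge0 4 c0) (gam1 l) (s4_ge j l j i) (C1term_ge0 j).
lra.
Qed.

Lemma Ztri_ge i : c ^+ 4 * (EE (nx i) + EE (nx (nx i))) <= Ztri i.
Proof.
rewrite /EE /Ztri !nx3; set j := nx i; set l := nx j.
have c4 := exprn_ge0 4 c0.
have := mul_lb c4 (gam1 i) (s4_ge i i j j) (JJ0 l).
have := mul_lb c4 (gam1 i) (s4_ge i i l l) (JJ0 j).
have := mul_lb c4 (gam1 i) (s4_ge i j j l) (C1term_ge0 j).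
have := mul_lb c4 (gam1 i) (s4_ge i j l l) (C1term_ge0 l).
have := mul_lb c4 (gam1 j) (s4_ge i i j l) (C1term_ge0 i).
have := mul_lb c4 (gam1 l) (s4_ge i i j l) (C1term_ge0 i).
have := mul_lb c4 (gam1 l) (s4_ge i i j j) (JJ0 l).
have := mul_lb c4 (gam1 j) (s4_ge i i l l) (JJ0 j).
have := mul_lb c4 (gam1 l) (s4_ge i j j l) (C1term_ge0 j).
have := mul_lb c4 (gam1 j) (s4_ge i j l l) (C1term_ge0 l).
have : 0 <= c ^+ 4 * PP l by rewrite mulr_ge0.
have : 0 <= c ^+ 4 * PP j by rewrite mulr_ge0.
have : 0 <= c ^+ 4 * PP i by rewrite mulr_ge0.
have : 0 <= c ^+ 4 * JJ j by rewrite mulr_ge0.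
have : 0 <= c ^+ 4 * JJ l by rewrite mulr_ge0.
have s0 h : 0 <= s h by exact: ltW.
have g0 h : 0 <= gam h by exact: ltW.
have : 0 <= 2 * gam i * gam j * gam l * s i ^+ 2 * s j * s l * PP i.
  by rewrite !(mulr_ge0, exprn_ge0).
have : 0 <= 2 * k * gam i * s i ^+ 2 * s j ^+ 2 * s l ^+ 2 * (1 + I i * I j * I l).
  by rewrite mulr_ge0 ?T0 // !(mulr_ge0, exprn_ge0).
have : 0 <= 2 * k * gam j * s i ^+ 3 * s j * s l ^+ 2 * PP l.
  by rewrite !(mulr_ge0, exprn_ge0).
have : 0 <= 2 * k * gam l * s i ^+ 3 * s j ^+ 2 * s l * PP j.
  by rewrite !(mulr_ge0, exprn_ge0).
lra.
Qed.

End LowerBound.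

Lemma W_ge0 i : 0 <= W i.
Proof.
apply: le_trans (@Wtri_ge 0 (lexx 0) _ i) => [|j]; last exact: ltW.
by rewrite expr0n mul0r.
Qed.

Lemma wtri_ge0 i : 0 <= wtri i.
Proof. by rewrite divr_ge0 ?W_ge0 // mulr_ge0 // ltW. Qed.

Lemma Z_ge0 i : 0 <= Ztri i.
Proof.
apply: le_trans (@Ztri_ge 0 (lexx 0) _ i) => [|j]; last exact: ltW.
by rewrite expr0n mul0r.
Qed.

Lemma km_gt0 i : 0 < 2 + k * m i.
Proof. by rewrite ltr_wpDr // mulr_ge0 // ltW. Qed.

Lemma atri_ge0 i : 0 <= atri i.
Proof.
apply: divr_ge0; first by rewrite mulr_ge0 // Z_ge0.
by rewrite !mulr_ge0 // ltW // km_gt0.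
Qed.

(** Through [EE_gt0]: at most one weight of a triangle vanishes. Hence an angle decreases strictly
    when its own disc grows ([angG_anti]). *)
Lemma wtri_gt0 i : 0 < wtri i + wtri (nx i).
Proof.
pose c := Num.min (s ord0) (Num.min (s (nx ord0)) (s (nx (nx ord0)))).
have c0 : 0 < c by rewrite !lt_min !s_gt0.
have cs j : c <= s j.
  have h0 : c <= s ord0 by rewrite ge_min lexx.
  have h1 : c <= s (nx ord0) by rewrite !ge_min lexx orbT.
  have h2 : c <= s (nx (nx ord0)) by rewrite !ge_min lexx !orbT.
  case: j => [[|[|[|]]]] // h.
  - by rewrite (_ : Ordinal h = ord0) //; exact/val_inj.
  - by rewrite (_ : Ordinal h = nx ord0) //; apply/val_inj; rewrite /= nxE.
  - by rewrite (_ : Ordinal h = nx (nx ord0)) //; apply/val_inj; rewrite /= !nxE.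
have lb j : c ^+ 4 * EE j / (d * n j) <= wtri j.
  rewrite ler_wpM2r ?invr_ge0 ?(ltW (mulr_gt0 _ _)) //.
  exact: Wtri_ge (ltW c0) cs j.
have e := EE_gt0 I_gtN1 I_le1 C1term_ge0 i.
apply: lt_le_trans (lerD (lb i) (lb (nx i))).
have c4 : 0 < c ^+ 4 by exact: exprn_gt0.
have E0 j : 0 <= EE j by exact: EE_ge0.
have q j : 0 < c ^+ 4 / (d * n j) by rewrite divr_gt0 // mulr_gt0.
rewrite ![c ^+ 4 * _ / _]mulrAC.
have := E0 i; rewrite le_eqVlt => /predU1P[e0|e0].
  by rewrite -e0 mulr0 add0r mulr_gt0 //; rewrite -e0 add0r in e.
exact: ltr_pwDl (mulr_gt0 (q i) e0) (mulr_ge0 (ltW (q _)) (E0 _)).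
Qed.

End Jacobian.

Section AngleDerivative.
Context {R : realType} (k : R) (I : 'I_3 -> R) (p s : R -> 'I_3 -> R).
Variables (t : R) (x : 'I_3 -> R).
Implicit Type i : 'I_3.
Hypothesis hs : forall i, s t i ^+ 2 = p t i * (2 + k * p t i).
Hypotheses (k0 : 0 <= k) (p_gt0 : forall i, 0 < p t i) (s_gt0 : forall i, 0 < s t i).
Hypotheses (I_gtN1 : forall i, -1 < I i) (I_le1 : forall i, I i <= 1).
Hypothesis C1term_ge0 : forall i, 0 <= C1term I i.
Hypothesis dp : forall i, is_derive t 1 (fun t => p t i) (s t i ^+ 2 * x i).
Hypothesis ds : forall i,
  is_derive t 1 (fun t => s t i) (s t i * gfac k (p t) i * x i).

Local Notation gam := (gfac k (p t)).
Local Notation m := (mlen k (p t) (s t) I).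
Local Notation n := (nlen k (p t) (s t) I).
Local Notation N := (Nang k (p t) (s t) I).
Local Notation W := (Wtri k (p t) (s t) I).
Local Notation Z := (Ztri k (p t) (s t) I).
Local Notation dr := (dmr k (p t) (s t) I).
Local Notation dl := (dml k (p t) (s t) I).
Local Notation d := (Num.sqrt (Dtri k (p t) (s t) I)).

Local Notation wt := (wtri k (p t) (s t) I).
Local Notation ca := (atri k (p t) (s t) I).

Let dm i := dr i * x (nx i) + dl i * x (nx (nx i)).

Lemma isd_mlen i : is_derive t 1 (fun t => mlen k (p t) (s t) I i) (dm i).
Proof.
rewrite /mlen /dm /dr /dl /gfac.
apply: is_derive_eq (isdD (isdD (isdD (dp _) (dp _)) (isdM (isdcM k (dp _)) (dp _)))
  (isdM (isdM (ds _) (ds _)) (isdC (I i) t))) _.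
rewrite /gfac; ring.
Qed.

Let dn i := 2 * (1 + k * m i) * dm i.

Lemma isd_nlen i : is_derive t 1 (fun t => nlen k (p t) (s t) I i) (dn i).
Proof.
apply: is_derive_eq (isdM (isd_mlen i) (isdD (isdC 2 t) (isdcM k (isd_mlen i)))) _.
rewrite /dn; ring.
Qed.

Lemma isd_Nang i : is_derive t 1 (fun t => Nang k (p t) (s t) I i)
  (dm (nx i) * (1 + k * m (nx (nx i))) + dm (nx (nx i)) * (1 + k * m (nx i))
   - dm i).
Proof.
apply: is_derive_eq (isdD (isdB (isdD (isd_mlen _) (isd_mlen _)) (isd_mlen _))
  (isdM (isdcM k (isd_mlen _)) (isd_mlen _))) _.
ring.
Qed.

Let nn0 i : 0 < n i. Proof. exact: nlen_gt0. Qed.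
Let mm0 i : 0 < m i. Proof. exact: mlen_gt0. Qed.

(** The differential of an angle in terms of those of the three side lengths; the quotients N / n
    encode the cosines of the other two angles. *)
Lemma isd_ang_aux i : is_derive t 1 (fun t => ang k (p t) (s t) I i)
  ((dm i - N (nx (nx i)) / n (nx i) * dm (nx i)
    - N (nx i) / n (nx (nx i)) * dm (nx (nx i))) / d).
Proof.
set j := nx i; set l := nx j.
have B0 : 0 < Num.sqrt (n j * n l) by rewrite sqrtr_gt0 mulr_gt0.
have B2 : Num.sqrt (n j * n l) ^+ 2 = n j * n l by rewrite sqr_sqrtr // mulr_ge0 // ltW.
have d0 : 0 < d by exact: sqrtD_gt0.
have cb : -1 < N i / Num.sqrt (n j * n l) < 1.
  by rewrite sqrtrM ?(ltW (nn0 _)) //; exact: cosarg.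
have e1 : Num.sqrt (1 - (N i / Num.sqrt (n j * n l)) ^+ 2) = d / Num.sqrt (n j * n l).
  by rewrite sqrtrM ?(ltW (nn0 _)) //; exact: sqrt1B_arg.
have B0' := lt0r_neq0 B0; have nj := lt0r_neq0 (nn0 j).
have nl := lt0r_neq0 (nn0 l); have d0' := lt0r_neq0 d0.
have nn : 0 < n j * n l by rewrite mulr_gt0.
pose g t := nlen k (p t) (s t) I j * nlen k (p t) (s t) I l.
have h1 := @isd_comp _ Num.sqrt g t _ _ (is_derive1_sqrt nn)
  (isdM (isd_nlen j) (isd_nlen l)).
have h2 := isdM (isd_Nang i) (@isdV _ (fun t => Num.sqrt (g t)) _ _ B0' h1).
apply: is_derive_eq (@isd_comp _ _ (fun t => Nang k (p t) (s t) I i /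
  Num.sqrt (g t)) _ _ _ (is_derive1_acos cb) h2) _.
rewrite /g.
rewrite e1 -/j -/l; move: B2 B0'; move: (Num.sqrt (n j * n l)) => B B2 B0'.
have eB : B ^- 2 = (n j * n l)^-1 by rewrite B2.
have -> : - (d / B)^-1 *
  (N i * - (B ^- 2 * ((2 * B)^-1 * (n j * dn l + n l * dn j))) +
   B^-1 * (dm j * (1 + k * m l) + dm l * (1 + k * m j) - dm i)) =
  (N i * (B ^- 2 * ((n j * dn l + n l * dn j) / 2)) -
   (dm j * (1 + k * m l) + dm l * (1 + k * m j) - dm i)) / d.
  by field; rewrite d0' B0'.
rewrite eB; congr (_ / _).
(* These two identities absorb the derivative of the square root in the denominator. *)
have Nj : N i * (1 + k * m j) = n j * (1 + k * m l) - N l.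
  rewrite /Nang /nlen nx3 -/j -/l; ring.
have Nl : N i * (1 + k * m l) = n l * (1 + k * m j) - N j.
  rewrite /Nang /nlen !nx3 -/j -/l; ring.
have -> : N i * ((n j * n l)^-1 * ((n j * dn l + n l * dn j) / 2)) =
  (N i * (1 + k * m l)) * dm l / n l + (N i * (1 + k * m j)) * dm j / n j.
  rewrite /dn; field; by rewrite nj nl.
rewrite Nj Nl; field; by rewrite nj nl.
Qed.

Lemma isd_ang i : is_derive t 1 (fun t => ang k (p t) (s t) I i)
  (wt (nx (nx i)) * (x (nx i) - x i) + wt (nx i) * (x (nx (nx i)) - x i)
   - ca i * x i).
Proof.
apply: is_derive_eq (isd_ang_aux i) _.
have d0' : d != 0 by rewrite gt_eqF //; exact: sqrtD_gt0.
rewrite /dm /wtri /atri !nx3.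
have := Wtri_nx I hs i; have := Wtri_pv I hs i; have := ZtriE I hs i.
set j := nx i; set l := nx j.
have nj := lt0r_neq0 (nn0 j); have nl := lt0r_neq0 (nn0 l).
have mj := lt0r_neq0 (mm0 j); have ml := lt0r_neq0 (mm0 l).
have gj : 2 + k * m j != 0.
  by rewrite gt_eqF // ltr_wpDr // mulr_ge0 // ltW.
have gl : 2 + k * m l != 0.
  by rewrite gt_eqF // ltr_wpDr // mulr_ge0 // ltW.
move=> hZ hj hl.
rewrite -hj -hl.
have hZ' : k * Z i = (N l * n l * dl j + N j * n j * dr l
   - (W l * n j + W j * n l)) / (m j * m l).
  by rewrite hZ; field; rewrite mj ml.
rewrite hZ' -hj -hl /nlen.
field.
by rewrite d0' gj gl mj ml.
Qed.

End AngleDerivative.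

(** * Functions of one radius and the coordinate u *)

Section Radius.
Context {R : realType}.
Implicit Types (G : geom) (r u x : R).

Definition kap G : R := if G is Hyperbolic then 1 else 0.
Definition pG G r : R := if G is Hyperbolic then coshR r - 1 else r ^+ 2 / 2.
Definition sG G r : R := if G is Hyperbolic then sinhR r else r.
(* [lam] is a primitive of 1 / s with inverse [rho], and [dom] is its range. *)
Definition dom G u : Prop := if G is Hyperbolic then u < 0 else True.
Definition rho G u : R :=
  if G is Hyperbolic then ln ((1 + expR u) / (1 - expR u)) else expR u.
Definition lam G r : R :=
  if G is Hyperbolic then ln ((expR r - 1) / (expR r + 1)) else ln r.

Lemma kap_ge0 G : 0 <= kap G. Proof. by case: G => /=. Qed.

Lemma cosh2 r : coshR r ^+ 2 = 1 + sinhR r ^+ 2.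
Proof.
have e : expR r * expR (- r) = 1 by rewrite expRxMexpNx_1.
rewrite /coshR /sinhR; move: e; move: (expR r) (expR (- r)) => a b e.
have -> : ((a + b) / 2) ^+ 2 = a * b + ((a - b) / 2) ^+ 2 by field.
by rewrite e.
Qed.

Lemma isd_expN r : is_derive r 1 (fun x => expR (- x)) (- expR (- r)).
Proof.
apply: is_derive_eq (isd_comp (is_derive_expR (- r)) (isdN (is_derive_id r 1))) _.
by rewrite mulrN1.
Qed.

Lemma isd_sinh r : is_derive r 1 (@sinhR R) (coshR r).
Proof.
rewrite /sinhR /coshR.
apply: is_derive_eq (isdM (isdB (is_derive_expR r) (isd_expN r)) (isdC 2^-1 r)) _.
by rewrite mulr0 add0r opprK mulrC.
Qed.

Lemma isd_cosh r : is_derive r 1 (@coshR R) (sinhR r).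
Proof.
rewrite /sinhR /coshR.
apply: is_derive_eq (isdM (isdD (is_derive_expR r) (isd_expN r)) (isdC 2^-1 r)) _.
by rewrite mulr0 add0r mulrC.
Qed.

Lemma sinh_gt0 r : 0 < r -> 0 < sinhR r.
Proof. by move=> r0; rewrite /sinhR divr_gt0 // subr_gt0 ltr_expR; lra. Qed.

Lemma cosh_gt0 r : 0 < coshR r.
Proof. by rewrite /coshR divr_gt0 // addr_gt0 // expR_gt0. Qed.

Lemma cosh_gt1 r : 0 < r -> 1 < coshR r.
Proof.
move=> /sinh_gt0 s0; rewrite -(@ltr_pXn2r _ 2) ?nnegrE ?ltW ?cosh_gt0 //.
by rewrite cosh2 expr1n ltrDl exprn_gt0.
Qed.

Lemma sinh0 : sinhR 0 = 0 :> R. Proof. by rewrite /sinhR oppr0 subrr mul0r. Qed.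
Lemma cosh0 : coshR 0 = 1 :> R.
Proof. by rewrite /coshR oppr0 expR0; field. Qed.

Lemma pG_rel G r : sG G r ^+ 2 = pG G r * (2 + kap G * pG G r).
Proof.
case: G => /=; last by field.
have := cosh2 r; move: (coshR r) (sinhR r) => c s e.
have -> : s ^+ 2 = c ^+ 2 - 1 by rewrite e; ring.
ring.
Qed.

Lemma pG_gt0 G r : 0 < r -> 0 < pG G r.
Proof.
case: G => /= r0; first by rewrite subr_gt0 cosh_gt1.
by rewrite divr_gt0 // exprn_gt0.
Qed.

Lemma sG_gt0 G r : 0 < r -> 0 < sG G r.
Proof. by case: G => //=; exact: sinh_gt0. Qed.

Lemma pG0 G : pG G 0 = 0.
Proof. by case: G => /=; [rewrite cosh0 subrr|rewrite expr0n mul0r]. Qed.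

Lemma sG0 G : sG G 0 = 0.
Proof. by case: G => //=; exact: sinh0. Qed.

Lemma pG_ge0 G r : 0 <= r -> 0 <= pG G r.
Proof. by rewrite le_eqVlt => /predU1P[<-|/(pG_gt0 G)/ltW//]; rewrite pG0. Qed.

Lemma sG_ge0 G r : 0 <= r -> 0 <= sG G r.
Proof. by rewrite le_eqVlt => /predU1P[<-|/(sG_gt0 G)/ltW//]; rewrite sG0. Qed.

Lemma isd_pG G r : is_derive r 1 (pG G) (sG G r).
Proof.
case: G => /=; rewrite /pG.
  by apply: is_derive_eq (isdB (isd_cosh r) (isdC 1 r)) _; rewrite subr0.
apply: is_derive_eq (isdM (isdM (is_derive_id r 1) (is_derive_id r 1)) (isdC 2^-1 r)) _.
by field.
Qed.

Lemma isd_sG G r : is_derive r 1 (sG G) (1 + kap G * pG G r).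
Proof.
case: G => /=; rewrite /sG.
  by apply: is_derive_eq (isd_sinh r) _; ring.
by rewrite mul0r addr0; exact: is_derive_id.
Qed.

Lemma pG_cont G : continuous (pG G).
Proof. by move=> r; exact: isd_cont (isd_pG G r). Qed.

Lemma sG_cont G : continuous (sG G).
Proof. by move=> r; exact: isd_cont (isd_sG G r). Qed.

Lemma sG_le G r r' : 0 <= r -> r <= r' -> sG G r <= sG G r'.
Proof.
move=> r0 rr; rewrite -lerN2.
apply: (isd_nincr rr (fun x _ => isdN (isd_sG G x))) => x /andP[rx _].
rewrite oppr_le0 addr_ge0 // mulr_ge0 ?kap_ge0 // ltW // pG_gt0 //.
exact: le_lt_trans rx.
Qed.

Lemma pG_le G r r' : 0 <= r -> r <= r' -> pG G r <= pG G r'.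
Proof.
move=> r0 rr; rewrite -lerN2.
apply: (isd_nincr rr (fun x _ => isdN (isd_pG G x))) => x /andP[rx _].
by rewrite oppr_le0 ltW // sG_gt0 // (le_lt_trans r0).
Qed.

Lemma rho_gt0 G u : dom G u -> 0 < rho G u.
Proof.
case: G => /= [u0|_]; last exact: expR_gt0.
have e1 : expR u < 1 by rewrite -expR0 ltr_expR.
have e0 := expR_gt0 u.
by rewrite ln_gt0 // ltr_pdivlMr ?subr_gt0 //; lra.
Qed.

Lemma isd_rho G u : dom G u -> is_derive u 1 (rho G) (sG G (rho G u)).
Proof.
case: G => /= [u0|_]; rewrite /rho; last exact: is_derive_expR.
have e1 : expR u < 1 by rewrite -expR0 ltr_expR.
have e0 := expR_gt0 u.
have n0 : 1 - expR u != 0 by rewrite gt_eqF // subr_gt0.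
have n1 : 1 + expR u != 0 by rewrite gt_eqF // addr_gt0.
have q0 : 0 < (1 + expR u) / (1 - expR u) by apply: divr_gt0; lra.
have h1 := isdM (isdD (isdC 1 u) (is_derive_expR u))
   (@isdV _ (fun x => 1 - expR x) _ _ n0 (isdB (isdC 1 u) (is_derive_expR u))).
have h := @isd_comp _ (@ln R) (fun u => (1 + expR u) / (1 - expR u)) _ _ _ (is_derive1_ln q0) h1.
apply: is_derive_eq h _.
rewrite /sinhR expRN lnK ?posrE //.
by field; rewrite n0 n1.
Qed.

Lemma lam_dom G r : 0 < r -> dom G (lam G r).
Proof.
case: G => //= r0; have e1 : 1 < expR r by rewrite -expR0 ltr_expR.
apply: ln_lt0; apply/andP; split; first by apply: divr_gt0; lra.
by rewrite ltr_pdivrMr ?addr_gt0 ?expR_gt0 //; lra.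
Qed.

Lemma isd_lam G r : 0 < r -> is_derive r 1 (lam G) (sG G r)^-1.
Proof.
case: G => /= r0; rewrite /lam; last exact: is_derive1_ln.
have e1 : 1 < expR r by rewrite -expR0 ltr_expR.
have n0 : expR r - 1 != 0 by rewrite gt_eqF // subr_gt0.
have n1 : expR r + 1 != 0 by rewrite gt_eqF // addr_gt0 // expR_gt0.
have n2 : expR r != 0 by rewrite gt_eqF // expR_gt0.
have q0 : 0 < (expR r - 1) / (expR r + 1).
  by apply: divr_gt0; lra.
have h1 := isdM (isdB (is_derive_expR r) (isdC 1 r))
   (@isdV _ (fun x => expR x + 1) _ _ n1 (isdD (is_derive_expR r) (isdC 1 r))).
have h := @isd_comp _ (@ln R) (fun r => (expR r - 1) / (expR r + 1)) _ _ _ (is_derive1_ln q0) h1.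
apply: is_derive_eq h _.
rewrite /sinhR expRN.
field. rewrite n0 n1 n2 /=.
suff -> : expR r * expR r - 1 = (expR r - 1) * (expR r + 1) by rewrite mulf_neq0.
ring.
Qed.

Lemma rhoK G r : 0 < r -> rho G (lam G r) = r.
Proof.
case: G => /= r0; last by rewrite lnK.
have e1 : 1 < expR r by rewrite -expR0 ltr_expR.
have n1 : expR r + 1 != 0 by rewrite gt_eqF // addr_gt0 // expR_gt0.
rewrite lnK; last by rewrite posrE; apply: divr_gt0; lra.
rewrite (_ : _ / _ = expR r) ?expRK //.
field. rewrite n1 /=.
by rewrite (_ : _ - _ = 2) ?pnatr_eq0 //; ring.
Qed.

Lemma lamK G u : dom G u -> lam G (rho G u) = u.
Proof.
case: G => /= [u0|_]; last by rewrite expRK.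
have e1 : expR u < 1 by rewrite -expR0 ltr_expR.
have e0 := expR_gt0 u.
have n0 : 1 - expR u != 0 by rewrite gt_eqF // subr_gt0.
rewrite lnK; last by rewrite posrE; apply: divr_gt0; lra.
rewrite (_ : _ / _ = expR u) ?expRK //.
field. rewrite n0 /=.
by rewrite (_ : _ + _ = 2) ?pnatr_eq0 //; ring.
Qed.

Lemma dom_le G u u' : u <= u' -> dom G u' -> dom G u.
Proof. by case: G => //= h; exact: le_lt_trans. Qed.

Lemma rho_le G u u' : dom G u' -> u <= u' -> rho G u <= rho G u'.
Proof.
move=> du uu; rewrite -lerN2.
have D x : u <= x <= u' -> dom G x by move=> /andP[_ xu]; exact: dom_le du.
apply: (isd_nincr uu (fun x h => isdN (isd_rho (D x h)))) => x /andP[/ltW a /ltW b].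
rewrite oppr_le0 ltW // sG_gt0 // rho_gt0 //; apply: D; exact/andP.
Qed.

Lemma lam_le G r r' : 0 < r -> r <= r' -> lam G r <= lam G r'.
Proof.
move=> r0 rr; rewrite -lerN2.
have D x : r <= x <= r' -> 0 < x by move=> /andP[a _]; exact: lt_le_trans a.
apply: (isd_nincr rr (fun x h => isdN (isd_lam G (D x h)))) => x /andP[/ltW a /ltW b].
by rewrite oppr_le0 invr_ge0 ltW // sG_gt0 // D // a.
Qed.

Lemma lam_lt G r r' : 0 < r -> r < r' -> lam G r < lam G r'.
Proof.
move=> r0 rr; rewrite lt_neqAle (lam_le G r0 (ltW rr)) andbT.
apply/eqP => /(congr1 (rho G)); rewrite !rhoK //; last exact: lt_trans rr.
by move=> e; rewrite e ltxx in rr.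
Qed.

Lemma rho_lipschitz G (b x y : R) : dom G b -> x <= b -> y <= b ->
  `|rho G x - rho G y| <= sG G (rho G b) * `|x - y|.
Proof.
move=> db.
have H p q : p <= q -> q <= b -> `|rho G q - rho G p| <= sG G (rho G b) * `|q - p|.
  rewrite le_eqVlt => /predU1P[->|pq] qb; first by rewrite !subrr !normr0 mulr0.
  have [|c /andP[_ cq] ->] := mvt (f := rho G) (df := fun x => sG G (rho G x)) pq.
    by move=> c /andP[_ cq]; apply: isd_rho; apply: dom_le db; exact: le_trans qb.
  have cb : c <= b by rewrite (le_trans (ltW cq)).
  have c0 : 0 < rho G c by apply: rho_gt0; exact: dom_le db.
  rewrite normrM ler_wpM2r // ger0_norm ?sG_ge0 ?(ltW c0) //.
  by apply: sG_le; [exact: ltW|exact: rho_le].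
move=> xb yb; have [xy|/ltW yx] := leP x y; last exact: H.
by rewrite distrC [`|x - y|]distrC; exact: H.
Qed.

Lemma coshK x : 1 <= x -> coshR (acoshR x) = x /\ sinhR (acoshR x) = Num.sqrt (x ^+ 2 - 1).
Proof.
move=> x1; set y := Num.sqrt (x ^+ 2 - 1).
have x2 : 0 <= x ^+ 2 - 1 by rewrite subr_ge0 exprn_ege1.
have y2 : y ^+ 2 = x ^+ 2 - 1 by rewrite sqr_sqrtr.
have y0 : 0 <= y by exact: sqrtr_ge0.
have xy : 0 < x + y by lra.
have xyV : (x + y)^-1 = x - y.
  apply: (mulfI (lt0r_neq0 xy)); rewrite divff ?gt_eqF //.
  have -> : (x + y) * (x - y) = x ^+ 2 - y ^+ 2 by ring.
  by rewrite y2; ring.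
rewrite /coshR /sinhR /acoshR -/y expRN lnK ?posrE // xyV. split; lra.
Qed.

End Radius.

(** * Bounds on the Laplacian weights and on the diagonal *)

Section WeightBounds.
Context {R : realType} (k : R) (p s I : 'I_3 -> R).
Implicit Type i : 'I_3.
Local Notation gam := (gfac k p).
Local Notation m := (mlen k p s I).
Local Notation n := (nlen k p s I).
Local Notation N := (Nang k p s I).
Local Notation JJ := (sinI2 I).
Local Notation PP := (C1term I).
Local Notation W := (Wtri k p s I).
Local Notation Z := (Ztri k p s I).
Local Notation w := (wtri k p s I).
Local Notation a := (atri k p s I).
Local Notation D := (Dtri k p s I).
Local Notation d := (Num.sqrt (Dtri k p s I)).

Hypothesis hs : forall i, s i ^+ 2 = p i * (2 + k * p i).
Hypotheses (k0 : 0 <= k) (p_gt0 : forall i, 0 < p i) (s_gt0 : forall i, 0 < s i).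
Hypotheses (I_gtN1 : forall i, -1 < I i) (I_le1 : forall i, I i <= 1).
Hypothesis C1term_ge0 : forall i, 0 <= PP i.

Let gam0 i : 0 < gam i. Proof. exact: gam_gt0. Qed.
Let gam1 i : 1 <= gam i. Proof. exact: gam_ge1. Qed.
Let JJ0 i : 0 <= JJ i. Proof. exact: sinI2_ge0. Qed.
Let T0 i : 0 <= 1 + I i * I (nx i) * I (nx (nx i)). Proof. exact: III_ge0. Qed.
Let D0 : 0 < D. Proof. exact: Dtri_gt0. Qed.
Let d0 : 0 < d. Proof. exact: sqrtD_gt0. Qed.
Let d2 : d ^+ 2 = D. Proof. exact: sqrtD_sqr. Qed.
Let n0 i : 0 < n i. Proof. exact: nlen_gt0. Qed.
Let m0 i : 0 < m i. Proof. exact: mlen_gt0. Qed.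
Let s0 i : 0 <= s i. Proof. exact: ltW. Qed.
Let g0 i : 0 <= gam i. Proof. exact: ltW. Qed.

Lemma Dtri_le i : D <= n i * n (nx i).
Proof.
rewrite -(DtriE k p s I (nx (nx i))) nx3 gerBl; exact: sqr_ge0.
Qed.

Section Box.
Variables c M b : R.
Hypotheses (c0 : 0 < c) (cs : forall i, c <= s i).
Hypotheses (pM : forall i, p i <= M) (sb : forall i, s i <= b).

Let mu := M + M + k * M * M + b * b.
Let nu := mu * (2 + k * mu).

Lemma mlen_box i : m i <= mu.
Proof.
have p0 j : 0 <= p j by exact: ltW.
have M0 : 0 <= M by exact: le_trans (p0 ord0) (pM ord0).
rewrite lerD //; last first.
  have ss : 0 <= s (nx i) * s (nx (nx i)) by rewrite mulr_ge0.
  apply: le_trans (_ : s (nx i) * s (nx (nx i)) <= _); last exact: ler_pM.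
  by rewrite ler_piMr.
rewrite lerD ?lerD // ler_pM ?mulr_ge0 // ler_pM //.
Qed.

Lemma nlen_box i : n i <= nu.
Proof.
have h := mlen_box i; have h0 := ltW (m0 i).
by rewrite ler_pM // ?lerD ?ler_wpM2l // addr_ge0 // mulr_ge0.
Qed.

Lemma sqrtD_box : d <= nu.
Proof.
have nn : 0 <= nu by exact: le_trans (ltW (n0 ord0)) (nlen_box ord0).
rewrite -(@ler_pXn2r _ 2) ?nnegrE ?(ltW d0) // d2.
apply: le_trans (Dtri_le ord0) _.
by rewrite expr2 ler_pM ?nlen_box // ltW.
Qed.

(** Uniform over all radii in a compact box: c bounds s from below, and nu bounds both [nlen] and d
    from above. *)
Lemma wtri_box i : c ^+ 4 / (nu * nu) * EE I i <= w i.
Proof.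
have nn : 0 < nu by exact: lt_le_trans (n0 ord0) (nlen_box ord0).
have E0 : 0 <= EE I i by exact: EE_ge0.
rewrite mulrAC ler_pM //.
- by rewrite mulr_ge0 // exprn_ge0 // ltW.
- by rewrite invr_ge0 mulr_ge0 // ltW.
- by apply: Wtri_ge => //; exact: ltW.
- rewrite lef_pV2 ?posrE ?(mulr_gt0 d0 (n0 i)) ?(mulr_gt0 nn nn) //.
  by rewrite ler_pM ?(ltW d0) ?(ltW (n0 _)) ?sqrtD_box ?nlen_box.
Qed.

Lemma atri_box i : k * (c ^+ 4 * (EE I (nx i) + EE I (nx (nx i))) /
  (nu * ((2 + k * mu) * (2 + k * mu)))) <= a i.
Proof.
have nn : 0 < nu by exact: lt_le_trans (n0 ord0) (nlen_box ord0).
have E0 j : 0 <= EE I j by exact: EE_ge0.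
have mu0 : 0 <= mu by exact: le_trans (ltW (m0 ord0)) (mlen_box ord0).
have km j : 0 < 2 + k * m j by exact: km_gt0.
have kmu : 0 < 2 + k * mu by rewrite ltr_wpDr // mulr_ge0.
have kk j : 2 + k * m j <= 2 + k * mu by rewrite lerD2l ler_wpM2l // mlen_box.
rewrite mulrA ler_pM //.
- by apply: mulr_ge0 => //; apply: mulr_ge0; [rewrite exprn_ge0 // ltW|rewrite addr_ge0].
- by rewrite invr_ge0 !mulr_ge0 // ltW.
- by rewrite ler_wpM2l //; apply: Ztri_ge => //; exact: ltW.
- rewrite lef_pV2 ?posrE ?(mulr_gt0 d0 (mulr_gt0 (km _) (km _)))
    ?(mulr_gt0 nn (mulr_gt0 kmu kmu)) //.
  rewrite ler_pM ?(ltW d0) ?sqrtD_box ?mulr_ge0 ?(ltW (km _)) //.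
  by rewrite ler_pM ?(ltW (km _)).
Qed.

End Box.

(** * Upper bounds that persist when radii tend to 0: only [gfac] is bounded *)

Section Upper.
Variable g : R.
Hypothesis gamg : forall i, gam i <= g.

Let g1 : 1 <= g. Proof. exact: le_trans (gam1 ord0) (gamg ord0). Qed.
Let gp : 0 < g. Proof. exact: lt_le_trans g1. Qed.

Lemma s2_le i : s i ^+ 2 <= p i * (1 + g).
Proof.
rewrite hs ler_wpM2l ?(ltW (p_gt0 _)) //.
have := gamg i; rewrite /gfac; lra.
Qed.

(** Complements the bound of [nlen] by the product of the two s, which is too weak when one radius
    is much smaller than the other. *)
Lemma nlen_s2 i :
  (1 + I i) / (1 + g) * (s (nx i) ^+ 2 + s (nx (nx i)) ^+ 2) <= n i.
Proof.
have nm : 2 * m i <= n i by exact: nlen_ge.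
apply: le_trans nm.
set j := nx i; set l := nx j.
have i1 : 0 < 1 + I i by have := I_gtN1 i; lra.
have gg : 0 < 1 + g by have := g1; lra.
have h1 := s2_le j; have h2 := s2_le l.
apply: (@le_trans _ _ ((1 + I i) * (p j + p l))).
  rewrite -mulrA ler_pM2l // mulrC ler_pdivrMr // mulrDl; lra.
have pj := p_gt0 j; have pl := p_gt0 l.
have kp : 0 <= k * p j * p l by rewrite !mulr_ge0 // ltW.
pose Q := p j + p l + k * p j * p l.
have mQ : m i = Q + s j * s l * I i by [].
have sQ : s j * s l <= Q.
  have : (1 + I i) * (s j * s l) <= m i by exact: mlen_ge.
  rewrite mQ; lra.
have ss : 0 <= s j * s l by rewrite mulr_ge0.
have QQ : (1 + I i) * (p j + p l) <= (1 + I i) * Q.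
  by rewrite ler_wpM2l ?(ltW i1) // /Q lerDl.
apply: le_trans QQ _; rewrite mQ.
have Q0 : 0 <= Q by rewrite (le_trans ss).
have [I0|I0] := leP 0 (I i).
  have : 0 <= s j * s l * I i by rewrite mulr_ge0.
  have : Q * I i <= Q * 1 by rewrite ler_wpM2l.
  lra.
have : 0 <= (Q - s j * s l) * - I i by rewrite mulr_ge0 // ?subr_ge0 // oppr_ge0 ltW.
have : 0 <= Q * (1 + I i) by rewrite mulr_ge0 // ltW.
lra.
Qed.

Lemma geM i (x : R) : 0 <= x -> x <= gam i * x.
Proof. by move=> x0; rewrite ler_peMl. Qed.

Lemma Dtri_terms i : let j := nx i in let l := nx j in
  [/\ s j ^+ 2 * s l ^+ 2 * JJ i <= D,
      s j * s l * s i ^+ 2 * PP i <= D &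
      k * s i ^+ 2 * s j ^+ 2 * s l ^+ 2 * (1 + I i * I j * I l) <= D].
Proof.
have t1 h h' h'' : 0 <= s h ^+ 2 * s h' ^+ 2 * JJ h''.
  by rewrite !(mulr_ge0, exprn_ge0).
have t2 h h' h'' : 0 <= s h * s h' * s h'' ^+ 2 * PP h''.
  by rewrite !(mulr_ge0, exprn_ge0).
have t3 : 0 <= k * s i ^+ 2 * s (nx i) ^+ 2 * s (nx (nx i)) ^+ 2 *
    (1 + I i * I (nx i) * I (nx (nx i))).
  by rewrite mulr_ge0 ?T0 // !(mulr_ge0, exprn_ge0).
move=> j l; rewrite (Dtri_gram I hs i) -/j -/l.
have gg h h' h1 h2 h3 : 0 <= gam h * gam h' * (s h1 * s h2 * s h3 ^+ 2 * PP h3).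
  by rewrite mulr_ge0 // mulr_ge0.
have := gg j l j l i; have := gg l i l i j; have := gg i j i j l.
have := t1 j l i; have := t1 l i j; have := t1 i j l.
have := t2 j l i; have := t3; rewrite -/j -/l.
have : s j * s l * s i ^+ 2 * PP i <= gam j * gam l * (s j * s l * s i ^+ 2 * PP i).
  have h1 := geM l (t2 j l i).
  have h2 := geM j (le_trans (t2 j l i) h1).
  by have := le_trans h1 h2; rewrite mulrA.
by move=> *; split; lra.
Qed.

(** Each of the nine terms of [Ztri] is twice, or a sum of two times, a term of [Dtri] with a factor
    at most g ^+ 3. *)
Lemma Ztri_le i : Z i <= 18 * g ^+ 3 * D.
Proof.
have gg1 : 1 <= g ^+ 2 by rewrite exprn_ege1.
have g3 : g <= g ^+ 3 by rewrite exprS ler_peMr // ltW.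
have Dp := ltW D0.
have gD : g * D <= g ^+ 3 * D by rewrite ler_wpM2r.
have := Dtri_terms i; have := Dtri_terms (nx i); have := Dtri_terms (nx (nx i)).
rewrite /= !nx3 /Ztri; set j := nx i; set l := nx j.
move=> [al bl _] [aj bj _] [ai bi ci].
have b1 h x : 0 <= x -> x <= D -> gam h * x <= g * D.
  by move=> x0 xD; rewrite ler_pM.
have t1 h h' h'' : 0 <= s h ^+ 2 * s h' ^+ 2 * JJ h''.
  by rewrite !(mulr_ge0, exprn_ge0).
have t2 h h' h'' : 0 <= s h * s h' * s h'' ^+ 2 * PP h''.
  by rewrite !(mulr_ge0, exprn_ge0).
have t3 : 0 <= k * s i ^+ 2 * s j ^+ 2 * s l ^+ 2 * (1 + I i * I j * I l).
  by rewrite mulr_ge0 ?T0 // !(mulr_ge0, exprn_ge0).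
have := b1 i _ t3 ci.
have := b1 i _ (t1 _ _ _) al; have := b1 l _ (t1 _ _ _) al.
have := b1 i _ (t1 _ _ _) aj; have := b1 j _ (t1 _ _ _) aj.
have := b1 i _ (t2 _ _ _) bj; have := b1 l _ (t2 _ _ _) bj.
have := b1 i _ (t2 _ _ _) bl; have := b1 j _ (t2 _ _ _) bl.
have := b1 j _ (t2 _ _ _) bi; have := b1 l _ (t2 _ _ _) bi.
have : gam i * gam j * gam l * (s j * s l * s i ^+ 2 * PP i) <= g ^+ 3 * D.
  have -> : g ^+ 3 = g * g * g by ring.
  by rewrite ler_pM ?mulr_ge0 // ler_pM ?mulr_ge0 // ler_pM.
have ks : k * s i ^+ 2 <= g ^+ 2.
  have e : k * s i ^+ 2 = gam i ^+ 2 - 1 by rewrite hs /gfac; ring.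
  rewrite e; have : gam i ^+ 2 <= g ^+ 2 by rewrite lerXn2r ?nnegrE // ltW.
  lra.
have q h x : 0 <= x -> x <= D -> gam h * (k * s i ^+ 2) * x <= g ^+ 3 * D.
  move=> x0 xD; have -> : g ^+ 3 = g * g ^+ 2 by ring.
  by rewrite ler_pM ?mulr_ge0 ?exprn_ge0 // ler_pM ?mulr_ge0 ?exprn_ge0.
have := q j _ (t2 _ _ _) bl; have := q l _ (t2 _ _ _) bj.
lra.
Qed.

(** [Ztri_le] bounds Z by a multiple of d ^+ 2 whereas [atri] divides by a single d; this controls
    the factor k d left over. *)
Lemma kd_le : k * d <= 4 * g ^+ 4.
Proof.
have km i : 1 + k * m i <= 2 * g ^+ 2.
  have -> : 1 + k * m i = gam (nx i) * gam (nx (nx i)) +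
     k * (s (nx i) * s (nx (nx i))) * I i by rewrite /mlen /gfac; ring.
  have gg : gam (nx i) * gam (nx (nx i)) <= g ^+ 2 by rewrite expr2 ler_pM.
  have ks j : k * s j ^+ 2 <= g ^+ 2.
    have e : k * s j ^+ 2 = gam j ^+ 2 - 1 by rewrite hs /gfac; ring.
    rewrite e; have : gam j ^+ 2 <= g ^+ 2 by rewrite lerXn2r ?nnegrE // ltW.
    lra.
  have ss : k * (s (nx i) * s (nx (nx i))) <= g ^+ 2.
    have := ks (nx i); have := ks (nx (nx i)).
    have : 0 <= k * (s (nx i) - s (nx (nx i))) ^+ 2 by rewrite mulr_ge0 ?sqr_ge0.
    lra.
  have : k * (s (nx i) * s (nx (nx i))) * I i <= k * (s (nx i) * s (nx (nx i))).
    by rewrite ler_piMr // !mulr_ge0.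
  lra.
have kn i : k * n i <= 4 * g ^+ 4.
  have e : k * n i = (1 + k * m i) ^+ 2 - 1 by rewrite /nlen; ring.
  have : (1 + k * m i) ^+ 2 <= (2 * g ^+ 2) ^+ 2.
    rewrite lerXn2r ?nnegrE //; last by rewrite mulr_ge0 // exprn_ge0 // ltW.
    by rewrite addr_ge0 // mulr_ge0 // ltW.
  rewrite e; lra.
have g4 : 0 <= 4 * g ^+ 4 by rewrite mulr_ge0 // exprn_ge0 // ltW.
have kd : 0 <= k * d by rewrite mulr_ge0 // ltW.
rewrite -(@ler_pXn2r _ 2) ?nnegrE // exprMn d2.
apply: (@le_trans _ _ ((k * n ord0) * (k * n (nx ord0)))).
  have := Dtri_le ord0; have := sqr_ge0 k.
  have -> : k * n ord0 * (k * n (nx ord0)) = k ^+ 2 * (n ord0 * n (nx ord0)) by ring.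
  by move=> h1 h2; rewrite ler_wpM2l.
have kn0 j : 0 <= k * n j by exact: mulr_ge0 k0 (ltW (n0 j)).
by rewrite expr2 ler_pM.
Qed.

Lemma atri_le i : a i <= 18 * g ^+ 7.
Proof.
have g3 : 0 <= g ^+ 3 by rewrite exprn_ge0 // ltW.
have km j : 2 <= 2 + k * m j by rewrite lerDl mulr_ge0 // ltW.
have km2 : 4 <= (2 + k * m (nx i)) * (2 + k * m (nx (nx i))).
  have : 2 * 2 <= (2 + k * m (nx i)) * (2 + k * m (nx (nx i))) by rewrite ler_pM.
  lra.
have km0 : 0 < (2 + k * m (nx i)) * (2 + k * m (nx (nx i))) by lra.
rewrite ler_pdivrMr ?(mulr_gt0 d0 km0) //.
apply: (@le_trans _ _ (k * (18 * g ^+ 3 * d ^+ 2))).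
  by rewrite d2 ler_wpM2l // Ztri_le.
have -> : k * (18 * g ^+ 3 * d ^+ 2) = (18 * g ^+ 3 * d) * (k * d) by ring.
apply: (@le_trans _ _ ((18 * g ^+ 3 * d) * (4 * g ^+ 4))).
  by rewrite ler_wpM2l ?kd_le // !mulr_ge0 // ltW.
have -> : 18 * g ^+ 3 * d * (4 * g ^+ 4) = 18 * g ^+ 7 * (d * 4) by ring.
rewrite ler_wpM2l //; first by rewrite mulr_ge0 // exprn_ge0 // ltW.
by rewrite ler_pM2l.
Qed.

(** The first summand bounds the [sinI2] part of the weight, the second one the two [C1term] parts.
    Radii enter only through g. *)
Definition wbound i := g / (2 * (1 + I i)) +
  4 * g * (1 + g) / (Num.sqrt (JJ (nx i) + JJ (nx (nx i)) + 2 * PP i) * (1 + I i)).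

Lemma wtri_le i : w i <= wbound i.
Proof.
set j := nx i; set l := nx j.
have i1 : 0 < 1 + I i by have := I_gtN1 i; lra.
set q := JJ j + JJ l + 2 * PP i.
have q0 : 0 < q by exact: sinI2_C1term_gt0.
pose c := Num.sqrt q.
have c0 : 0 < c by rewrite sqrtr_gt0.
have c2 : c ^+ 2 = q by rewrite sqr_sqrtr // ltW.
have J1 : JJ i <= 1 by rewrite /sinI2 gerBl sqr_ge0.
have P2 h : PP h <= 2.
  have := I_le1 h.
  have : I (nx h) * I (nx (nx h)) <= 1.
    have b h' : `|I h'| <= 1 by rewrite ler_norml I_le1 ltW.
    apply: le_trans (ler_norm _) _; rewrite normrM mulr_ile1 //.
  rewrite /C1term; lra.
have ss : 0 <= s j * s l by rewrite mulr_ge0.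
have X : s j * s l * JJ i <= d.
  rewrite -(@ler_pXn2r _ 2) ?nnegrE ?(ltW d0) ?mulr_ge0 // d2.
  have [h _ _] := Dtri_terms i; apply: le_trans h; rewrite -/j -/l !exprMn.
  rewrite ler_wpM2l ?mulr_ge0 ?exprn_ge0 // expr2 ler_piMr //.
(* To bound s_i s_j s_l by d (s_j + s_l) / c: the smaller of s_j and s_l goes together with s_i into
   [Dtri_min], the larger one is at most their sum. *)
pose mn := Num.min (s j) (s l).
have mn0 : 0 <= mn by rewrite le_min !s0.
have mnc : s i * mn * c <= d.
  rewrite -(@ler_pXn2r _ 2) ?nnegrE ?(ltW d0) ?mulr_ge0 ?(ltW c0) // d2.
  rewrite !exprMn c2; apply: Dtri_min => //.
  - by rewrite ge_min lexx.
  - by rewrite ge_min lexx orbT.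
have sjl : s j * s l <= mn * (s j + s l).
  by rewrite /mn; have [h|h] := leP (s j) (s l); rewrite mulrDr;
    [rewrite lerDr|rewrite [s j * _]mulrC lerDl]; rewrite mulr_ge0.
have Y : s i * (s j * s l) <= d / c * (s j + s l).
  apply: (@le_trans _ _ (s i * (mn * (s j + s l)))).
    by rewrite ler_wpM2l.
  rewrite mulrA ler_wpM2r ?addr_ge0 //.
  by rewrite ler_pdivlMr.
have WE : W i = gam i * (s j * s l) * (s j * s l * JJ i)
  + s i * (s j * s l) * (gam j * s l * PP l + gam l * s j * PP j).
  rewrite /Wtri -/j -/l; ring.
have gP h h' : gam h * s h' * PP h' <= 2 * g * s h'.
  have -> : 2 * g * s h' = g * s h' * 2 by ring.
  by rewrite ler_pM ?mulr_ge0 // ler_wpM2r.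
have S0 : 0 <= s j + s l by rewrite addr_ge0.
have W1 : W i <= g * (s j * s l) * d + d / c * (s j + s l) * (2 * g * (s j + s l)).
  rewrite WE lerD //.
    by rewrite ler_pM ?mulr_ge0 // ler_wpM2r.
  rewrite ler_pM ?addr_ge0 ?mulr_ge0 //.
  by have := gP j l; have := gP l j; lra.
have n1 : 2 * (1 + I i) * (s j * s l) <= n i.
  have : 2 * m i <= n i by exact: nlen_ge.
  have : (1 + I i) * (s j * s l) <= m i by exact: mlen_ge.
  lra.
have n2 := nlen_s2 i; rewrite -/j -/l in n2.
have gg : 0 < 1 + g by have := g1; lra.
rewrite ler_pdivrMr ?(mulr_gt0 d0 (n0 i)) //.
apply: le_trans W1 _; rewrite /wbound -/j -/l -/q -/c [leRHS]mulrDl lerD //.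
  have -> : g * (s j * s l) * d = g / (2 * (1 + I i)) * (d * (2 * (1 + I i) * (s j * s l))).
    by field; rewrite gt_eqF.
  rewrite ler_wpM2l ?divr_ge0 ?mulr_ge0 ?(ltW i1) ?(ltW gp) //.
  by rewrite ler_wpM2l // ltW.
have e : d / c * (s j + s l) * (2 * g * (s j + s l)) =
  4 * g * (1 + g) / (c * (1 + I i)) *
    (d * ((1 + I i) / (1 + g) * ((s j + s l) ^+ 2 / 2))).
  by field; rewrite !gt_eqF.
rewrite e ler_wpM2l //.
  by rewrite divr_ge0 // !mulr_ge0 // ltW.
rewrite ler_wpM2l ?(ltW d0) //; apply: le_trans n2.
rewrite ler_wpM2l ?divr_ge0 ?(ltW i1) ?(ltW gg) //.
rewrite ler_pdivrMr //.
have := sqr_ge0 (s j - s l); lra.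
Qed.

End Upper.
End WeightBounds.

Lemma sum3 {V : nmodType} (i : 'I_3) (f : 'I_3 -> V) :
  \sum_j f j = f i + f (nx i) + f (nx (nx i)).
Proof.
elim/nx_ind: i => [|i ->]; last by rewrite nx3 -addrA addrC.
rewrite !big_ord_recl big_ord0 addr0 -addrA.
by congr (_ + (f _ + f _)); apply/val_inj; rewrite /= !nxE.
Qed.

(** * The angles of one triangle as functions of u *)

Section FaceAngles.
Context {R : realType} (G : geom) (I : 'I_3 -> R).
Implicit Types (r u x y : 'I_3 -> R) (i j : 'I_3).

Definition angG r i : R :=
  ang (kap G) (fun j => pG G (r j)) (fun j => sG G (r j)) I i.
Definition wG r i : R :=
  wtri (kap G) (fun j => pG G (r j)) (fun j => sG G (r j)) I i.
Definition aG r i : R :=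
  atri (kap G) (fun j => pG G (r j)) (fun j => sG G (r j)) I i.
Definition jacG r x i : R := wG r (nx (nx i)) * (x (nx i) - x i)
  + wG r (nx i) * (x (nx (nx i)) - x i) - aG r i * x i.

Hypotheses (I_gtN1 : forall i, -1 < I i) (I_le1 : forall i, I i <= 1).
Hypothesis C1term_ge0 : forall i, 0 <= C1term I i.

Let rel r i : sG G (r i) ^+ 2 = pG G (r i) * (2 + kap G * pG G (r i)).
Proof. exact: pG_rel. Qed.
Let k0 : 0 <= kap G :> R. Proof. exact: kap_ge0. Qed.

Section Positive.
Variable r : 'I_3 -> R.
Hypothesis r0 : forall i, 0 < r i.
Let p0 i : 0 < pG G (r i). Proof. exact: pG_gt0. Qed.
Let s0 i : 0 < sG G (r i). Proof. exact: sG_gt0. Qed.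

Lemma angG_gt0 i : 0 < angG r i. Proof. exact: ang_gt0. Qed.
Lemma angG_ltpi i : angG r i < pi. Proof. exact: ang_ltpi. Qed.
Lemma angG_pair i : angG r i + angG r (nx i) < pi. Proof. exact: ang_pair. Qed.
Lemma angG_sum_le : \sum_i angG r i <= pi.
Proof. by rewrite (sum3 ord0); exact: asum_le. Qed.
Lemma angG_sum_eq : G = Euclidean -> \sum_i angG r i = pi.
Proof. by move=> GE; rewrite (sum3 ord0); apply: asum_pi => //; rewrite GE. Qed.

Lemma wG_ge0 i : 0 <= wG r i. Proof. exact: wtri_ge0. Qed.
Lemma aG_ge0 i : 0 <= aG r i. Proof. exact: atri_ge0. Qed.
Lemma wG_gt0 i : 0 < wG r i + wG r (nx i). Proof. exact: wtri_gt0. Qed.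

End Positive.

Definition radii u j : R := rho G (u j).

Lemma jac_quad r x : \sum_i x i * jacG r x i =
  - (\sum_i wG r i * (x (nx i) - x (nx (nx i))) ^+ 2 + \sum_i aG r i * x i ^+ 2).
Proof. rewrite !(sum3 ord0) /jacG !nx3; ring. Qed.

Definition between (u u' v : 'I_3 -> R) :=
  forall j, Num.min (u j) (u' j) <= v j <= Num.max (u j) (u' j).

(** The mean value theorem is applied to the scalar product with a fixed y, so that one intermediate
    point serves all corners; for y = u' - u the right side is the quadratic form of [jac_quad]. *)
Lemma angG_mvt u u' y : (forall j, dom G (u j)) -> (forall j, dom G (u' j)) ->
  exists2 v, between u u' v & \sum_i y i * (angG (radii u') i - angG (radii u) i) =
    \sum_i y i * jacG (radii v) (fun j => u' j - u j) i.
Proof.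
move=> du du'; pose x j := u' j - u j; pose v t j := u j + t * x j.
have bt (t : R) : 0 <= t <= 1 -> between u u' (v t).
  move=> /andP[t0 t1] j; rewrite ge_min le_max /v /x.
  have [uu|uu] := leP (u j) (u' j).
    have : 0 <= t * (u' j - u j) by rewrite mulr_ge0 // subr_ge0.
    have : 0 <= (1 - t) * (u' j - u j) by rewrite mulr_ge0 // subr_ge0.
    by move=> *; apply/andP; split; apply/orP; [left|right]; lra.
  have : 0 <= t * (u j - u' j) by rewrite mulr_ge0 // subr_ge0 ltW.
  have : 0 <= (1 - t) * (u j - u' j) by rewrite mulr_ge0 // subr_ge0 // ltW.
  by move=> *; apply/andP; split; apply/orP; [right|left]; lra.
have dv (t : R) j : 0 <= t <= 1 -> dom G (v t j).
  move=> /bt/(_ j)/andP[_ h]; apply: dom_le h _.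
  by case: leP.
have D (t : R) i : 0 <= t <= 1 ->
    is_derive t 1 (fun t => angG (radii (v t)) i) (jacG (radii (v t)) x i).
  move=> t01.
  apply: (@isd_ang _ _ I (fun t j => pG G (radii (v t) j))
    (fun t j => sG G (radii (v t) j))) => // j.
  - by apply: pG_gt0; apply: rho_gt0; exact: dv.
  - by apply: sG_gt0; apply: rho_gt0; exact: dv.
  - apply: is_derive_eq (@isd_comp _ (pG G) (fun t => radii (v t) j) _ _ _ (isd_pG G _)
      (@isd_comp _ (rho G) (fun t => v t j) _ _ _ (isd_rho (dv t j t01))
        (isd_line _ _ _))) _.
    by rewrite mulrA expr2.
  - apply: is_derive_eq (@isd_comp _ (sG G) (fun t => radii (v t) j) _ _ _ (isd_sG G _)
      (@isd_comp _ (rho G) (fun t => v t j) _ _ _ (isd_rho (dv t j t01))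
        (isd_line _ _ _))) _.
    by rewrite mulrA [_ * sG _ _]mulrC.
have [t /andP[t0 t1] e] := mvt ltr01 (fun t h => isd_sum (P := predT)
  (fun i _ => isdcM (y i) (D t i h))).
exists (v t); first by apply: bt; rewrite !ltW.
have e1 : v 1 = u' by apply/funext => j; rewrite /v mul1r addrC subrK.
have e0 : v 0 = u by apply/funext => j; rewrite /v mul0r addr0.
rewrite subr0 mulr1 e1 e0 in e; rewrite -e -sumrB; apply: eq_bigr => i _.
exact: mulrBr.
Qed.

Lemma between_dom u u' v : (forall j, dom G (u j)) -> (forall j, dom G (u' j)) ->
  between u u' v -> forall j, dom G (v j).
Proof.
by move=> du du' b j; have /andP[_ h] := b j; apply: dom_le h _; case: leP.
Qed.

Lemma angG_mvt1 u u' i : (forall j, dom G (u j)) -> (forall j, dom G (u' j)) ->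
  exists2 v, between u u' v & angG (radii u') i - angG (radii u) i =
    jacG (radii v) (fun j => u' j - u j) i.
Proof.
move=> du du'; have [v b e] := angG_mvt (fun j => (j == i)%:R) du du'.
exists v => //.
have S (f : 'I_3 -> R) : \sum_j (j == i)%:R * f j = f i.
  rewrite (bigD1 i) //= eqxx mul1r big1 ?addr0 // => j /negPf->.
  by rewrite mul0r.
by rewrite -(S (fun j => angG (radii u') j - angG (radii u) j)) e S.
Qed.

Lemma radii_lam r : (forall j, 0 < r j) -> radii (fun j => lam G (r j)) = r.
Proof. by move=> r0; apply/funext => j; rewrite /radii rhoK. Qed.

(** The off-diagonal entries of the Jacobian are nonnegative. This comparison principle is what
    makes Perron's method work. *)
Lemma angG_mono r r' i : (forall j, 0 < r j) -> (forall j, r j <= r' j) ->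
  r i = r' i -> angG r i <= angG r' i.
Proof.
move=> r0 rr ri; have r'0 j : 0 < r' j by exact: lt_le_trans (rr j).
have du j := lam_dom G (r0 j); have du' j := lam_dom G (r'0 j).
have [v b] := angG_mvt1 i du du'; rewrite !radii_lam // => e.
have dv := between_dom du du' b.
rewrite -subr_ge0 e /jacG ri subrr mulr0 !subr0.
have w0 j : 0 <= wG (radii v) j by apply: wG_ge0 => l; exact: rho_gt0.
have uu j : 0 <= lam G (r' j) - lam G (r j) by rewrite subr_ge0 lam_le.
by rewrite addr_ge0 // mulr_ge0.
Qed.

Lemma angG_anti r r' i : (forall j, 0 < r j) -> r i < r' i ->
  (forall j, j != i -> r' j = r j) -> angG r' i < angG r i.
Proof.
move=> r0 ri rj; have r'0 j : 0 < r' j.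
  have [->|/rj->//] := eqVneq j i; exact: lt_trans ri.
have du j := lam_dom G (r0 j); have du' j := lam_dom G (r'0 j).
have [v b] := angG_mvt1 i du du'; rewrite !radii_lam // => e.
have dv := between_dom du du' b.
have x0 : 0 < lam G (r' i) - lam G (r i) by rewrite subr_gt0 lam_lt.
have nxi j : nx j != j.
  by rewrite -(inj_eq val_inj) /= nxE; case: j => [[|[|[|]]]].
have nxxi j : nx (nx j) != j.
  by rewrite -(inj_eq val_inj) /= !nxE; case: j => [[|[|[|]]]].
rewrite -subr_lt0 e /jacG (rj (nx i)) // (rj (nx (nx i))) // !subrr.
have v0 j : 0 < radii v j by exact: rho_gt0.
have := wG_gt0 v0 (nx i); have := aG_ge0 v0 i.
move: (lam G (r' i) - lam G (r i)) x0 => x x0.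
move: (wG _ _) (wG _ _) (aG _ _) => w w' a a0 ww.
have : 0 < (w' + w) * x by rewrite mulr_gt0 // addrC.
have : 0 <= a * x by rewrite mulr_ge0 // ltW.
lra.
Qed.

Lemma angG_dissip u u' : (forall j, dom G (u j)) -> (forall j, dom G (u' j)) ->
  \sum_i (u' i - u i) * (angG (radii u') i - angG (radii u) i) <= 0.
Proof.
move=> du du'; have [v b ->] := angG_mvt (fun j => u' j - u j) du du'.
have dv := between_dom du du' b.
have v0 j : 0 < radii v j by exact: rho_gt0.
rewrite (jac_quad (radii v) (fun j => u' j - u j)) oppr_le0 addr_ge0 //;
  apply: sumr_ge0 => i _; rewrite mulr_ge0 ?sqr_ge0 //.
  exact: wG_ge0.
exact: aG_ge0.
Qed.

(** On the box a <= u <= b the weights are bounded below by multiples of [EE] that depend on a and b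
    only; the intermediate point stays in the box. *)
Lemma angG_coercive a b : dom G b -> exists2 c, 0 < c &
  forall u u', (forall j, a <= u j <= b) -> (forall j, a <= u' j <= b) ->
  \sum_i (u' i - u i) * (angG (radii u') i - angG (radii u) i) <=
  - c * (\sum_i EE I i * ((u' (nx i) - u (nx i)) - (u' (nx (nx i)) - u (nx (nx i)))) ^+ 2
     + kap G * \sum_i (u' i - u i) ^+ 2).
Proof.
move=> db.
have [ab|ab] := leP a b; last first.
  exists 1 => // u u' h; have /andP[/le_trans h1 /h1] := h ord0.
  by rewrite leNgt ab.
have da := dom_le ab db.
pose c := sG G (rho G a); pose M := pG G (rho G b); pose s := sG G (rho G b).
have c0 : 0 < c by apply: sG_gt0; exact: rho_gt0.
pose mu := M + M + kap G * M * M + s * s.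
pose nu := mu * (2 + kap G * mu).
have M0 : 0 < M by apply: pG_gt0; exact: rho_gt0.
have s0 : 0 < s by apply: sG_gt0; exact: rho_gt0.
have mu0 : 0 < mu.
  by rewrite /mu ltr_wpDl ?mulr_gt0 // !addr_ge0 ?mulr_ge0 // ltW.
have nu0 : 0 < nu by rewrite /nu mulr_gt0 // ltr_wpDr // mulr_ge0 // ltW.
pose e := EE I ord0 + EE I (nx ord0).
(* The bound on [atri] involves [EE] at the two other corners; E is the least of these three sums,
   positive by [EE_gt0]. *)
pose E := Num.min (EE I ord0 + EE I (nx ord0)) (Num.min
  (EE I (nx ord0) + EE I (nx (nx ord0))) (EE I (nx (nx ord0)) + EE I ord0)).
have E0 : 0 < E.
  rewrite !lt_min; do 2 (rewrite (EE_gt0 I_gtN1 I_le1 C1term_ge0) /=).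
  by rewrite -{2}(nx3 ord0) (EE_gt0 I_gtN1 I_le1 C1term_ge0).
have EI i : E <= EE I (nx i) + EE I (nx (nx i)).
  have h0 : E <= EE I (nx ord0) + EE I (nx (nx ord0)) by rewrite /E !ge_min lexx orbT.
  have h1 : E <= EE I (nx (nx ord0)) + EE I ord0 by rewrite /E !ge_min lexx !orbT.
  have h2 : E <= EE I ord0 + EE I (nx ord0) by rewrite /E ge_min lexx.
  have [|[|]] : i = ord0 \/ i = nx ord0 \/ i = nx (nx ord0).
  - case: i => [[|[|[|]]]] // h; [left|right;left|right;right];
    by apply/val_inj; rewrite /= ?nxE /= ?nxE.
  - by move->.
  - by move->; rewrite nx3.
  - by move->; rewrite !nx3.
pose kk := (2 + kap G * mu) * (2 + kap G * mu).
have kk0 : 0 < kk by rewrite /kk mulr_gt0 // ltr_wpDr // mulr_ge0 // ltW.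
pose c1 := c ^+ 4 / (nu * nu); pose c2 := c ^+ 4 * E / (nu * kk).
have c1p : 0 < c1 by rewrite /c1 divr_gt0 ?exprn_gt0 // mulr_gt0.
have c2p : 0 < c2.
  by rewrite /c2 divr_gt0 //; apply: mulr_gt0 => //; exact: exprn_gt0.
exists (Num.min c1 c2); first by rewrite lt_min c1p.
move=> u u' hu hu'.
have du j : dom G (u j) by have /andP[_ h] := hu j; exact: dom_le db.
have du' j : dom G (u' j) by have /andP[_ h] := hu' j; exact: dom_le db.
have [v bt ->] := angG_mvt (fun j => u' j - u j) du du'.
have dv := between_dom du du' bt.
have vab j : a <= v j <= b.
  have /andP[h1 h2] := bt j; have /andP[? ?] := hu j; have /andP[? ?] := hu' j.
  apply/andP; split; first by apply: le_trans h1; rewrite le_min; apply/andP.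
  by apply: le_trans h2 _; rewrite ge_max; apply/andP.
have v0 j : 0 < radii v j by exact: rho_gt0.
have p0 j : 0 < pG G (radii v j) by exact: pG_gt0.
have s0' j : 0 < sG G (radii v j) by exact: sG_gt0.
have cs j : c <= sG G (radii v j).
  by have /andP[? ?] := vab j; apply: sG_le; [exact/ltW/rho_gt0|exact: rho_le].
have pM j : pG G (radii v j) <= M.
  by have /andP[? ?] := vab j; apply: pG_le; [exact/ltW|exact: rho_le].
have sM j : sG G (radii v j) <= s.
  by have /andP[? ?] := vab j; apply: sG_le; [exact/ltW|exact: rho_le].
rewrite (jac_quad (radii v) (fun j => u' j - u j)) mulNr lerN2 mulrDr lerD //.
  rewrite mulr_sumr; apply: ler_sum => i _.
  rewrite mulrA ler_wpM2r ?sqr_ge0 //.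
  have hw : c1 * EE I i <= wG (radii v) i.
    by apply: (wtri_box (rel _) k0 p0 s0' I_gtN1 I_le1 C1term_ge0 c0 cs pM sM).
  apply: le_trans hw; rewrite ler_wpM2r ?ge_min ?lexx //.
  exact: EE_ge0.
rewrite mulrA mulr_sumr; apply: ler_sum => i _.
rewrite ler_wpM2r ?sqr_ge0 //.
have := atri_box (rel _) k0 p0 s0' I_gtN1 I_le1 C1term_ge0 c0 cs pM sM i.
apply: le_trans; rewrite mulrC ler_wpM2l //.
apply: (@le_trans _ _ c2); first by rewrite ge_min lexx orbT.
rewrite ler_wpM2r //; first by rewrite invr_ge0 ltW // mulr_gt0.
by rewrite ler_wpM2l ?exprn_ge0 // ltW.
Qed.

(** No lower bound on u is assumed: the constant survives radii tending to 0, as a globally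
    Lipschitz field requires. *)
Lemma angG_lip g : exists2 K, 0 <= K &
  forall u u', (forall j, dom G (u j)) -> (forall j, dom G (u' j)) ->
  (forall j, 1 + kap G * pG G (rho G (u j)) <= g) ->
  (forall j, 1 + kap G * pG G (rho G (u' j)) <= g) ->
  forall i, `|angG (radii u') i - angG (radii u) i| <= K * \sum_j `|u' j - u j|.
Proof.
have [g1|g1] := leP 1 g; last first.
  exists 0 => // u u' du _ hu; have := le_lt_trans (hu ord0) g1.
  by rewrite gtrDl ltNge mulr_ge0 // ltW // pG_gt0 // rho_gt0.
pose K := \sum_i wbound I g i + 18 * g ^+ 7.
have gp : 0 < g by exact: lt_le_trans g1.
have W0 i : 0 <= wbound I g i.
  have i1 : 0 < 1 + I i by have := I_gtN1 i; lra.
  have g0 := ltW gp; have gg : 0 <= 1 + g by lra.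
  apply: addr_ge0; apply: divr_ge0 => //; first by rewrite mulr_ge0 // ltW.
    by rewrite !mulr_ge0.
  by rewrite mulr_ge0 ?sqrtr_ge0 // ltW.
have Wi i : wbound I g i <= K.
  rewrite /K (bigD1 i) //= -addrA lerDl addr_ge0 ?sumr_ge0 //.
  by rewrite mulr_ge0 // exprn_ge0 // ltW.
have K0 : 0 <= K by exact: le_trans (W0 ord0) (Wi ord0).
have gK : 18 * g ^+ 7 <= K by rewrite lerDr sumr_ge0.
exists (3 * K) => [|u u' du du' gu gu' i]; first by rewrite mulr_ge0.
have [v bt ->] := angG_mvt1 i du du'.
have dv := between_dom du du' bt.
have v0 j : 0 < radii v j by exact: rho_gt0.
have p0 j : 0 < pG G (radii v j) by exact: pG_gt0.
have s0' j : 0 < sG G (radii v j) by exact: sG_gt0.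
have gv j : gfac (kap G) (fun j => pG G (radii v j)) j <= g.
  have /andP[_] := bt j.
  have h (x : R) : v j <= x -> dom G x -> 1 + kap G * pG G (rho G x) <= g ->
      gfac (kap G) (fun j => pG G (radii v j)) j <= g.
    move=> vx dx; apply: le_trans; rewrite /gfac lerD2l ler_wpM2l //.
    by apply: pG_le; [exact/ltW|exact: rho_le].
  by case: (leP (u j) (u' j)) => _ vx; [exact: (h _ vx (du' j) (gu' j))|exact: (h _ vx (du j) (gu j))].
have wK j : `|wG (radii v) j| <= K.
  rewrite ger0_norm ?wG_ge0 //; apply: le_trans (Wi j).
  exact: wtri_le.
have aK j : `|aG (radii v) j| <= K.
  rewrite ger0_norm ?aG_ge0 //; apply: le_trans gK.
  exact: atri_le.
rewrite (sum3 i) /jacG.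
move: (u' i - u i) (u' (nx i) - u (nx i)) (u' (nx (nx i)) - u (nx (nx i))) => x y z.
have ub (c a b : R) : `|c| <= K -> `|c * (a - b)| <= K * (`|a| + `|b|).
  by move=> cK; rewrite normrM ler_pM // ler_normB.
have h1 := ub _ y x (wK (nx (nx i))); have h2 := ub _ z x (wK (nx i)).
have h3 : `|aG (radii v) i * x| <= K * `|x| by rewrite normrM ler_pM.
apply: le_trans (ler_normB _ _) _; apply: le_trans (lerD (ler_normD _ _) (lexx _)) _.
have : 0 <= K * `|y| by rewrite mulr_ge0.
have : 0 <= K * `|z| by rewrite mulr_ge0.
lra.
Qed.

End FaceAngles.

Unset Implicit Arguments.

(** * Limits of the angles *)

Section AngleLimits.
Local Open Scope classical_set_scope.
Context {R : realType} {T : Type} (F : set_system T) {FF : ProperFilter F}.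

(** Strict monotonicity of cos on [0, pi] gives this also for the limits 0 and pi, where the
    derivative of cos vanishes. *)
Lemma cvg_of_cos {th : T -> R} {l : R} : 0 <= l <= pi ->
  (\forall t \near F, 0 <= th t <= pi) -> cos (th t) @[t --> F] --> cos l ->
  th t @[t --> F] --> l.
Proof.
move=> /andP[l0 l1] th0 cth; apply/cvgrPdist_lt => e e0.
have up : \forall t \near F, th t < l + e.
  have [le|le] := leP (l + e) pi; last first.
    by apply: filterS th0 => t /andP[_ h]; exact: le_lt_trans le.
  have c : cos (l + e) < cos l.
    by rewrite ltr_cos ?in_itv /=; lra.
  have h : \forall t \near F, cos (l + e) < cos (th t) by exact: cvgr_gt cth _ c.
  apply: filterS2 _ th0 h => t /andP[h0 h1].
  rewrite ltr_cos ?in_itv /= ?h0 ?h1 //; lra.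
have dn : \forall t \near F, l - e < th t.
  have [le|le] := leP 0 (l - e); last first.
    by apply: filterS th0 => t /andP[h _]; exact: lt_le_trans h.
  have c : cos l < cos (l - e).
    by rewrite ltr_cos ?in_itv /=; lra.
  have h : \forall t \near F, cos (th t) < cos (l - e) by exact: cvgr_lt cth _ c.
  apply: filterS2 _ th0 h => t /andP[h0 h1].
  rewrite ltr_cos ?in_itv /= ?h0 ?h1 //; lra.
apply: filterS2 _ up dn => t h1 h2.
by rewrite ltr_norml; apply/andP; split; lra.
Qed.

Variables (G : geom) (I : 'I_3 -> R).
Implicit Types (i j : 'I_3).
Hypotheses (I_gtN1 : forall i, -1 < I i) (I_le1 : forall i, I i <= 1).
Hypothesis C1term_ge0 : forall i, 0 <= C1term I i.

Variables (r : T -> 'I_3 -> R) (w : 'I_3 -> R).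
Hypothesis r0 : \forall t \near F, forall j, 0 < r t j.
Hypothesis w0 : forall j, 0 <= w j.
Hypothesis rw : forall j, r t j @[t --> F] --> w j.

Local Notation k := (kap G : R).
Local Notation pt t := (fun j => pG G (r t j)).
Local Notation st t := (fun j => sG G (r t j)).
Local Notation pw := (fun j => pG G (w j)).
Local Notation sw := (fun j => sG G (w j)).

Let k0 : 0 <= k. Proof. exact: kap_ge0. Qed.
Let rel (x : 'I_3 -> R) j : sG G (x j) ^+ 2 = pG G (x j) * (2 + k * pG G (x j)).
Proof. exact: pG_rel. Qed.

Lemma cvg_pG j : pG G (r t j) @[t --> F] --> pG G (w j).
Proof. exact (cvK (@pG_cont R G (w j)) (rw j)). Qed.

Lemma cvg_sG j : sG G (r t j) @[t --> F] --> sG G (w j).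
Proof. exact (cvK (@sG_cont R G (w j)) (rw j)). Qed.

Lemma cvg_mlen i : mlen k (pt t) (st t) I i @[t --> F] --> mlen k pw sw I i.
Proof.
exact (cvD (cvD (cvD (cvg_pG _) (cvg_pG _)) (cvM (cvM (cvC k) (cvg_pG _)) (cvg_pG _)))
  (cvM (cvM (cvg_sG _) (cvg_sG _)) (cvC (I i)))).
Qed.

Lemma cvg_nlen i : nlen k (pt t) (st t) I i @[t --> F] --> nlen k pw sw I i.
Proof.
exact (cvM (cvg_mlen _) (cvD (cvC 2) (cvM (cvC k) (cvg_mlen _)))).
Qed.

Lemma cvg_Nang i : Nang k (pt t) (st t) I i @[t --> F] --> Nang k pw sw I i.
Proof.
exact (cvD (cvB (cvD (cvg_mlen _) (cvg_mlen _)) (cvg_mlen _))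
  (cvM (cvM (cvC k) (cvg_mlen _)) (cvg_mlen _))).
Qed.

Lemma cvg_cos_angG i : 0 < mlen k pw sw I (nx i) -> 0 < mlen k pw sw I (nx (nx i)) ->
  cos (angG G I (r t) i) @[t --> F] -->
  Nang k pw sw I i / Num.sqrt (nlen k pw sw I (nx i) * nlen k pw sw I (nx (nx i))).
Proof.
move=> m1 m2.
have n_gt0 j : 0 < mlen k pw sw I j -> 0 < nlen k pw sw I j.
  by move=> mj; rewrite mulr_gt0 // ltr_wpDr // mulr_ge0 // ltW.
have nn := mulr_gt0 (n_gt0 _ m1) (n_gt0 _ m2).
have h : Nang k (pt t) (st t) I i /
   Num.sqrt (nlen k (pt t) (st t) I (nx i) * nlen k (pt t) (st t) I (nx (nx i)))
   @[t --> F] --> Nang k pw sw I i /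
   Num.sqrt (nlen k pw sw I (nx i) * nlen k pw sw I (nx (nx i))).
  refine (cvM (cvg_Nang i) (cvV _ (cvK (@sqrt_continuous R _) _))).
    by rewrite gt_eqF // sqrtr_gt0.
  exact (cvM (cvg_nlen _) (cvg_nlen _)).
apply: (cv_near h).
apply: filterS r0 => t rt.
have p0 j : 0 < pG G (r t j) by exact: pG_gt0.
have s0 j : 0 < sG G (r t j) by exact: sG_gt0.
have n0 j : 0 < nlen k (pt t) (st t) I j by exact: nlen_gt0.
by rewrite /angG cos_ang // sqrtrM // (ltW (n0 _)).
Qed.

Lemma angG_near i : \forall t \near F, 0 <= angG G I (r t) i <= pi.
Proof.
by apply: filterS r0 => t rt; rewrite !ltW ?angG_ltpi ?angG_gt0.
Qed.

Lemma mlenw_gt0 i : (w (nx i) = 0 /\ 0 < w (nx (nx i))) \/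
  (0 < w (nx i) /\ w (nx (nx i)) = 0) -> 0 < mlen k pw sw I i.
Proof.
rewrite /mlen => -[[e h]|[h e]]; rewrite e pG0 sG0; have := pG_gt0 G h; lra.
Qed.

Lemma cvg_angG_interior i : (forall j, 0 < w j) ->
  angG G I (r t) i @[t --> F] --> angG G I w i.
Proof.
move=> wp; have p0 j : 0 < pG G (w j) by exact: pG_gt0.
have s0 j : 0 < sG G (w j) by exact: sG_gt0.
have m0 j : 0 < mlen k pw sw I j by exact: mlen_gt0.
have n0 j : 0 < nlen k pw sw I j by exact: nlen_gt0.
apply: cvg_of_cos (angG_near i) _; first by rewrite !ltW ?angG_ltpi ?angG_gt0.
have h := cvg_cos_angG i (m0 (nx i)) (m0 (nx (nx i))).
rewrite (_ : cos (angG G I w i) = Nang k pw sw I i /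
   Num.sqrt (nlen k pw sw I (nx i) * nlen k pw sw I (nx (nx i)))) //.
by rewrite /angG cos_ang // [in RHS]sqrtrM // ltW.
Qed.

(** In the limit the sides at corner i are the radii of the two other discs, and the law of cosines
    for the third side has cosine - I i. *)
Lemma cvg_angG_vertex i : w i = 0 -> 0 < w (nx i) -> 0 < w (nx (nx i)) ->
  angG G I (r t) i @[t --> F] --> acos (- I i).
Proof.
move=> wi wj wl; have Ii : -1 <= - I i <= 1.
  by have := I_gtN1 i; have := I_le1 i; move=> *; apply/andP; split; lra.
apply: cvg_of_cos (angG_near i) _; first by rewrite acos_ge0 ?acos_lepi.
rewrite acosK ?in_itv //=.
have h := @cvg_cos_angG i.
rewrite (_ : - I i = Nang k pw sw I i /
   Num.sqrt (nlen k pw sw I (nx i) * nlen k pw sw I (nx (nx i)))).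
  by apply: h; apply: mlenw_gt0; rewrite nx3; [right|left].
have sj : 0 < sG G (w (nx i)) by exact: sG_gt0.
have sl : 0 < sG G (w (nx (nx i))) by exact: sG_gt0.
rewrite /Nang /nlen /mlen !nx3 wi pG0 sG0.
have -> : (pG G (w (nx (nx i))) + 0 + k * pG G (w (nx (nx i))) * 0 +
  sG G (w (nx (nx i))) * 0 * I (nx i)) = pG G (w (nx (nx i))) by ring.
have -> : (0 + pG G (w (nx i)) + k * 0 * pG G (w (nx i)) +
  0 * sG G (w (nx i)) * I (nx (nx i))) = pG G (w (nx i)) by ring.
rewrite -!(rel w) -exprMn sqrtr_sqr ger0_norm ?mulr_ge0 ?ltW //.
by field; rewrite !gt_eqF.
Qed.

(** Both sides at corner i tend to w i while the opposite side collapses. *)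
Lemma cvg_angG_edge i : 0 < w i -> w (nx i) = 0 -> w (nx (nx i)) = 0 ->
  angG G I (r t) i @[t --> F] --> (0 : R).
Proof.
move=> wi wj wl.
apply: cvg_of_cos (angG_near i) _; first by rewrite lexx pi_ge0.
have h := @cvg_cos_angG i; rewrite cos0.
rewrite (_ : 1 = Nang k pw sw I i /
   Num.sqrt (nlen k pw sw I (nx i) * nlen k pw sw I (nx (nx i)))).
  by apply: h; apply: mlenw_gt0; rewrite nx3; [left|right].
have si : 0 < sG G (w i) by exact: sG_gt0.
rewrite /Nang /nlen /mlen !nx3 wj wl pG0 sG0.
have -> : 0 + pG G (w i) + k * 0 * pG G (w i) + 0 * sG G (w i) * I (nx i)
  = pG G (w i) by ring.
have -> : pG G (w i) + 0 + k * pG G (w i) * 0 + sG G (w i) * 0 * I (nx (nx i))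
  = pG G (w i) by ring.
rewrite -expr2 sqrtr_sqr ger0_norm; last by rewrite -(rel w) sqr_ge0.
have := lt0r_neq0 (exprn_gt0 2 si); rewrite (rel w) => h0.
by rewrite -[LHS](divff h0); congr (_ / _); ring.
Qed.

(** The denominators 2 + k m of [cos_asum] stay positive when sides collapse, so the third radius
    may tend to 0 as well. *)
Lemma cvg_sum_angG i : w i = 0 -> w (nx i) = 0 ->
  \sum_j angG G I (r t) j @[t --> F] --> (pi : R).
Proof.
move=> wi wj.
apply: cvg_of_cos; first by rewrite pi_ge0 lexx.
  apply: filterS r0 => t rt; rewrite angG_sum_le // andbT.
  by rewrite sumr_ge0 // => j _; rewrite ltW // angG_gt0.
rewrite cospi.
have cm := cvg_mlen; set m := mlen k pw sw I in cm.
have ml : m (nx (nx i)) = 0 by rewrite /m /mlen ?nx3 wi wj pG0 sG0; ring.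
have mi : m i = pG G (w (nx (nx i))) by rewrite /m /mlen ?nx3 wj pG0 sG0; ring.
have mj : m (nx i) = pG G (w (nx (nx i))) by rewrite /m /mlen ?nx3 wi pG0 sG0; ring.
have d0 : (2 + k * m i) * (2 + k * m (nx i)) * (2 + k * m (nx (nx i))) != 0.
  rewrite mi mj ml mulr0 addr0 !mulf_neq0 // gt_eqF // ltr_wpDr // mulr_ge0 // pG_ge0 //.
rewrite (_ : - 1 = 1 - (4 + k * (m i + m (nx i) + m (nx (nx i)))) ^+ 2 /
  ((2 + k * m i) * (2 + k * m (nx i)) * (2 + k * m (nx (nx i))))); last first.
  move: d0; rewrite mi mj ml mulr0 !addr0; set q := pG _ _ => d0.
  have h : 2 + k * q != 0.
    by apply: contra d0 => /eqP ->; rewrite !mul0r.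
  by field.
have c2 j : 2 + k * mlen k (pt t) (st t) I j @[t --> F] --> 2 + k * m j.
  exact (cvD (cvC 2) (cvM (cvC k) (cm j))).
have h : 1 - (4 + k * (mlen k (pt t) (st t) I i + mlen k (pt t) (st t) I (nx i) +
    mlen k (pt t) (st t) I (nx (nx i)))) ^+ 2 /
  ((2 + k * mlen k (pt t) (st t) I i) * (2 + k * mlen k (pt t) (st t) I (nx i)) *
   (2 + k * mlen k (pt t) (st t) I (nx (nx i))))
  @[t --> F] -->
  1 - (4 + k * (m i + m (nx i) + m (nx (nx i)))) ^+ 2 /
  ((2 + k * m i) * (2 + k * m (nx i)) * (2 + k * m (nx (nx i)))).
  have h4 : (4 + k * (mlen k (pt t) (st t) I i + mlen k (pt t) (st t) I (nx i) +
    mlen k (pt t) (st t) I (nx (nx i)))) @[t --> F] -->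
    4 + k * (m i + m (nx i) + m (nx (nx i))).
    exact (cvD (cvC 4) (cvM (cvC k) (cvD (cvD (cm i) (cm (nx i))) (cm (nx (nx i)))))).
  exact (cvB (cvC 1) (cvM (cvM h4 h4) (cvV d0 (cvM (cvM (c2 _) (c2 _)) (c2 _))))).
apply: (cv_near h).
apply: filterS r0 => t rt.
have p0 j : 0 < pG G (r t j) by exact: pG_gt0.
have s0 j : 0 < sG G (r t j) by exact: sG_gt0.
by rewrite (sum3 i); apply/esym; exact: cos_asum.
Qed.

End AngleLimits.

Set Implicit Arguments.

(** * Total angle of a triangle at a set of shrinking discs *)

Section FaceLimits.
Local Open Scope classical_set_scope.
Context {R : realType} (G : geom) (Th : 'I_3 -> R).
Implicit Types (B : pred 'I_3) (i : 'I_3) (r w : 'I_3 -> R).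
Let I i := cos (Th i).
Hypotheses (Th_itv : forall i, 0 <= Th i < pi) (C1term_ge0 : forall i, 0 <= C1term I i).

Lemma cosTh_gtN1 i : -1 < I i.
Proof.
have /andP[h0 h1] := Th_itv i.
by rewrite -cospi ltr_cos // in_itv /= ?pi_ge0 ?lexx // h0 ltW.
Qed.

Lemma cosTh_le1 i : I i <= 1. Proof. exact: cos_le1. Qed.

Lemma acosTh i : acos (- I i) = pi - Th i.
Proof.
have /andP[h0 h1] := Th_itv i.
by rewrite acosN ?cos_geN1 ?cos_le1 // cosK // in_itv /= h0 ltW.
Qed.

(* Limit of the total angle at the corners in [B] when the radii there shrink
   to 0 and the others do not. *)
Definition face_lim B : R :=
  \sum_i (if [&& B i, ~~ B (nx i) & ~~ B (nx (nx i))] then pi - Th i else 0)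
  + (if [exists i, B i && B (nx i)] then pi else 0).

Lemma nx_cases B : [\/ forall i, ~~ B i,
  exists i, [/\ B i, ~~ B (nx i) & ~~ B (nx (nx i))],
  exists i, [/\ B i, B (nx i) & ~~ B (nx (nx i))] |
  forall i, B i].
Proof.
have c : forall P : pred 'I_3, P ord0 -> P (nx ord0) -> P (nx (nx ord0)) -> forall i, P i.
  move=> P h0 h1 h2 i.
  have [->|[->|->]] // : i = ord0 \/ i = nx ord0 \/ i = nx (nx ord0).
  case: i => [[|[|[|]]]] // h; [left|right;left|right;right];
  by apply/val_inj; rewrite /= ?nxE /= ?nxE.
case b0 : (B ord0); case b1 : (B (nx ord0)); case b2 : (B (nx (nx ord0))).
- by constructor 4; apply: c.
- by constructor 3; exists ord0; rewrite b0 b1 b2.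
- by constructor 3; exists (nx (nx ord0)); rewrite !nx3 b0 b1 b2.
- by constructor 2; exists ord0; rewrite b0 b1 b2.
- by constructor 3; exists (nx ord0); rewrite !nx3 b0 b1 b2.
- by constructor 2; exists (nx ord0); rewrite !nx3 b0 b1 b2.
- by constructor 2; exists (nx (nx ord0)); rewrite !nx3 b0 b1 b2.
- by constructor 1; apply: (c (fun i => ~~ B i)); rewrite ?b0 ?b1 ?b2.
Qed.

Lemma face_lim0 B : (forall i, ~~ B i) -> face_lim B = 0.
Proof.
move=> h; rewrite /face_lim big1 ?add0r.
  by rewrite ifF //; apply/existsP => -[i]; rewrite (negPf (h i)).
by move=> i _; rewrite (negPf (h i)).
Qed.

Lemma face_limT B : (forall i, B i) -> face_lim B = pi.
Proof.
move=> h; rewrite /face_lim big1 ?add0r.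
  by rewrite ifT //; apply/existsP; exists ord0; rewrite !h.
by move=> i _; rewrite !h.
Qed.

Lemma face_lim1 B i : B i -> ~~ B (nx i) -> ~~ B (nx (nx i)) ->
  face_lim B = pi - Th i.
Proof.
move=> h0 h1 h2; rewrite /face_lim (sum3 i) !nx3 h0 h1 h2 (negPf h1) (negPf h2) /=.
rewrite !addr0 ifF ?addr0 //; apply/existsP => -[j].
have : [|| j == i, j == nx i | j == nx (nx i)].
  case: i {h0 h1 h2} => [[|[|[|]]]] // h; case: j => [[|[|[|]]]] // h';
  by rewrite -!(inj_eq val_inj) /= !nxE.
by case/or3P => /eqP ->; rewrite ?nx3 ?(negPf h1) ?(negPf h2) ?andbF.
Qed.

Lemma face_lim2 B i : B i -> B (nx i) -> ~~ B (nx (nx i)) -> face_lim B = pi.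
Proof.
move=> h0 h1 h2; rewrite /face_lim (sum3 i) !nx3 h0 h1 (negPf h2) /= !add0r.
by rewrite ifT //; apply/existsP; exists i; rewrite h0 h1.
Qed.

Lemma sumB B (f : 'I_3 -> R) i : \sum_(j | B j) f j =
  (if B i then f i else 0) + (if B (nx i) then f (nx i) else 0) +
  (if B (nx (nx i)) then f (nx (nx i)) else 0).
Proof. by rewrite big_mkcond (sum3 i). Qed.

(** With one corner in B the angle increases to its limit as its disc shrinks; with two corners this
    is [ang_pair]. *)
Lemma face_lim_gt B r : (forall i, 0 < r i) ->
  (exists i, B i) -> (exists i, ~~ B i) ->
  \sum_(i | B i) angG G I r i < face_lim B.
Proof.
move=> r0 [i1 Bi1] [i2 Bi2].
have a0 i : 0 < angG G I r i by apply: angG_gt0 => //; [exact: cosTh_gtN1|exact: cosTh_le1].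
have [h|[i [h0 h1 h2]]|[i [h0 h1 h2]]|h] := nx_cases B.
- by have := h i1; rewrite Bi1.
- rewrite (face_lim1 h0 h1 h2) (sumB _ _ i) h0 (negPf h1) (negPf h2) !addr0.
  (* The disc i is shrunk to the radius r i / (n + 1); the step from n = 0 to n = 1 provides the
     strict inequality. *)
  pose rr (n : nat) j : R := if j == i then n.+1%:R^-1 * r i else r j.
  pose w j : R := if j == i then 0 else r j.
  have nxi : nx i != i by rewrite -(inj_eq val_inj) /= nxE; case: (i) => [[|[|[|]]]].
  have nxxi : nx (nx i) != i.
    by rewrite -(inj_eq val_inj) /= !nxE; case: (i) => [[|[|[|]]]].
  have rr0 n j : 0 < rr n j by rewrite /rr; case: ifP => // _; rewrite mulr_gt0.
  have lim : angG G I (rr n) i @[n --> \oo] --> pi - Th i.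
    rewrite -acosTh.
    refine (cvg_angG_vertex _ G I cosTh_gtN1 cosTh_le1 C1term_ge0 rr w _ _ i _ _ _).
    - by apply: nearW.
    - move=> j; rewrite /rr /w; case: ifP => _; last exact: cvg_cst.
      rewrite -[0](mul0r (r i)); exact (cvM (@cvg_harmonic R) (cvC (r i))).
    - by rewrite /w eqxx.
    - by rewrite /w (negPf nxi).
    - by rewrite /w (negPf nxxi).
  have anti n : angG G I (rr n.+1) i <= angG G I (rr n.+2) i.
    apply: ltW; apply: angG_anti => //.
    + exact: cosTh_gtN1.
    + exact: cosTh_le1.
    + by rewrite /rr eqxx ltr_pM2r // ltf_pV2 ?posrE // ltr_nat.
    + by move=> j /negPf ji; rewrite /rr ji.
  have h : angG G I r i < angG G I (rr 1%N) i.
    apply: angG_anti => //.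
    + exact: cosTh_gtN1.
    + exact: cosTh_le1.
    + by rewrite /rr eqxx gtr_pMl // invf_lt1 // ltr1n.
    + by move=> j /negPf ji; rewrite /rr ji.
  apply: lt_le_trans h _.
  apply: (cvgr_to_ge lim).
  exists 1%N => // -[|n] // _ /=.
  elim: n => // n ih; exact: le_trans ih (anti n).
- rewrite (face_lim2 h0 h1 h2) (sumB _ _ i) h0 h1 (negPf h2) !addr0.
  by apply: angG_pair => //; [exact: cosTh_gtN1|exact: cosTh_le1].
- by have := h i2; rewrite (negPf Bi2).
Qed.

Lemma face_lim_ge B r : (forall i, 0 < r i) ->
  \sum_(i | B i) angG G I r i <= face_lim B.
Proof.
move=> r0; have [[i hi]|h] := pselect (exists i, B i); last first.
  by rewrite face_lim0 ?big1 // => i; [|apply/negP] => Bi; case: h; exists i.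
have [[j hj]|h] := pselect (exists i, ~~ B i).
  by apply/ltW/face_lim_gt => //; [exists i|exists j].
have BT l : B l by apply: contra_notT h => Bl; exists l.
rewrite face_limT // (eq_bigl predT) //.
by apply: angG_sum_le => //; [exact: cosTh_gtN1|exact: cosTh_le1].
Qed.

Lemma cvg_face_lim {T : Type} (F : set_system T) {FF : ProperFilter F}
  (r : T -> 'I_3 -> R) w :
  (\forall t \near F, forall j, 0 < r t j) -> (forall j, 0 <= w j) ->
  (forall j, r t j @[t --> F] --> w j) ->
  \sum_(i | w i == 0) angG G I (r t) i @[t --> F] --> face_lim (fun i => w i == 0).
Proof.
move=> r0 w0 rw; set B := fun i => w i == 0.
have wB i : ~~ B i -> 0 < w i by move=> h; rewrite lt_neqAle eq_sym h w0.
have wB' i : B i -> w i = 0 by move/eqP.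
have hg := cosTh_gtN1; have hl := cosTh_le1.
have [h|[i [h0 h1 h2]]|[i [h0 h1 h2]]|h] := nx_cases B.
- rewrite face_lim0 // (_ : (fun t => _) = fun=> 0); first exact: cvC.
  by apply/funext => t; rewrite big1 // => i Bi; move: (h i); rewrite /B Bi.
- rewrite (face_lim1 h0 h1 h2) -acosTh.
  rewrite (_ : (fun t => _) = fun t => angG G I (r t) i); last first.
    by apply/funext => t; rewrite (sumB B _ i) h0 (negPf h1) (negPf h2) !addr0.
  by refine (cvg_angG_vertex F G I hg hl C1term_ge0 r w r0 rw i _ _ _); auto.
(* The two angles need not converge separately; their sum is the total, which tends to pi, minus the
   third angle, which tends to 0. *)
- rewrite (face_lim2 h0 h1 h2).
  rewrite (_ : (fun t => _) = fun t =>
    \sum_j angG G I (r t) j - angG G I (r t) (nx (nx i))); last first.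
    apply/funext => t.
    by rewrite (sumB B _ i) h0 h1 (negPf h2) addr0 (sum3 i) addrK.
  rewrite -[pi]subr0; refine (cvB _ _).
    exact (cvg_sum_angG F G I hg hl C1term_ge0 r w r0 w0 rw i (wB' _ h0) (wB' _ h1)).
  refine (cvg_angG_edge F G I hg hl C1term_ge0 r w r0 rw (nx (nx i)) _ _ _); rewrite ?nx3; auto.
- rewrite face_limT //.
  rewrite (_ : (fun t => _) = fun t => \sum_j angG G I (r t) j); last first.
    by apply/funext => t; exact: eq_bigl.
  exact (cvg_sum_angG F G I hg hl C1term_ge0 r w r0 w0 rw ord0 (wB' _ (h ord0)) (wB' _ (h (nx ord0)))).
Qed.

End FaceLimits.

(** * The angle at a large hyperbolic disc is small, whatever the other radii *)

Section Barrier.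
Local Open Scope classical_set_scope.
Context {R : realType} (I : 'I_3 -> R).
Hypotheses (I_gtN1 : forall i, -1 < I i) (I_le1 : forall i, I i <= 1).
Hypothesis C1term_ge0 : forall i, 0 <= C1term I i.

Lemma cosh_ge (r : R) : (1 + r) / 2 <= coshR r.
Proof.
have := expR_ge1Dx r; have := expR_gt0 (- r); rewrite /coshR; lra.
Qed.

(** The cosh of each side at corner i is at least d C times the cosh of the other radius on it,
    while the cosh of the opposite side is at most twice the product of these two. They cancel in
    the law of cosines. *)
Lemma angG_small_aux (d C : R) (r : 'I_3 -> R) i : 0 < d -> d <= 1 ->
  (forall j, 2 * d <= 1 + I j) -> (forall j, 0 < r j) ->
  2 <= d * C -> C <= coshR (r i) ->
  1 - cos (angG Hyperbolic I r i) <= 8 / (d * C) ^+ 2.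
Proof.
move=> d0 d1 dI r0 dC Ci.
have p0 j : 0 < pG Hyperbolic (r j) by exact: pG_gt0.
have s0 j : 0 < sG Hyperbolic (r j) by exact: sG_gt0.
have rel j := pG_rel Hyperbolic (r j).
have k0 : 0 <= kap Hyperbolic :> R by exact: kap_ge0.
rewrite /angG cos_ang //.
set p := fun j => pG _ _; set s := fun j => sG _ _.
set m := mlen (kap Hyperbolic) p s I.
have m0 j : 0 < m j by exact: mlen_gt0.
have n0 j : 0 < nlen (kap Hyperbolic) p s I j by exact: nlen_gt0.
have nE j : nlen (kap Hyperbolic) p s I j = (1 + m j) ^+ 2 - 1.
  rewrite /nlen -/m /=; ring.
have C1 j : 1 < coshR (r j) by exact: cosh_gt1.
have S0 j : 0 < sinhR (r j) by exact: sinh_gt0.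
have SC j : sinhR (r j) <= coshR (r j).
  rewrite -(@ler_pXn2r _ 2) ?nnegrE ?ltW ?cosh_gt0 //.
  by rewrite cosh2 ltrDr.
have mE j : 1 + m j = coshR (r (nx j)) * coshR (r (nx (nx j))) +
    sinhR (r (nx j)) * sinhR (r (nx (nx j))) * I j.
  rewrite /m /mlen /p /s /=; ring.
have ss j l : sinhR (r j) * sinhR (r l) <= coshR (r j) * coshR (r l).
  by rewrite ler_pM ?(ltW (S0 _)).
have lb j : d * (coshR (r (nx j)) * coshR (r (nx (nx j)))) <= 1 + m j.
  rewrite mE; have := dI j; have := ss (nx j) (nx (nx j)).
  have := mulr_gt0 (S0 (nx j)) (S0 (nx (nx j))).
  move: (sinhR _ * sinhR _) (coshR _ * coshR _) (I j) => a b x a0 ab dx.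
  have [x0|x0] := leP 0 x.
    have : 0 <= a * x by rewrite mulr_ge0 // ltW.
    have : 0 <= (1 - d) * b by rewrite mulr_ge0 ?subr_ge0 //; lra.
    lra.
  have : 0 <= (b - a) * - x by rewrite mulr_ge0 ?subr_ge0 // oppr_ge0 ltW.
  have : 0 <= (1 + x - d) * b by rewrite mulr_ge0 //; lra.
  lra.
have ub : 1 + m i <= 2 * (coshR (r (nx i)) * coshR (r (nx (nx i)))).
  rewrite mE; have := ss (nx i) (nx (nx i)).
  have := mulr_gt0 (S0 (nx i)) (S0 (nx (nx i))).
  move: (sinhR _ * sinhR _) (coshR _ * coshR _) => a b a0 ab.
  have : a * I i <= a * 1 by rewrite ler_wpM2l // ltW.
  lra.
have qub j : Num.sqrt (nlen (kap Hyperbolic) p s I j) <= 1 + m j.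
  have h : 0 < 1 + m j by have := m0 j; lra.
  rewrite -(@ler_pXn2r _ 2) ?nnegrE ?sqrtr_ge0 ?(ltW h) // sqr_sqrtr ?(ltW (n0 j)) //.
  by rewrite nE gerBl.
have qlb j : 2 <= 1 + m j -> (1 + m j) / 2 <= Num.sqrt (nlen (kap Hyperbolic) p s I j).
  move=> h; rewrite -(@ler_pXn2r _ 2) ?nnegrE ?sqrtr_ge0 //; last by lra.
  rewrite sqr_sqrtr ?(ltW (n0 j)) // nE.
  have : 0 <= (1 + m j - 2) * (1 + m j + 2) by rewrite mulr_ge0; lra.
  lra.
set cj := coshR (r (nx i)); set cl := coshR (r (nx (nx i))).
have cj1 : 1 < cj by exact: C1.
have cl1 : 1 < cl by exact: C1.
have C0 : 0 < C.
  by rewrite -(pmulr_rgt0 _ d0); lra.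
have lj : d * C * cl <= 1 + m (nx i).
  apply: le_trans (lb (nx i)); rewrite nx3 -/cl -mulrA ler_pM2l // mulrC.
  by rewrite ler_pM2l //; lra.
have ll : d * C * cj <= 1 + m (nx (nx i)).
  apply: le_trans (lb (nx (nx i))); rewrite !nx3 -/cj -mulrA ler_pM2l //.
  by rewrite ler_pM2r //; lra.
have two x : 1 < x -> 2 <= d * C * x.
  move=> x1; have : 0 <= (d * C - 2) * x by rewrite mulr_ge0 //; lra.
  lra.
have qj := qlb (nx i) (le_trans (two _ cl1) lj).
have ql := qlb (nx (nx i)) (le_trans (two _ cj1) ll).
have qj' := qub (nx i); have ql' := qub (nx (nx i)).
set aj := Num.sqrt _ in qj qj' *; set al := Num.sqrt _ in ql ql' *.
have aj0 : 0 < aj by have := two _ cl1; lra.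
have al0 : 0 < al by have := two _ cj1; lra.
have N1 : aj * al - Nang (kap Hyperbolic) p s I i <= 1 + m i.
  have : aj * al <= (1 + m (nx i)) * (1 + m (nx (nx i))) by apply: ler_pM => //; exact: ltW.
  rewrite /Nang -/m /=; lra.
have -> : forall N : R, 1 - N / (aj * al) = (aj * al - N) / (aj * al).
  by move=> N; field; rewrite !gt_eqF.
rewrite ler_pdivrMr ?mulr_gt0 //.
apply: le_trans N1 _; apply: le_trans ub _; rewrite -/cj -/cl.
have dC0 : 0 < d * C by lra.
rewrite [leRHS]mulrAC ler_pdivlMr ?exprn_gt0 //.
have -> : 2 * (cj * cl) * (d * C) ^+ 2 = 8 * ((d * C * cl / 2) * (d * C * cj / 2)).
  by field.
rewrite ler_wpM2l // ler_pM //.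
- by rewrite divr_ge0 // mulr_ge0 ?(ltW dC0) //; lra.
- by rewrite divr_ge0 // mulr_ge0 ?(ltW dC0) //; lra.
- by apply: le_trans qj; rewrite ler_pM2r.
- by apply: le_trans ql; rewrite ler_pM2r.
Qed.

Lemma angG_small (e : R) : 0 < e -> exists2 M, 0 < M &
  forall (r : 'I_3 -> R) i, (forall j, 0 < r j) -> M <= r i ->
  angG Hyperbolic I r i < e.
Proof.
move=> e0.
pose d := Num.min ((1 + I ord0) / 2) (Num.min ((1 + I (nx ord0)) / 2)
  ((1 + I (nx (nx ord0))) / 2)).
have Ip i : 0 < 1 + I i by have := I_gtN1 i; lra.
have d0 : 0 < d by rewrite !lt_min !divr_gt0.
have dI j : 2 * d <= 1 + I j.
  have h0 : d <= (1 + I ord0) / 2 by rewrite ge_min lexx.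
  have h1 : d <= (1 + I (nx ord0)) / 2 by rewrite !ge_min lexx orbT.
  have h2 : d <= (1 + I (nx (nx ord0))) / 2 by rewrite !ge_min lexx !orbT.
  have [->|[->|->]] : j = ord0 \/ j = nx ord0 \/ j = nx (nx ord0);
    [|lra|lra|lra].
  case: j => [[|[|[|]]]] // h; [left|right;left|right;right];
  by apply/val_inj; rewrite /= ?nxE /= ?nxE.
have d1 : d <= 1 by have := dI ord0; have := I_le1 ord0; lra.
pose e' := Num.min e pi.
have e'0 : 0 < e' by rewrite lt_min e0 pi_gt0.
have e'pi : e' <= pi by rewrite ge_min lexx orbT.
have c1 : cos e' < 1.
  by rewrite -cos0 ltr_cos // in_itv /= ?lexx ?pi_ge0 // e'pi ltW.
pose q := 1 - cos e'; have q0 : 0 < q by rewrite subr_gt0.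
(* Makes d C at least 2 and 8 / (d C) ^+ 2 smaller than q; [cosh_ge] then turns the bound C on cosh
   r into the bound 2 C on r. *)
pose C := (2 + 8 / q) / d.
have q8 : 0 < 8 / q by rewrite divr_gt0.
have dC : d * C = 2 + 8 / q by rewrite /C mulrC divfK // gt_eqF.
have C0 : 0 < C by rewrite divr_gt0 // addr_gt0.
exists (2 * C) => [|r i r0 Mr]; first by rewrite mulr_gt0.
have Cr : C <= coshR (r i) by have := cosh_ge (r i); lra.
have h : 2 <= d * C by rewrite dC; lra.
have := angG_small_aux d0 d1 dI r0 h Cr; rewrite dC => h1.
have h2 : 8 / (2 + 8 / q) ^+ 2 < q.
  rewrite ltr_pdivrMr ?exprn_gt0 ?addr_gt0 //.
  have e8 : q * (8 / q) = 8 by rewrite mulrC divfK // gt_eqF.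
  have -> : q * (2 + 8 / q) ^+ 2 = 4 * q + 4 * (q * (8 / q)) + q * (8 / q) * (8 / q) by ring.
  rewrite e8; lra.
apply: (@lt_le_trans _ _ e'); last by rewrite ge_min lexx.
have a0 : 0 < angG Hyperbolic I r i by exact: angG_gt0.
have api : angG Hyperbolic I r i < pi by exact: angG_ltpi.
rewrite -ltr_cos ?in_itv /= ?e'pi ?ltW //.
by have := le_lt_trans h1 h2; rewrite /q; lra.
Qed.

End Barrier.

(** * Side lengths and angles of the triangulation in terms of one triangle of discs *)

Section Link.
Context {R : realType} {V E F : finType} (tv : F -> 'I_3 -> V) (te : F -> 'I_3 -> E).
Variables (G : geom) (Th : E -> R).
Hypotheses (Th_itv : forall e, 0 <= Th e < pi) (hC1 : C1 te Th).

Definition faceI (f : F) (i : 'I_3) : R := cos (Th (te f i)).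

Lemma faceI_gtN1 f i : -1 < faceI f i.
Proof. exact: (@cosTh_gtN1 _ (fun i => Th (te f i))). Qed.

Lemma faceI_le1 f i : faceI f i <= 1.
Proof. exact: cos_le1. Qed.

Lemma faceI_C1term f i : 0 <= C1term (faceI f) i.
Proof. exact: hC1. Qed.

Lemma acosh_ge0 (x : R) : 1 <= x -> 0 <= acoshR x.
Proof.
by move=> x1; rewrite /acoshR ln_ge0 // (le_trans x1) // lerDl sqrtr_ge0.
Qed.

Lemma coshD (x y : R) : coshR (x + y) = coshR x * coshR y + sinhR x * sinhR y.
Proof. rewrite /coshR /sinhR opprD !expRD; lra. Qed.

Variable r : V -> R.
Hypothesis r0 : forall v, 0 < r v.

Section Face.
Variable f : F.
Local Notation k := (kap G : R).
Local Notation p := (fun j => pG G (r (tv f j))).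
Local Notation s := (fun j => sG G (r (tv f j))).
Local Notation I := (faceI f).
Local Notation m := (mlen k p s I).
Local Notation n := (nlen k p s I).
Local Notation N := (Nang k p s I).

Let p0 j : 0 < p j. Proof. exact: pG_gt0. Qed.
Let s0 j : 0 < s j. Proof. exact: sG_gt0. Qed.
Let rel j : s j ^+ 2 = p j * (2 + k * p j). Proof. exact: pG_rel. Qed.
Let k0 : 0 <= k. Proof. exact: kap_ge0. Qed.
Let m0 i : 0 < m i.
Proof. by apply: mlen_gt0 => //; exact: faceI_gtN1. Qed.
Let n0 i : 0 < n i.
Proof. by apply: nlen_gt0 => //; exact: faceI_gtN1. Qed.

Let kapH : G = Hyperbolic -> k = 1. Proof. by move->. Qed.
Let kapE : G = Euclidean -> k = 0. Proof. by move->. Qed.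

Let NH i : G = Hyperbolic ->
  N i = m (nx i) + m (nx (nx i)) - m i + m (nx i) * m (nx (nx i)).
Proof. by move=> /kapH k1; rewrite /Nang k1 mul1r. Qed.

Let NE i : G = Euclidean -> N i = m (nx i) + m (nx (nx i)) - m i.
Proof. by move=> /kapE k1; rewrite /Nang k1 !mul0r addr0. Qed.

Lemma side_len_hyp i : G = Hyperbolic ->
  [/\ coshR (side_len tv te G Th r (f, i)) = 1 + m i,
      sinhR (side_len tv te G Th r (f, i)) = Num.sqrt (n i) &
      0 <= side_len tv te G Th r (f, i)].
Proof.
move=> GE; have -> : side_len tv te G Th r (f, i) = acoshR (1 + m i).
  rewrite /side_len /ssrc /stgt /sedge /mlen /faceI GE /=.
  by congr acoshR; ring.
have m1 : 1 <= 1 + m i by rewrite lerDl ltW.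
have [-> ->] := coshK m1; split => //; last exact: acosh_ge0.
have -> : n i = m i * (2 + m i) by rewrite /nlen kapH // mul1r.
by rewrite (_ : (1 + m i) ^+ 2 - 1 = m i * (2 + m i)) //; ring.
Qed.

Lemma side_len_euc i : G = Euclidean ->
  [/\ side_len tv te G Th r (f, i) = Num.sqrt (n i), n i = 2 * m i &
      side_len tv te G Th r (f, i) ^+ 2 = 2 * m i].
Proof.
move=> GE; have nE : n i = 2 * m i by rewrite /nlen kapE // mul0r addr0 mulrC.
have -> : side_len tv te G Th r (f, i) = Num.sqrt (n i).
  rewrite nE /side_len /ssrc /stgt /sedge /mlen /faceI GE /=.
  by congr (Num.sqrt _); field.
by rewrite sqr_sqrtr ?nE // mulr_ge0 // ltW.
Qed.

Lemma corner_angleE i : corner_angle tv te G Th r (f, i) =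
  angG G I (fun j => r (tv f j)) i.
Proof.
rewrite /corner_angle /angG /ang sqrtrM ?ltW //=.
case GE : {-}G.
  have [c0 _ _] := side_len_hyp i GE; have [c1 q1 _] := side_len_hyp (nx i) GE.
  have [c2 q2 _] := side_len_hyp (nx (nx i)) GE.
  rewrite {1}GE /= c0 c1 c2 q1 q2; congr (acos (_ / _)).
  rewrite NH //; ring.
have [e0 n0' q0] := side_len_euc i GE; have [e1 n1' q1] := side_len_euc (nx i) GE.
have [e2 n2' q2] := side_len_euc (nx (nx i)) GE.
rewrite {1}GE /= q0 q1 q2 e1 e2; congr acos.
rewrite NE //.
by field; rewrite !gt_eqF ?sqrtr_gt0.
Qed.

Lemma side_len_triangle i : side_len tv te G Th r (f, i) <
  side_len tv te G Th r (f, nx i) + side_len tv te G Th r (f, nx (nx i)).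
Proof.
have hN : `|N i| < Num.sqrt (n (nx i)) * Num.sqrt (n (nx (nx i))).
  apply: Nang_lt => //; [exact: faceI_gtN1|exact: faceI_le1|exact: faceI_C1term].
(* For the sides a, b, c this reads cosh a < cosh (b + c), resp. a^2 < (b + c)^2. *)
have {}hN : - N i < Num.sqrt (n (nx i)) * Num.sqrt (n (nx (nx i))).
  by apply: le_lt_trans hN; rewrite -normrN ler_norm.
rewrite ltNge; apply/negP => h.
case GE : {-}G.
  have [c0 _ l0] := side_len_hyp i GE; have [c1 q1 l1] := side_len_hyp (nx i) GE.
  have [c2 q2 l2] := side_len_hyp (nx (nx i)) GE.
  have := pG_le Hyperbolic (addr_ge0 l1 l2) h; rewrite /= coshD c0 c1 c2 q1 q2.
  rewrite NH // in hN; lra.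
have [e0 n0' q0] := side_len_euc i GE; have [e1 n1' q1] := side_len_euc (nx i) GE.
have [e2 n2' q2] := side_len_euc (nx (nx i)) GE.
rewrite NE // -e1 -e2 in hN.
have l1 : 0 <= side_len tv te G Th r (f, nx i) by rewrite e1 sqrtr_ge0.
have l2 : 0 <= side_len tv te G Th r (f, nx (nx i)) by rewrite e2 sqrtr_ge0.
have := lerXn2r 2 _ _ h; rewrite !nnegrE => /(_ (addr_ge0 l1 l2)).
rewrite {1}e0 sqrtr_ge0 => /(_ isT); rewrite sqrrD q0 q1 q2; lra.
Qed.

End Face.
End Link.

(** * Combinatorics of the triangulation *)

Lemma card_set_sum (T : finType) (P : pred T) : #|[set x | P x]| = (\sum_x P x)%N.
Proof. by rewrite -sum1dep_card big_mkcond; apply: eq_bigr => x _; case: ifP. Qed.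

Lemma connect_ind_closed (T : finType) (e : rel T) (P : T -> Prop) x y :
  (forall x y, P x -> e x y -> P y) -> connect e x y -> P x -> P y.
Proof.
move=> cl /connectP[p]; elim: p x => [|z p ih] x /= => [_ -> //|/andP[xz zp] e0 Px].
exact: ih zp e0 (cl _ _ Px xz).
Qed.

Section Surface.
Context {V E F : finType} (tv : F -> 'I_3 -> V) (te : F -> 'I_3 -> E).
Hypothesis surf : is_tri_surface tv te.

Local Notation side := (F * 'I_3)%type.
Local Notation sedge := (sedge te).
Local Notation ssrc := (ssrc tv).
Local Notation stgt := (stgt tv).
Local Notation cvert := (cvert tv).
Local Notation glued := (glued te).
Implicit Types (s : side) (v : V) (e : E) (A : {set V}).

Let sides_card e : (1 <= #|[set s | sedge s == e]| <= 2)%N.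
Proof. by case: surf. Qed.

Let glued_ends s s' : glued s s' -> ssrc s = stgt s' /\ stgt s = ssrc s'.
Proof. by case: surf => _ h _ _ _; exact: h. Qed.

Lemma gluedC s s' : glued s s' = glued s' s.
Proof. by rewrite /Defs.glued eq_sym [sedge s == _]eq_sym. Qed.

Lemma glued_bside s s' : glued s s' -> ~~ bside te s.
Proof.
move=> /andP[ss' e]; rewrite /bside /bedge neq_ltn; apply/orP; right.
rewrite (cardsD1 s) inE eqxx (cardsD1 s') !inE eq_sym ss' eq_sym e.
by [].
Qed.

Lemma bside_glued s : ~~ bside te s -> exists s', glued s s'.
Proof.
rewrite /bside /bedge (cardsD1 s) inE eqxx add1n eqSS -lt0n => /card_gt0P[s'].
by rewrite !inE => /andP[h1 h2]; exists s'; rewrite /Defs.glued eq_sym h1 eq_sym.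
Qed.

Lemma glued_uniq s s1 s2 : glued s s1 -> glued s s2 -> s1 = s2.
Proof.
move=> /andP[n1 e1] /andP[n2 e2]; apply/eqP; apply: contraT => n12.
have /andP[_] := sides_card (sedge s).
rewrite (cardsD1 s) inE eqxx (cardsD1 s1) !inE eq_sym n1 eq_sym e1 /=.
by rewrite (cardsD1 s2) !inE eq_sym n12 eq_sym n2 eq_sym e2.
Qed.

Lemma incidentE s v : incident tv te v (sedge s) = (ssrc s == v) || (stgt s == v).
Proof.
apply/existsP/idP => [[s' /andP[/eqP e h]]|h]; last by exists s; rewrite eqxx.
have [<-//|ss'] := eqVneq s' s.
have /glued_ends[-> ->] : glued s s' by rewrite /Defs.glued eq_sym ss' e eqxx.
by rewrite orbC.
Qed.

Definition touch A s := (ssrc s \in A) || (stgt s \in A).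

Lemma touchE A s : [exists v in A, incident tv te v (sedge s)] = touch A s.
Proof.
apply/existsP/orP => [[v /andP[vA]]|].
  by rewrite incidentE => /orP[] /eqP ->; [left|right].
by case=> h; [exists (ssrc s)|exists (stgt s)]; rewrite h incidentE eqxx ?orbT.
Qed.

Lemma in_linkE A f i : in_link tv te A (f, i) =
  [&& tv f i \in A, tv f (nx i) \notin A & tv f (nx (nx i)) \notin A].
Proof.
rewrite /in_link /Defs.cvert /=; congr (_ && _).
have -> : [forall v in A, ~~ incident tv te v (sedge (f, i))] =
   ~~ [exists v in A, incident tv te v (sedge (f, i))].
  rewrite negb_exists; apply: eq_forallb => v; by rewrite negb_and implybE.
by rewrite touchE /touch negb_or.
Qed.

(** An interior edge has two sides, a boundary edge one. *)
Lemma sum_touch A : (\sum_s touch A s)%N =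
  (2 * #|[set e | [exists v in A, incident tv te v e] && ~~ bedge te e]|
   + #|[set e | [exists v in A, incident tv te v e] && bedge te e]|)%N.
Proof.
pose tE e := [exists v in A, incident tv te v e].
rewrite (partition_big sedge xpredT) //=.
have sE e : (\sum_(s | sedge s == e) touch A s)%N = (tE e * #|[set s | sedge s == e]|)%N.
  rewrite (eq_bigr (fun=> nat_of_bool (tE e))) => [|s /eqP <-]; last by rewrite -touchE.
  by rewrite sum_nat_cond_const mulnC cardsE.
rewrite (eq_bigr _ (fun e _ => sE e)).
rewrite (eq_bigr (fun e => (2 * (tE e && ~~ bedge te e) + (tE e && bedge te e))%N)).
  by rewrite big_split /= -big_distrr /= !card_set_sum.
move=> e _; have := sides_card e; rewrite /bedge; case: (tE e) => //=.
by case: #|_| => [|[|[|]]].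
Qed.

(** * Boundary vertices and boundary edges are equally many *)

Section BoundaryCount.

(** [osd] and [isd] are the sides of the triangle of c that leave and enter its vertex; [Nrel] turns
    around the vertex by crossing the outgoing side. *)
Let osd (c : side) : side := (c.1, nx (nx c.2)).
Let isd (c : side) : side := (c.1, nx c.2).
Let Nrel : rel side := fun c c' => glued (osd c) (isd c').

Let src_osd c : ssrc (osd c) = cvert c.
Proof. by rewrite /Defs.ssrc /= nx3. Qed.
Let tgt_isd c : stgt (isd c) = cvert c.
Proof. by rewrite /Defs.stgt /= nx3. Qed.

Let cadjE c c' : cadj te c c' -> Nrel c c' || Nrel c' c.
Proof.
case: c => f i; case: c' => f' i'.
move=> /existsP[[g j]] /existsP[[g' j']] /andP[gl /orP[]] /=
   /andP[/eqP[-> ->] /eqP[-> ->]]; rewrite /Nrel /osd /isd /= !nx3 ?gl //.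
by rewrite orbC gluedC gl.
Qed.

Let Nrel_cvert c c' : Nrel c c' -> cvert c = cvert c'.
Proof. by move=> /glued_ends[]; rewrite src_osd tgt_isd. Qed.

Let isd_inj : injective isd.
Proof.
move=> [f i] [f' i'] [-> /(congr1 (fun x => nx (nx x)))].
by rewrite !nx3 => ->.
Qed.

Let osd_inj : injective osd.
Proof. by move=> [f i] [f' i'] [-> /(congr1 nx)]; rewrite !nx3 => ->. Qed.

(* Following the gluings around a vertex from a corner whose outgoing side is
   on the boundary reaches every other corner of that vertex. *)
Lemma bside_src_inj s s' : bside te s -> bside te s' -> ssrc s = ssrc s' -> s = s'.
Proof.
move=> bs bs' e; pose c : side := (s.1, nx s.2); pose d : side := (s'.1, nx s'.2).
have sc : osd c = s by rewrite /osd /= nx3; case: (s).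
have sd : osd d = s' by rewrite /osd /= nx3; case: (s').
have cd : connect (cadj te) c d by case: surf => _ _ h _ _; apply: h; exact: e.
have reach x y : connect Nrel x c -> cadj te x y -> connect Nrel y c.
  move=> xc /cadjE/orP[]; last by move=> /connect1 yx; exact: connect_trans xc.
  move=> xy; case/connectP: xc => [[|z p]] /=.
    by move=> _ e0; have := glued_bside xy; rewrite -e0 sc bs.
  move=> /andP[xz zp] ->; apply/connectP; exists p => //.
    by rewrite -(isd_inj (glued_uniq xz xy)).
  by rewrite -(isd_inj (glued_uniq xz xy)).
have dc : connect Nrel d c.
  exact: (connect_ind_closed (P := fun y => connect Nrel y c) reach cd).
case/connectP: dc => [[|z p]] /=.
  by move=> _ e0; rewrite -sc -sd /c -/c e0.
by move=> /andP[/glued_bside]; rewrite sd bs'.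
Qed.

(** If no boundary side started at v, turning around v would be an injective, hence surjective, map
    of the finite set of corners at v. The boundary side that ends at v would then be glued to
    another side. *)
Lemma bside_src_surj v : bvert tv te v -> exists2 s, bside te s & ssrc s = v.
Proof.
move=> /existsP[s /andP[bs /orP[/eqP <-|/eqP tv_s]]]; first by exists s.
have [/existsP[s' /andP[bs' /eqP e]]|h] := boolP [exists s', bside te s' && (ssrc s' == v)].
  by exists s'.
exfalso; pose c : side := (s.1, nx (nx s.2)).
have isc : isd c = s by rewrite /isd /= nx3; case: (s).
pose g x := odflt x [pick y | Nrel x y].
have gP x : cvert x = v -> Nrel x (g x).
  move=> xv; rewrite /g; case: pickP => //= no.
  have [s' gl] : exists s', glued (osd x) s'.
    apply: bside_glued; apply: contra h => bx; apply/existsP; exists (osd x).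
    by rewrite bx src_osd xv /=.
  have := no (s'.1, nx (nx s'.2)); rewrite /Nrel /isd /= nx3 -surjective_pairing.
  by rewrite gl.
pose Cv := [set x | cvert x == v].
have gC : g @: Cv \subset Cv.
  apply/fintype.subsetP => y /imsetP[x]; rewrite !inE => /eqP xv ->.
  by rewrite -(Nrel_cvert (gP x xv)) xv.
have gi : {in Cv &, injective g}.
  move=> x y; rewrite !inE => /eqP xv /eqP yv e.
  have gx := gP x xv; have gy := gP y yv; rewrite -e in gy.
  apply: osd_inj; apply: (@glued_uniq (isd (g x))); rewrite gluedC //.
have eC : g @: Cv = Cv.
  by apply/eqP; rewrite eqEcard gC card_in_imset /=.
have : c \in Cv by rewrite inE -tgt_isd isc tv_s.
rewrite -eC => /imsetP[x]; rewrite inE => /eqP xv e.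
have := gP x xv; rewrite -e /Nrel isc gluedC => /glued_bside.
by rewrite bs.
Qed.

Lemma card_bvert_bedge : #|[set v | bvert tv te v]| = #|[set e | bedge te e]|.
Proof.
have -> : [set v | bvert tv te v] = ssrc @: [set s | bside te s].
  apply/setP => v; rewrite inE; apply/idP/imsetP => [/bside_src_surj[s bs <-]|].
    by exists s; rewrite ?inE.
  by move=> [s]; rewrite inE => bs ->; apply/existsP; exists s; rewrite bs eqxx.
have -> : [set e | bedge te e] = sedge @: [set s | bside te s].
  apply/setP => e; rewrite inE; apply/idP/imsetP => [be|[s]]; last by rewrite inE => bs ->.
  have /andP[/card_gt0P[s]] := sides_card e; rewrite inE => /eqP es _.
  by exists s; rewrite ?inE // /bside es.
rewrite card_in_imset => [|s s']; last by rewrite !inE => bs bs'; exact: bside_src_inj.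
rewrite card_in_imset // => s s'; rewrite !inE => bs bs' e.
apply/eqP; apply: contraT => n.
by have := @glued_bside s s'; rewrite /Defs.glued n e eqxx bs => /(_ isT).
Qed.

End BoundaryCount.

(** Otherwise membership in A would spread across glued sides to every triangle. Such a triangle
    supplies the strict inequality in [sum_fld_lt]. *)
Lemma face_mixed A : A != finset.set0 -> A != [set: V] ->
  exists f, (exists i, tv f i \in A) /\ (exists i, tv f i \notin A).
Proof.
case: surf => _ _ _ hv [hf _] /set0Pn[v vA] AT.
have [w wA] : exists w, w \notin A.
  by apply/existsP; apply: contraR AT; rewrite negb_exists => /forallP h;
    apply/eqP/setP => x; rewrite inE; have := h x; rewrite negbK.
have [[f i] /= fv] := hv v; have [[f' i'] /= fw] := hv w.
have [//|no] := pselect (exists f, (exists i, tv f i \in A) /\ (exists i, tv f i \notin A)).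
have pure g j j' : tv g j \in A -> tv g j' \in A.
  move=> h; apply: contraT => h'; case: no; exists g; split; [by exists j|by exists j'].
have fA : tv f ord0 \in A by apply: (pure f i); move: fv; rewrite /Defs.cvert /= => ->.
have : tv f' ord0 \in A.
  apply: (connect_ind_closed (P := fun g => tv g ord0 \in A) _ (hf f f') fA).
  move=> g g' gA /existsP[j /existsP[j' /eqP e]].
  have [[<- _] //|ne] := eqVneq (g, j) (g', j').
  have gl : glued (g, j) (g', j') by rewrite /Defs.glued ne /Defs.sedge /= e eqxx.
  apply: (pure g' (nx j')); have [_] := glued_ends gl; rewrite /Defs.ssrc /Defs.stgt /= => <-.
  exact: pure gA.
by move=> /(pure f' _ i'); move: fw; rewrite /Defs.cvert /= => ->; rewrite (negPf wA).
Qed.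

Section Real.
Context {R : realType}.
Variable Th : E -> R.

Definition bangle v : R := if bvert tv te v then pi else 2 * pi.

(** A triangle with one, two or three corners in A has two, three or three sides touching A. Summed
    over triangles, this turns the terms pi of [face_lim] into counts of edges and triangles. *)
Lemma face_count A f : (if [exists i, (tv f i \in A) && (tv f (nx i) \in A)] then 1 else 0) =
  (\sum_i touch A (f, i))%:R - 2 * [exists i, tv f i \in A]%:R :> R.
Proof.
rewrite (sum3 ord0) /touch /Defs.ssrc /Defs.stgt /= !nx3.
have ex (P : pred 'I_3) : [exists i, P i] = [|| P ord0, P (nx ord0) | P (nx (nx ord0))].
  apply/existsP/or3P => [[i]|[]]; last 3 first.
  - by exists ord0.
  - by exists (nx ord0).
  - by exists (nx (nx ord0)).
  have [->|[->|->]] : i = ord0 \/ i = nx ord0 \/ i = nx (nx ord0);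
    [|by constructor 1|by constructor 2|by constructor 3].
  case: i => [[|[|[|]]]] // h; [left|right;left|right;right];
  by apply/val_inj; rewrite /= ?nxE /= ?nxE.
rewrite !ex !nx3.
by case: (tv f ord0 \in A); case: (tv f (nx ord0) \in A);
   case: (tv f (nx (nx ord0)) \in A) => /=; ring.
Qed.

Lemma sum_const_set (P : pred V) (c : R) :
  \sum_(v | P v) c = c * #|[set v | P v]|%:R.
Proof.
rewrite card_set_sum natr_sum mulr_sumr big_mkcond; apply: eq_bigr => v _.
by case: ifP => _; rewrite ?mulr1 ?mulr0.
Qed.

Lemma sum_bangle A : \sum_(v in A) bangle v =
  2 * pi * #|[set v in A | ~~ bvert tv te v]|%:R + pi * #|[set v in A | bvert tv te v]|%:R.
Proof.
rewrite (bigID (bvert tv te)) /= addrC; congr (_ + _).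
  rewrite (eq_bigr (fun=> 2 * pi)) => [|v /andP[_ /negPf h]]; last by rewrite /bangle h.
  exact: sum_const_set.
rewrite (eq_bigr (fun=> pi)) => [|v /andP[_ h]]; last by rewrite /bangle h.
exact: sum_const_set.
Qed.

Lemma sum_pairs A :
  \sum_f (if [exists i, (tv f i \in A) && (tv f (nx i) \in A)] then pi else 0 : R) =
  pi * ((2 * #|[set e | [exists v in A, incident tv te v e] && ~~ bedge te e]|
   + #|[set e | [exists v in A, incident tv te v e] && bedge te e]|)%:R
   - 2 * #|[set f | [exists i, tv f i \in A]]|%:R).
Proof.
rewrite -sum_touch card_set_sum.
rewrite (eq_bigr (fun f => pi * ((\sum_i touch A (f, i))%:R
   - 2 * [exists i, tv f i \in A]%:R))) => [|f _]; last first.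
  by rewrite -face_count; case: ifP => _; rewrite ?mulr1 ?mulr0.
rewrite -mulr_sumr sumrB -mulr_sumr -!natr_sum.
by congr (_ * (_%:R - _)); rewrite pair_bigA; apply: eq_bigr => -[].
Qed.

(** Identifies the right side in [attainable] with what the angles leave of the flat total when the
    radii in A shrink to 0. *)
Lemma attain_bound A :
  - (\sum_(c | in_link tv te A c) (pi - Th (sedge c)))
  + 2 * pi * (chi_GA_int tv te A)%:~R + pi * (chi_GA_bdry tv te A)%:~R =
  \sum_(v in A) bangle v
  - \sum_f face_lim (fun i => Th (te f i)) (fun i => tv f i \in A).
Proof.
have -> : \sum_(c | in_link tv te A c) (pi - Th (sedge c)) =
  \sum_f \sum_i (if [&& tv f i \in A, tv f (nx i) \notin A & tv f (nx (nx i)) \notin A]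
     then pi - Th (te f i) else 0).
  rewrite big_mkcond pair_bigA /=; apply: eq_bigr => -[f i] _ /=.
  by rewrite in_linkE.
rewrite /face_lim big_split /= opprD.
rewrite sum_pairs.
rewrite sum_bangle /chi_GA_int /chi_GA_bdry !(intrD, mulrNz) -!pmulrn.
rewrite natrD natrM; ring.
Qed.

(** Combinatorial Gauss-Bonnet: 3 #|F| is twice the number of interior edges plus that of boundary
    edges, and the latter is the number of boundary vertices. *)
Lemma attain_boundT : \sum_v bangle v - pi * #|F|%:R = 2 * pi * (@tri_chi V E F)%:~R.
Proof.
have ex f : [exists i : 'I_3, tv f i \in [set: V]] by apply/existsP; exists ord0; rewrite inE.
have f2 f : [exists i, (tv f i \in [set: V]) && (tv f (nx i) \in [set: V])].
  by apply/existsP; exists ord0; rewrite !inE.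
have et e : [exists v in [set: V], incident tv te v e].
  have /andP[/card_gt0P[s]] := sides_card e; rewrite inE => /eqP es _.
  by apply/existsP; exists (ssrc s); rewrite inE -es incidentE eqxx.
have := sum_touch [set: V].
have -> : (\sum_s touch [set: V] s = 3 * #|F|)%N.
  rewrite (eq_bigr (fun=> 1%N)) => [|s _]; last by rewrite /touch !inE.
  by rewrite sum1_card card_prod card_ord mulnC.
have -> : [set e | [exists v in [set: V], incident tv te v e] && ~~ bedge te e] =
   ~: [set e | bedge te e] by apply/setP => e; rewrite !inE et.
have -> : [set e | [exists v in [set: V], incident tv te v e] && bedge te e] =
   [set e | bedge te e] by apply/setP => e; rewrite !inE et.
have := cardsC [set e | bedge te e]; rewrite -card_bvert_bedge.
have := cardsC [set v | bvert tv te v].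
move=> /(congr1 (fun n => n%:R : R)); rewrite natrD => hV.
move=> /(congr1 (fun n => n%:R : R)); rewrite natrD => hE.
move=> /(congr1 (fun n => n%:R : R)); rewrite natrM natrD natrM => hF.
have -> : \sum_v bangle v = \sum_(v in [set: V]) bangle v by apply: eq_bigl => v; rewrite inE.
rewrite sum_bangle.
have -> : [set v in [set: V] | ~~ bvert tv te v] = ~: [set v | bvert tv te v].
  by apply/setP => v; rewrite !inE.
have -> : [set v in [set: V] | bvert tv te v] = [set v | bvert tv te v].
  by apply/setP => v; rewrite !inE.
rewrite /tri_chi !(intrD, mulrNz) -!pmulrn.
have hF' : #|F|%:R = (2 * #|~: [set e | bedge te e]|%:R + #|[set v | bvert tv te v]|%:R) / 3 :> R.
  by rewrite -hF; field.
rewrite -hV -hE hF'; lra.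
Qed.

End Real.

Lemma connected_osc {R : realType} : exists2 C : R, 0 <= C & forall x : V -> R, forall u v,
  `|x u - x v| <= C * \sum_f \sum_i `|x (tv f (nx i)) - x (tv f (nx (nx i)))|.
Proof.
case: surf => _ _ _ hv [hf _].
(* At most #|F| steps between adjacent triangles, each bounded by three times the sum, and one
   passage inside the triangle at either end. *)
exists (#|F|%:R * 3 + 2); first by rewrite addr_ge0 // mulr_ge0.
move=> x u v; set S := \sum_f _.
have osc f i j : `|x (tv f i) - x (tv f j)| <= S.
  apply: (@le_trans _ _ (\sum_l `|x (tv f (nx l)) - x (tv f (nx (nx l)))|)); last first.
    rewrite /S (bigD1 f) //= lerDl sumr_ge0 // => g _; exact: sumr_ge0.
  have cases : [\/ i = j, j = nx i | i = nx j].
    case: i => [[|[|[|]]]] // hi; case: j => [[|[|[|]]]] // hj;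
    [constructor 1|constructor 2|constructor 3|constructor 3|constructor 1|constructor 2
    |constructor 2|constructor 3|constructor 1]; by apply/val_inj; rewrite /= ?nxE.
  have S0 : 0 <= \sum_l `|x (tv f (nx l)) - x (tv f (nx (nx l)))| by exact: sumr_ge0.
  case: cases => [->|->|->]; first by rewrite subrr normr0.
  - rewrite (bigD1 (nx (nx i))) //= nx3 lerDl; exact: sumr_ge0.
  - rewrite (bigD1 (nx (nx j))) //= nx3 distrC lerDl; exact: sumr_ge0.
have S0 : 0 <= S by apply: sumr_ge0 => f _; exact: sumr_ge0.
have step f g : fadj te f g -> `|x (tv f ord0) - x (tv g ord0)| <= 3 * S.
  move=> /existsP[j /existsP[j' /eqP e]].
  have [[-> _]|ne] := eqVneq (f, j) (g, j').
    by rewrite subrr normr0 mulr_ge0.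
  have gl : glued (f, j) (g, j') by rewrite /Defs.glued ne /Defs.sedge /= e eqxx.
  have [_] := glued_ends gl; rewrite /Defs.ssrc /Defs.stgt /= => e'.
  have -> : x (tv f ord0) - x (tv g ord0) =
    (x (tv f ord0) - x (tv f (nx (nx j)))) + (x (tv g (nx j')) - x (tv g ord0)).
    by rewrite e'; ring.
  apply: le_trans (ler_normD _ _) _.
  by have := osc f ord0 (nx (nx j)); have := osc g (nx j') ord0; lra.
have chain f g : `|x (tv f ord0) - x (tv g ord0)| <= #|F|%:R * (3 * S).
  have /connectP[p pp ->] := hf f g.
  case/shortenP: pp => q qp quniq _.
  have qs : (size q <= #|F|)%N.
    by move: quniq => /= /andP[_ /card_uniqP <-]; exact: max_card.
  have h : `|x (tv f ord0) - x (tv (last f q) ord0)| <= (size q)%:R * (3 * S).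
    elim: q f qp {quniq qs} => [|f' q ih] f /=; first by rewrite subrr normr0 mul0r.
    move=> /andP[/step h1 /ih h2].
    have -> : x (tv f ord0) - x (tv (last f' q) ord0) = (x (tv f ord0) - x (tv f' ord0))
      + (x (tv f' ord0) - x (tv (last f' q) ord0)) by ring.
    by apply: le_trans (ler_normD _ _) _; rewrite -natr1; lra.
  apply: le_trans h _; rewrite ler_wpM2r ?mulr_ge0 // ler_nat //.
have [[f i] /= <-] := hv u; have [[g j] /= <-] := hv v.
rewrite /Defs.cvert /=.
have -> : x (tv f i) - x (tv g j) = (x (tv f i) - x (tv f ord0)) +
  ((x (tv f ord0) - x (tv g ord0)) + (x (tv g ord0) - x (tv g j))) by ring.
apply: le_trans (ler_normD _ _) _.
have h := ler_normD (x (tv f ord0) - x (tv g ord0)) (x (tv g ord0) - x (tv g j)).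
by have := osc f i ord0; have := osc g ord0 j; have := chain f g; lra.
Qed.

End Surface.

(** * Global solutions of Lipschitz equations *)

Section PicardLindelof.
Context {R : realType}.

Lemma half_pow_le0 (x D : R) : (forall n, x <= D * 2^-1 ^+ n) -> x <= 0.
Proof.
move=> h; rewrite leNgt; apply/negP => x0.
have D0 : 0 < D by have := h 0%N; rewrite expr0 mulr1; exact: lt_le_trans.
have [n hn] : exists n : nat, D / x < n%:R.
  by exists (Num.bound (D / x)); apply: archi_boundP; rewrite divr_ge0 // ltW.
have h2 : (n%:R : R) <= 2 ^+ n.
  by rewrite -natrX ler_nat ltnW // ltn_expl.
have := h n; rewrite exprVn ler_pdivlMr ?exprn_gt0 // leNgt => /negP; apply.
rewrite mulrC -ltr_pdivrMr //; exact: lt_le_trans h2.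
Qed.

Lemma half_pow_lim (a : nat -> R) (M : R) : 0 <= M ->
  (forall n, `|a n.+1 - a n| <= M * 2^-1 ^+ n) ->
  exists l, forall n, `|a n - l| <= 2 * M * 2^-1 ^+ n.
Proof.
move=> M0 h; pose b n := a n - 2 * M * 2^-1 ^+ n; pose c n := a n + 2 * M * 2^-1 ^+ n.
have e n : 2^-1 ^+ n = 2 * 2^-1 ^+ n.+1 :> R by rewrite exprS; lra.
have bS n : b n <= b n.+1.
  rewrite /b (e n); have := h n; rewrite (e n) ler_norml => /andP[+ _].
  by move: (2^-1 ^+ n.+1) => q; lra.
have cS n : c n.+1 <= c n.
  rewrite /c (e n); have := h n; rewrite (e n) ler_norml => /andP[_].
  by move: (2^-1 ^+ n.+1) => q; lra.
have bc n : b n <= c n.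
  have : 0 <= 2 * M * 2^-1 ^+ n by rewrite !mulr_ge0 // exprn_ge0.
  rewrite /b /c; lra.
have bm n m : (n <= m)%N -> b n <= b m.
  by move=> /subnK <-; elim: (m - n)%N => // d ih; rewrite addSn (le_trans ih).
have cm n m : (n <= m)%N -> c m <= c n.
  by move=> /subnK <-; elim: (m - n)%N => // d ih; rewrite addSn (le_trans _ ih).
have bcm n m : b n <= c m.
  have [nm|mn] := leqP n m; first by rewrite (le_trans (bm _ _ nm)).
  by rewrite (le_trans _ (cm _ _ (ltnW mn))).
have sb : has_sup [set x | exists n, x = b n]%classic.
  by split; [exists (b 0%N), 0%N|exists (c 0%N) => _ [n ->]].
exists (sup [set x | exists n, x = b n]%classic) => n.
have h1 : b n <= sup [set x | exists n, x = b n]%classic.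
  by apply: sup_upper_bound => //; exists n.
have h2 : sup [set x | exists n, x = b n]%classic <= c n.
  by apply: ge_sup; [exists (b 0%N), 0%N|move=> _ [m ->]].
rewrite ler_norml; move: h1 h2; rewrite /b /c => ? ?; apply/andP; split; lra.
Qed.

Lemma lip_continuous (f : R -> R) (L : R) :
  (forall s t, `|f s - f t| <= L * `|s - t|) -> continuous f.
Proof.
move=> h t; apply/cvgrPdist_lt => e e0.
have L1 : 0 < `|L| + 1 by rewrite ltr_wpDl.
near=> s; apply: le_lt_trans (h t s) _.
have st : `|t - s| < e / (`|L| + 1) by near: s; apply: cvgr_dist_lt; rewrite ?divr_gt0.
rewrite ltr_pdivlMr // in st.
have : L * `|t - s| <= `|L| * `|t - s| by rewrite ler_wpM2r ?ler_norm.
have := normr_ge0 (t - s); lra.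
Unshelve. all: by end_near. Qed.

Lemma antiderivative (f : R -> R) (c : R) : continuous f ->
  exists2 G : R -> R, G 0 = c & forall t : R, 0 <= t -> is_derive t 1 G (f t).
Proof.
move=> cf.
(* Starting at -1 makes 0 an interior point, so that the derivative at 0 is two-sided. *)
pose P x := \int[lebesgue_measure]_(t in `[(-1), x]%classic) f t.
exists (fun x => P x + (c - P 0)); first by rewrite addrC subrK.
move=> t t0.
have fi : lebesgue_measure.-integrable `[(-1), t + 1]%classic (EFin \o f).
  apply: continuous_compact_integrable; first exact: segment_compact.
  by apply: continuous_subspaceT.
have tu : t < t + 1 by rewrite ltrDl.
have at1 : -1 < t by apply: lt_le_trans t0; rewrite oppr_lt0.
have [dP eP] := continuous_FTC1_closed tu fi at1 (cf t).
have h : is_derive t 1 P (f t) by split => //; rewrite -derive1E.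
have H := isdD h (isdC (c - P 0) t); rewrite addr0 in H; exact: H.
Qed.

Lemma compare_exp (h dh : R -> R) (A c : R) : 0 < c -> 0 <= A -> h 0 = 0 ->
  (forall t : R, 0 <= t -> is_derive t 1 h (dh t)) ->
  (forall t, 0 <= t -> `|dh t| <= A * expR (c * t)) ->
  forall t, 0 <= t -> `|h t| <= A / c * expR (c * t).
Proof.
move=> c0 A0 h0 dhP dhb t t0.
have Ac : 0 <= A / c by rewrite divr_ge0 // ltW.
have dE (s : R) : is_derive s 1 (fun t => A / c * expR (c * t)) (A * expR (c * s)).
  apply: is_derive_eq (isdcM (A / c) (@isd_comp _ expR (fun t => c * t) _ _ _
    (is_derive_expR _) (isdcM c (is_derive_id s 1)))) _.
  by field; rewrite gt_eqF.
have E0 : A / c * expR (c * 0) = A / c by rewrite mulr0 expR0 mulr1.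
rewrite ler_norml; apply/andP; split.
- have := isd_nincr (f := fun s => - h s - A / c * expR (c * s))
    (df := fun s => - dh s - A * expR (c * s)) t0 => H.
  have : - h t - A / c * expR (c * t) <= - h 0 - A / c * expR (c * 0).
    apply: H => [s /andP[s0 _]|s /andP[/ltW s0 _]].
      exact: isdB (isdN (dhP s s0)) (dE s).
    by have := dhb s s0; rewrite ler_norml => /andP[? _]; lra.
  rewrite E0 h0; lra.
- have := isd_nincr (f := fun s => h s - A / c * expR (c * s))
    (df := fun s => dh s - A * expR (c * s)) t0 => H.
  have : h t - A / c * expR (c * t) <= h 0 - A / c * expR (c * 0).
    apply: H => [s /andP[s0 _]|s /andP[/ltW s0 _]].
      exact: isdB (dhP s s0) (dE s).
    by have := dhb s s0; rewrite ler_norml => /andP[_ ?]; lra.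
  rewrite E0 h0; lra.
Qed.

Lemma lip_of_derive (h dh : R -> R) (B : R) :
  (forall t : R, 0 <= t -> is_derive t 1 h (dh t)) ->
  (forall t, 0 <= t -> `|dh t| <= B) ->
  forall s t, 0 <= s -> 0 <= t -> `|h s - h t| <= B * `|s - t|.
Proof.
move=> dhP dhB.
have H s t : 0 <= s -> s < t -> `|h t - h s| <= B * `|t - s|.
  move=> s0 st.
  have [|x /andP[sx _] ->] := mvt (f := h) (df := dh) st.
    by move=> x /andP[sx _]; apply: dhP; exact: le_trans sx.
  by rewrite normrM ler_wpM2r // dhB // (le_trans s0) // ltW.
move=> s t s0 t0; have [st|ts|->] := ltgtP s t; last by rewrite !subrr !normr0 mulr0.
  by rewrite distrC [`|s - t|]distrC; exact: H.
exact: H.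
Qed.

Context {V : finType}.
Variables (g : (V -> R) -> V -> R) (K B : R) (u0 : V -> R).
Hypotheses (K0 : 0 <= K) (B0 : 0 <= B).
Hypothesis g_lip : forall y z v, `|g y v - g z v| <= K * \sum_w `|y w - z w|.
Hypothesis g_bnd : forall y v, `|g y v| <= B.

Let good (Y : R -> V -> R) := Y 0 = u0 /\
  forall v s t, 0 <= s -> 0 <= t -> `|Y s v - Y t v| <= B * `|s - t|.

Let picard_step (Y : {Y | good Y}) : exists Y' : {Y | good Y},
  forall (t : R) v, 0 <= t -> is_derive t 1 (fun s => sval Y' s v) (g (sval Y t) v).
Proof.
case: Y => Y [Y0 YB] /=.
(* Y is controlled at nonnegative times only; freezing it before 0 makes phi continuous on the whole
   line. *)
pose phi v s := g (Y (Num.max s 0)) v.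
have phic v : continuous (phi v).
  apply: (@lip_continuous _ (K * \sum_(w : V) B)) => s t.
  apply: le_trans (g_lip _ _ _) _; rewrite -mulrA ler_wpM2l // mulr_suml.
  apply: ler_sum => w _; apply: le_trans (YB _ _ _ _ _) _; rewrite ?le_max ?lexx ?orbT //.
  rewrite ler_wpM2l //; case: (leP s 0) => s0; case: (leP t 0) => t0 //.
  - by rewrite subrr normr0.
  - rewrite sub0r normrN gtr0_norm // distrC ger0_norm ?subr_ge0; last by lra.
    lra.
  - rewrite subr0 gtr0_norm // ger0_norm ?subr_ge0; last by lra.
    lra.
have H v : exists G : R -> R, G 0 = u0 v /\ forall t : R, 0 <= t -> is_derive t 1 G (phi v t).
  by have [G G0 GP] := antiderivative (u0 v) (phic v); exists G.
have [Gf GP] := boolp.choice H.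
have Gd (t : R) v : 0 <= t -> is_derive t 1 (Gf v) (g (Y t) v).
  by move=> t0; have [_ /(_ t t0)] := GP v; rewrite /phi max_l.
have gd : good (fun t v => Gf v t).
  split; first by apply/funext => v; case: (GP v).
  move=> v; exact: (lip_of_derive (h := Gf v) (dh := fun t => g (Y t) v)
    (fun t => @Gd t v) (fun t _ => g_bnd _ _)).
by exists (exist _ _ gd).
Qed.

Lemma ode_exists : exists2 Y : R -> V -> R, Y 0 = u0 &
  forall (t : R) v, 0 <= t -> is_derive t 1 (fun s => Y s v) (g (Y t) v).
Proof.
have good0 : good (fun _ => u0).
  by split => // v s t _ _; rewrite subrr normr0 mulr_ge0.
have [nxt nxtP] := boolp.choice picard_step.
pose S n := iter n nxt (exist _ _ good0); pose Y n := sval (S n).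
have Yd n (t : R) v : 0 <= t -> is_derive t 1 (fun s => Y n.+1 s v) (g (Y n t) v).
  exact: nxtP.
have Y0 n : Y n 0 = u0 by rewrite /Y; case: (S n) => ? [].
pose L := K * #|V|%:R + 1.
have L1 : 1 <= L by rewrite lerDr mulr_ge0.
have L0 : 0 < L by lra.
(* With this rate a Picard step halves the norm sup |h t| exp (- c t), which gives convergence on
   the whole half-line at once. *)
pose c := 2 * L; have c0 : 0 < c by rewrite mulr_gt0.
pose C := B / c; have C0 : 0 <= C by rewrite divr_ge0 // ltW.
have hp n : 0 <= 2^-1 ^+ n :> R by rewrite exprn_ge0.
have gL y z v M : 0 <= M -> (forall w, `|y w - z w| <= M) -> `|g y v - g z v| <= L * M.
  move=> M0 h; apply: le_trans (g_lip _ _ _) _.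
  apply: (@le_trans _ _ (K * \sum_(w : V) M)).
    by rewrite ler_wpM2l //; exact: ler_sum.
  rewrite sumr_const -mulr_natl mulrA ler_wpM2r // cardT -cardE.
  by rewrite /L lerDl.
have est n t v : 0 <= t -> `|Y n.+1 t v - Y n t v| <= C * 2^-1 ^+ n * expR (c * t).
  elim: n t v => [|n ih] t v t0.
    rewrite expr0 mulr1.
    apply: (compare_exp (h := fun t => Y 1%N t v - Y 0%N t v)
      (dh := fun t => g (Y 0%N t) v - 0) c0 B0 _ _ _ t0).
    - by rewrite !Y0 subrr.
    - by move=> s s0; apply: isdB (Yd 0%N s v s0) _; exact: isdC.
    - move=> s s0; rewrite subr0; apply: le_trans (g_bnd _ _) _.
      by rewrite ler_peMr // -expR0 ler_expR mulr_ge0 // ltW.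
  have -> : C * 2^-1 ^+ n.+1 * expR (c * t) = L * (C * 2^-1 ^+ n) / c * expR (c * t).
    by rewrite exprS /c; field; rewrite gt_eqF.
  apply: (compare_exp (h := fun t => Y n.+2 t v - Y n.+1 t v)
    (dh := fun t => g (Y n.+1 t) v - g (Y n t) v) c0 _ _ _ _ t0).
  - exact: mulr_ge0 (ltW L0) (mulr_ge0 C0 (hp n)).
  - by rewrite !Y0 subrr.
  - by move=> s s0; apply: isdB; exact: Yd.
  - move=> s s0; rewrite -mulrA; apply: gL.
      exact: mulr_ge0 (mulr_ge0 C0 (hp n)) (expR_ge0 _).
    by move=> w; exact: ih.
have lim (t : R) v : exists l, 0 <= t -> forall n, `|Y n t v - l| <= 2 * (C * expR (c * t)) * 2^-1 ^+ n.
  have [t0|t0] := leP 0 t; last by exists 0.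
  have [||l h] := half_pow_lim (a := fun n => Y n t v) (M := C * expR (c * t)).
  - by rewrite mulr_ge0 // expR_ge0.
  - by move=> n; rewrite mulrAC; exact: est.
  by exists l.
have [yl ylP] := boolp.choice (fun tv : R * V => lim tv.1 tv.2).
pose y t v := yl (t, v).
have yP t v n : 0 <= t -> `|Y n t v - y t v| <= 2 * (C * expR (c * t)) * 2^-1 ^+ n.
  by move=> t0; exact: (ylP (t, v)).
have gy : good y.
  split.
    apply/funext => v; apply/eqP; rewrite -subr_eq0 -normr_le0.
    apply: (@half_pow_le0 _ (2 * (C * expR (c * 0)))) => n.
    by rewrite distrC -{1}(Y0 n); exact: yP.
  move=> v s t s0 t0; rewrite -subr_le0.
  apply: (@half_pow_le0 _ (2 * (C * expR (c * s)) + 2 * (C * expR (c * t)))) => n.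
  have YB : `|Y n s v - Y n t v| <= B * `|s - t|.
    by rewrite /Y; case: (S n) => ? [_ h] /=; exact: h.
  have -> : y s v - y t v = (y s v - Y n s v) + ((Y n s v - Y n t v) + (Y n t v - y t v)) by ring.
  have h1 := ler_normD (y s v - Y n s v) ((Y n s v - Y n t v) + (Y n t v - y t v)).
  have h2 := ler_normD (Y n s v - Y n t v) (Y n t v - y t v).
  have h3 := yP s v n s0; have h4 := yP t v n t0; rewrite distrC in h3.
  rewrite mulrDl; lra.
(* One more step from the limit y: Z is differentiable by construction, and it equals y for t >= 0
   because the iterates converge to both. *)
have [[Z [Z0 ZB]] /= ZP] := picard_step (exist _ _ gy).
have Zy t : 0 <= t -> Z t = y t.
  move=> t0; apply/funext => v; apply/eqP; rewrite -subr_eq0 -normr_le0.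
  apply: (@half_pow_le0 _ (2 * (C * expR (c * t)))) => n.
  have h1 : `|Z t v - Y n.+1 t v| <= L * (2 * C * 2^-1 ^+ n) / c * expR (c * t).
    apply: (compare_exp (h := fun t => Z t v - Y n.+1 t v)
      (dh := fun t => g (y t) v - g (Y n t) v) c0 _ _ _ _ t0).
    - exact: mulr_ge0 (ltW L0) (mulr_ge0 (mulr_ge0 _ C0) (hp n)).
    - by rewrite Z0 Y0 subrr.
    - by move=> s s0; apply: isdB; [exact: ZP|exact: Yd].
    - move=> s s0; rewrite -mulrA; apply: gL.
        exact: mulr_ge0 (mulr_ge0 (mulr_ge0 _ C0) (hp n)) (expR_ge0 _).
      by move=> w; rewrite distrC; have := yP s w n s0; lra.
  have -> : Z t v - y t v = (Z t v - Y n.+1 t v) + (Y n.+1 t v - y t v) by ring.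
  apply: le_trans (ler_normD _ _) _.
  have h2 := yP t v n.+1 t0.
  have e1 : L * (2 * C * 2^-1 ^+ n) / c * expR (c * t) = C * expR (c * t) * 2^-1 ^+ n.
    by rewrite /c; field; rewrite gt_eqF.
  by rewrite e1 in h1; rewrite exprS in h2; lra.
exists Z => // t v t0; rewrite (Zy t t0); exact: ZP.
Qed.

End PicardLindelof.

(** * Curvature defect and equilibria *)

Section Field.
Local Open Scope classical_set_scope.
Context {R : realType} {V E F : finType} (tv : F -> 'I_3 -> V) (te : F -> 'I_3 -> E).
Variables (G : geom) (Th : E -> R) (k : V -> R).
Hypothesis surf : is_tri_surface tv te.
Hypotheses (Th_itv : forall e, 0 <= Th e < pi) (hC1 : C1 te Th).
Implicit Types (r : V -> R) (A : {set V}) (v : V) (f : F) (i : 'I_3).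

Local Notation I := (faceI te Th).
Local Notation b := (@bangle V E F tv te R).
Local Notation rf r f := (fun j => r (tv f j)).

Let IgtN1 f i : -1 < I f i. Proof. exact: faceI_gtN1. Qed.
Let Ile1 f i : I f i <= 1. Proof. exact: faceI_le1. Qed.
Let IPP f i : 0 <= C1term (I f) i. Proof. exact: faceI_C1term. Qed.

Definition fld r v : R :=
  k v - b v + \sum_(c : F * 'I_3 | cvert tv c == v) angG G (I c.1) (rf r c.1) c.2.

Lemma fldE r v : (forall v, 0 < r v) -> k v - curv tv te G Th r v = fld r v.
Proof.
move=> r0; rewrite /curv /fld /bangle opprB addrA addrAC; congr (_ + _).
by apply: eq_bigr => -[f i] _; rewrite corner_angleE.
Qed.

Lemma sum_corners (P : pred V) (x : V -> R) (a : F * 'I_3 -> R) :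
  \sum_(v | P v) x v * (\sum_(c | cvert tv c == v) a c) =
  \sum_f \sum_(i | P (tv f i)) x (tv f i) * a (f, i).
Proof.
transitivity (\sum_(c | P (cvert tv c)) x (cvert tv c) * a c).
  rewrite (partition_big (cvert tv) P) //=; apply: eq_bigr => v Pv.
  rewrite mulr_sumr; apply: eq_big => [c|c /eqP -> //].
  by case: eqP => [->|]; rewrite ?Pv ?andbF.
by rewrite pair_big_dep /=; apply: eq_big => -[f i].
Qed.

Lemma fld_mono r r' v : (forall v, 0 < r v) -> (forall v, r v <= r' v) ->
  r v = r' v -> fld r v <= fld r' v.
Proof.
move=> r0 rr e; rewrite lerD2l; apply: ler_sum => -[f i] /eqP /= cv.
by apply: angG_mono => //=; rewrite -/(cvert tv (f, i)) cv.
Qed.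

(** The limit of the sum of [fld] over A when exactly the radii in A tend to 0 ([sum_fld_cvg]): the
    slack in the inequality of attainability. *)
Definition face_gap A : R := \sum_(v in A) k v - \sum_(v in A) b v +
  \sum_f face_lim (fun i => Th (te f i)) (fun i => tv f i \in A).

Lemma sum_fld x A : \sum_(v in A) fld x v = \sum_(v in A) k v - \sum_(v in A) b v +
  \sum_f \sum_(i | tv f i \in A) angG G (I f) (rf x f) i.
Proof.
rewrite /fld big_split /= sumrB; congr (_ + _).
transitivity (\sum_(v in A) 1 * (\sum_(c | cvert tv c == v)
    angG G (I c.1) (rf x c.1) c.2)).
  by apply: eq_bigr => v _; rewrite mul1r.
rewrite sum_corners; apply: eq_bigr => f _; apply: eq_bigr => i _.
by rewrite mul1r.
Qed.

Section Limit.
Context {T : Type} (FF : set_system T) {PF : ProperFilter FF}.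
Variables (r : T -> V -> R) (w : V -> R).
Hypothesis r0 : \forall t \near FF, forall v, 0 < r t v.
Hypothesis w0 : forall v, 0 <= w v.
Hypothesis rw : forall v, r t v @[t --> FF] --> w v.

Lemma fld_cvg v : (forall v, 0 < w v) -> fld (r t) v @[t --> FF] --> fld w v.
Proof.
move=> wp; refine (cvD (cvC _) (cv_sum _)) => -[f i] _ /=.
refine (cvg_angG_interior FF G (I f) (IgtN1 f) (Ile1 f) (IPP f)
  (fun t => rf (r t) f) (rf w f) _ (fun j => @rw (tv f j)) i (fun j => wp _)).
by apply: filterS r0 => t h j.
Qed.

Lemma sum_fld_cvg : let A := [set v | w v == 0]%SET in
  \sum_(v in A) fld (r t) v @[t --> FF] --> face_gap A.
Proof.
move=> A; rewrite (_ : (fun t => _) = fun t => \sum_(v in A) k v - \sum_(v in A) b v +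
  \sum_f \sum_(i | w (tv f i) == 0) angG G (I f) (rf (r t) f) i); last first.
  apply/funext => t; rewrite sum_fld; congr (_ + _); apply: eq_bigr => f _.
  by apply: eq_bigl => i; rewrite inE.
have -> : face_gap A = \sum_(v in A) k v - \sum_(v in A) b v +
  \sum_f face_lim (fun i => Th (te f i)) (fun i => w (tv f i) == 0).
  congr (_ + _); apply: eq_bigr => f _; congr face_lim.
  by apply/funext => i; rewrite inE.
refine (cvD (cvC _) (cv_sum _)) => f _.
refine (@cvg_face_lim R G (fun i => Th (te f i)) (fun i => Th_itv _) (IPP f) T FF PF
  (fun t => rf (r t) f) (rf w f) _ (fun j => w0 _) (fun j => @rw (tv f j))).
by apply: filterS r0 => t h j.
Qed.

End Limit.

Lemma attainable_gap A : attainable tv te Th k -> A != finset.set0 -> A != [set: V]%SET ->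
  0 < face_gap A.
Proof.
move=> att A0 AT; have := att A A0 AT.
rewrite (attain_bound surf Th A) /face_gap; lra.
Qed.

Lemma gap_setT : face_gap [set: V]%SET = \sum_v k v - 2 * pi * (@tri_chi V E F)%:~R.
Proof.
rewrite -(attain_boundT surf) /face_gap.
have e (x : V -> R) : \sum_(v in [set: V]%SET) x v = \sum_v x v.
  by apply: eq_bigl => v; rewrite inE.
rewrite !e opprB addrA addrAC; congr (_ + _).
rewrite (eq_bigr (fun=> pi)) => [|f _]; last by rewrite face_limT // => i; rewrite inE.
by rewrite sumr_const cardT -cardE mulr_natr.
Qed.

Lemma sum_fld_lt r A : (forall v, 0 < r v) -> A != finset.set0 -> A != [set: V]%SET ->
  \sum_(v in A) fld r v < face_gap A.
Proof.
move=> r0 A0 AT; have [f [h1 h2]] := face_mixed surf A0 AT.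
rewrite sum_fld ltrD2l (bigD1 f) //= [ltRHS](bigD1 f) //=.
apply: ltr_leD.
  exact: (face_lim_gt _ (fun i => Th_itv _) (IPP f) (fun j => r0 (tv f j))).
apply: ler_sum => g _.
exact: (face_lim_ge _ (fun i => Th_itv _) (IPP g) _ (fun j => r0 (tv g j))).
Qed.

Lemma equilibrium_attainable r : (forall v, 0 < r v) -> (forall v, fld r v = 0) ->
  attainable tv te Th k.
Proof.
move=> r0 e A A0 AT; have := sum_fld_lt r0 A0 AT.
rewrite big1 // (attain_bound surf Th A) /face_gap; lra.
Qed.

Lemma sum_fld_euc r : G = Euclidean -> (forall v, 0 < r v) ->
  \sum_v fld r v = \sum_v k v - 2 * pi * (@tri_chi V E F)%:~R.
Proof.
move=> GE r0; rewrite -gap_setT.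
have -> : \sum_v fld r v = \sum_(v in [set: V]%SET) fld r v.
  by apply: eq_bigl => v; rewrite inE.
rewrite sum_fld /face_gap; congr (_ + _); apply: eq_bigr => f _.
rewrite face_limT => [|i]; last by rewrite inE.
rewrite (eq_bigl predT) => [|i]; last by rewrite inE.
exact: (angG_sum_eq (IgtN1 f) (Ile1 f) (IPP f) (fun j => r0 (tv f j)) GE).
Qed.

Lemma fld_barrier : G = Hyperbolic -> (forall v, k v < b v) ->
  exists2 M, 0 < M & forall r v, (forall v, 0 < r v) -> M <= r v -> fld r v < 0.
Proof.
move=> GE kb.
(* If every angle at v is at most e v, their total stays strictly below b v - k v. *)
pose e v := (b v - k v) / (#|{: F * 'I_3}|%:R + 1).
have n1 : 0 < #|{: F * 'I_3}|%:R + 1 :> R by rewrite ltr_wpDl.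
have e0 v : 0 < e v by rewrite divr_gt0 // subr_gt0.
have H (vf : V * F) : exists M, 0 < M /\ forall (x : 'I_3 -> R) i,
    (forall j, 0 < x j) -> M <= x i -> angG Hyperbolic (I vf.2) x i < e vf.1.
  have [M M0 MP] := angG_small (IgtN1 vf.2) (Ile1 vf.2) (IPP vf.2) (e0 vf.1).
  by exists M.
have [Mf MP] := boolp.choice H.
have Mf0 vf : 0 < Mf vf by case: (MP vf).
exists (\sum_vf Mf vf + 1); first by rewrite ltr_wpDl // sumr_ge0 // => vf _; exact: ltW.
move=> r v r0 Mr.
have small (c : F * 'I_3) : cvert tv c == v -> angG G (I c.1) (rf r c.1) c.2 <= e v.
  case: c => f i /eqP cv /=; rewrite GE; apply: ltW.
  have [_ h] := MP (v, f); apply: h => //=.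
  rewrite -/(cvert tv (f, i)) cv; apply: le_trans Mr.
  rewrite (bigD1 (v, f)) //= -addrA lerDl addr_ge0 // sumr_ge0 // => vf _.
  exact: ltW.
have sm : \sum_(c | cvert tv c == v) angG G (I c.1) (rf r c.1) c.2 <= e v * #|{: F * 'I_3}|%:R.
  apply: (@le_trans _ _ (\sum_(c | cvert tv c == v) e v)); first exact: ler_sum.
  rewrite sumr_const -[leLHS]mulr_natr; apply: ler_wpM2l; first exact: ltW.
  by rewrite ler_nat max_card.
have ee : e v * (#|{: F * 'I_3}|%:R + 1) = b v - k v by rewrite /e divfK // gt_eqF.
have := e0 v; rewrite /fld; lra.
Qed.

Section Obstacle.
Variable M : R.
Hypothesis M0 : 0 < M.

Definition subsol r := (forall v, 0 < r v <= M) /\ (forall v, r v < M -> fld r v <= 0).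

(** At a vertex where r is the smaller one, passing from the minimum to r raises the other radii
    only, hence raises [fld], which is nonpositive at r. *)
Lemma subsol_min r r' : subsol r -> subsol r' ->
  subsol (fun v => Num.min (r v) (r' v)).
Proof.
move=> [h1 h2] [h1' h2']; have r0 v : 0 < r v by case/andP: (h1 v).
have r'0 v : 0 < r' v by case/andP: (h1' v).
have m0 v : 0 < Num.min (r v) (r' v) by rewrite lt_min r0 r'0.
split=> v /=; first by rewrite m0 ge_min; case/andP: (h1 v) => _ ->.
have [rr|rr] := leP (r v) (r' v) => rM.
  apply: le_trans (h2 v rM); apply: fld_mono => // [u|].
    by rewrite ge_min lexx.
  by rewrite (min_idPl rr).
apply: le_trans (h2' v rM); apply: fld_mono => // [u|].
  by rewrite ge_min lexx orbT.
by rewrite (min_idPr (ltW rr)).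
Qed.

Lemma subsol_top : subsol (fun=> M).
Proof. by split => v; rewrite ?M0 ?lexx // ltxx. Qed.

Lemma obstacle : exists w rn, [/\ forall v, 0 <= w v <= M,
  forall n, subsol (rn n), forall v, rn n v @[n --> \oo] --> w v &
  (forall v, 0 < w v) -> (forall v, 0 <= fld w v) /\ (forall v, w v < M -> fld w v = 0)].
Proof.
pose S v := [set x | exists2 r, subsol r & x = r v].
pose w v := inf (S v).
have Slb v : lbound (S v) 0 by move=> _ [r [h _] ->]; have /andP[/ltW] := h v.
have S0 v : S v !=set0 by exists M, (fun=> M) => //; exact: subsol_top.
have Sinf v : has_inf (S v) by split; [exact: S0|exists 0; exact: Slb].
have w0 v : 0 <= w v by apply: lb_le_inf => //; exact: Slb.
have wle r v : subsol r -> w v <= r v.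
  by move=> hr; apply: ge_inf; [exists 0; exact: Slb|exists r].
have wM v : w v <= M by exact: (wle (fun=> M) v subsol_top).
have approx e : 0 < e -> exists2 r, subsol r & forall v, r v < w v + e.
  move=> e0.
  (* The infimum is taken vertex by vertex; minima of finitely many members approach it at all
     vertices simultaneously. *)
  have H (s : seq V) : exists2 r, subsol r & forall v, v \in s -> r v < w v + e.
    elim: s => [|u s [r hr rs]]; first by exists (fun=> M) => //; exact: subsol_top.
    have [_ [r' hr' ->] ru] := inf_adherent e0 (Sinf u).
    exists (fun v => Num.min (r v) (r' v)); first exact: subsol_min.
    move=> v; rewrite inE => /predU1P[->|/rs h]; rewrite gt_min; last by rewrite h.
    by rewrite ru orbT.
  have [r hr rs] := H (enum V); exists r => // v; apply: rs.
  by rewrite mem_enum.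
have H n : exists r, subsol r /\ forall v, r v < w v + n.+1%:R^-1.
  by have [|r hr h] := approx (n.+1%:R^-1); [rewrite invr_gt0|exists r].
have [rn rnP] := boolp.choice H.
have rnw v : rn n v @[n --> \oo] --> w v.
  apply: (@squeeze_cvgr _ _ _ _ (fun=> w v) (fun n => w v + harmonic n)).
  - apply: nearW => n; have [h1 h2] := rnP n.
    by rewrite (wle _ _ h1) /= ltW //; exact: h2.
  - exact: cvC.
  - by rewrite -[X in _ --> X]addr0; apply: (@cvD R nat \oo _); [exact: cvC|exact: cvg_harmonic].
exists w, rn; split => //; first by move=> v; rewrite w0 wM.
  by move=> n; case: (rnP n).
move=> wp.
have rn0 n v : 0 < rn n v by have [[h _] _] := rnP n; case/andP: (h v).
have fw v : w v < M -> fld w v <= 0.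
  move=> wv.
  have c : fld (rn n) v @[n --> \oo] --> fld w v.
    by apply: fld_cvg => //; apply: nearW.
  apply: (cvgr_to_le c).
  have : \forall n \near \oo, rn n v < M by apply: (cvgr_lt (w v)).
  by apply: filterS => n; have [[_ h] _] := rnP n; exact: h.
(* If [fld] were negative at v, w could be lowered a little at v: this lowers [fld] at the other
   vertices and keeps it negative at v, so the result would be a member below the infimum. *)
have f0 v : 0 <= fld w v.
  rewrite leNgt; apply/negP => fv.
  pose wh h u : R := if u == v then w u - h else w u.
  have whc u : wh h u @[h --> 0^'+] --> w u.
    rewrite /wh; case: eqP => [_|_]; last exact: cvC.
    rewrite -[X in _ --> X]subr0; apply: cvB; first exact: cvC.
    exact: cvg_at_right_filter cvg_id.
  have hpos : \forall h \near 0^'+, forall u, 0 < wh h u.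
    have : \forall h \near 0^'+, h < w v by apply: nbhs_right_lt; exact: wp.
    by apply: filterS => h hw u; rewrite /wh; case: eqP => [->|_]; rewrite ?subr_gt0.
  have c : fld (wh h) v @[h --> 0^'+] --> fld w v by exact: fld_cvg.
  have neg : \forall h \near 0^'+, fld (wh h) v < 0 by apply: (cvgr_lt (fld w v)).
  have hgt : \forall h \near (0 : R)^'+, 0 < h by exact: nbhs_right_gt.
  have [h [[h1 h2] h3]] := filter_ex (filterI (filterI hpos neg) hgt).
  have whw u : wh h u <= w u by rewrite /wh; case: ifP => // _; rewrite gerBl ltW.
  have sub : subsol (wh h).
    split => u; first by rewrite h1 (le_trans (whw u)).
    have [-> _|uv] := eqVneq u v; first exact: ltW.
    rewrite {1}/wh (negPf uv) => uM; apply: le_trans (fw u uM).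
    by apply: fld_mono => //; rewrite /wh (negPf uv).
  have := wle _ v sub; rewrite /wh eqxx; lra.
split => // v wv; apply/eqP; rewrite eq_le f0 andbT; exact: fw.
Qed.

End Obstacle.

Lemma zero_gap (M : R) (w : V -> R) (rn : nat -> V -> R) : (forall v, 0 <= w v) -> 0 < M ->
  (forall n, subsol M (rn n)) -> (forall v, rn n v @[n --> \oo] --> w v) ->
  face_gap [set v | w v == 0]%SET <= 0.
Proof.
move=> w0 M0 sub cv; set A := [set v | w v == 0]%SET.
have rn0 n v : 0 < rn n v by have [h _] := sub n; case/andP: (h v).
have c : \sum_(v in A) fld (rn n) v @[n --> \oo] --> face_gap A.
  by apply: sum_fld_cvg => //; apply: nearW.
apply: (cvgr_to_le c).
have : \forall n \near \oo, forall v, v \in A -> rn n v < M.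
  apply: filter_forall => v; have [vA|vA] := boolP (v \in A); last exact: nearW.
  have wM : w v < M by move: vA; rewrite inE => /eqP ->.
  have : \forall n \near \oo, rn n v < M by apply: (cvgr_lt (w v)).
  by apply: filterS => n h _.
apply: filterS => n h; rewrite sumr_le0 // => v vA.
by have [_ h2] := sub n; apply: h2; exact: h.
Qed.

Lemma sum0_eq0 (x : V -> R) : (forall v, 0 <= x v) -> \sum_v x v = 0 -> forall v, x v = 0.
Proof.
by move=> x0 /eqP; rewrite psumr_eq0 // => /allP h v; apply/eqP/h; rewrite mem_index_enum.
Qed.

Lemma equilibrium_exists : attainable tv te Th k ->
  curvature_vector tv te G (@tri_chi V E F) k ->
  exists2 r, (forall v, 0 < r v) & forall v, fld r v = 0.
Proof.
move=> att [kb kchi].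
have pos (w : V -> R) : (forall v, 0 <= w v) -> face_gap [set v | w v == 0]%SET <= 0 ->
    [set v | w v == 0]%SET = [set: V]%SET \/ forall v, 0 < w v.
  move=> w0; set A := [set v | w v == 0]%SET.
  have [AT|AT] := eqVneq A [set: V]%SET; first by left.
  have [A0|A0] := eqVneq A finset.set0.
    right=> v; rewrite lt_neqAle w0 andbT eq_sym; apply/negP => wv.
    have : v \in A by rewrite inE.
    by rewrite A0 inE.
  by rewrite leNgt attainable_gap.
case GE : {-}G.
  have kb' v : k v < b v by exact: kb.
  have [M M0 barrier] := fld_barrier GE kb'.
  have [w [rn [w0M sub cv fw]]] := obstacle M0.
  have w0 v : 0 <= w v by case/andP: (w0M v).
  have gap := zero_gap w0 M0 sub cv.
  have [AT|wp] := pos w w0 gap.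
    move: gap; rewrite AT gap_setT leNgt subr_gt0.
    by move: kchi; rewrite GE => ->.
  have [f0 f1] := fw wp; exists w => // v.
  (* The bound M is not reached, since the barrier would make [fld] negative there. *)
  have [wM|wM] := ltP (w v) M; first exact: f1.
  by have := barrier w v wp wM; rewrite ltNge f0.
have sum0 r : (forall v, 0 < r v) -> \sum_v fld r v = 0.
  by move=> r0; rewrite sum_fld_euc //; move: kchi; rewrite GE => ->; rewrite subrr.
have [[r [rp rf0] r1]|no] := pselect (exists2 r, subsol 1 r & forall v, r v < 1).
  have r0 v : 0 < r v by case/andP: (rp v).
  exists r => // v; apply/eqP; rewrite -oppr_eq0; apply/eqP.
  apply: (sum0_eq0 (x := fun v => - fld r v)) => [u|].
    by rewrite oppr_ge0 rf0.
  by rewrite sumrN sum0 ?oppr0.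
have [w [rn [w0M sub cv fw]]] := obstacle ltr01.
have w0 v : 0 <= w v by case/andP: (w0M v).
have [AT|wp] := pos w w0 (zero_gap w0 ltr01 sub cv).
  exfalso; apply: no.
  have : \forall n \near \oo, forall v, rn n v < 1.
    apply: filter_forall => v; apply: (cvgr_lt (w v)) => //.
    have : v \in [set v | w v == 0]%SET by rewrite AT inE.
    by rewrite inE => /eqP ->.
  by move=> /filter_ex[n hn]; exists (rn n).
have [f0 _] := fw wp; exists w => //.
exact: (sum0_eq0 f0 (sum0 _ wp)).
Qed.

End Field.

Lemma cauchy_schwarz1 {R : realType} (I : finType) (a : I -> R) :
  (\sum_i a i) ^+ 2 <= #|I|%:R * \sum_i a i ^+ 2.
Proof.
have h : 0 <= \sum_i \sum_j (a i - a j) ^+ 2.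
  by apply: sumr_ge0 => i _; apply: sumr_ge0 => j _; exact: sqr_ge0.
have e : \sum_i \sum_j (a i - a j) ^+ 2 =
    2 * (#|I|%:R * \sum_i a i ^+ 2) - 2 * (\sum_i a i) ^+ 2.
  have -> : \sum_i \sum_j (a i - a j) ^+ 2 =
      \sum_i (#|I|%:R * a i ^+ 2 + \sum_j a j ^+ 2 - 2 * (a i * \sum_j a j)).
    apply: eq_bigr => i _; rewrite !mulr_sumr.
    have -> : #|I|%:R * a i ^+ 2 = \sum_(j : I) a i ^+ 2.
      by rewrite sumr_const mulr_natl cardT -cardE.
    rewrite -big_split /= -sumrB; apply: eq_bigr => j _; ring.
  rewrite sumrB big_split /= -!mulr_sumr -mulr_suml sumr_const cardT -cardE.
  rewrite -mulr_natl; ring.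
by move: h; rewrite e; lra.
Qed.

(** * Dissipation, Lipschitz bound and coercivity of the field in u *)

Section FieldEstimates.
Context {R : realType} {V E F : finType} (tv : F -> 'I_3 -> V) (te : F -> 'I_3 -> E).
Variables (G : geom) (Th : E -> R) (k : V -> R).
Hypothesis surf : is_tri_surface tv te.
Hypotheses (Th_itv : forall e, 0 <= Th e < pi) (hC1 : C1 te Th).
Implicit Types (r u : V -> R) (v : V) (f : F) (i : 'I_3).

Local Notation I := (faceI te Th).
Local Notation b := (@bangle V E F tv te R).
Local Notation rf r f := (fun j => r (tv f j)).
Local Notation fieldk := (fld tv te G Th k).

Let IgtN1 f i : -1 < I f i. Proof. exact: faceI_gtN1. Qed.
Let Ile1 f i : I f i <= 1. Proof. exact: faceI_le1. Qed.
Let IPP f i : 0 <= C1term (I f) i. Proof. exact: faceI_C1term. Qed.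

Definition fldu u v : R := fieldk (fun v => rho G (u v)) v.

Lemma fldu_diff (x : V -> R) u u' :
  \sum_v x v * (fldu u' v - fldu u v) = \sum_f \sum_i x (tv f i) *
    (angG G (I f) (radii G (rf u' f)) i - angG G (I f) (radii G (rf u f)) i).
Proof.
have := sum_corners tv predT x (fun c => angG G (I c.1) (radii G (rf u' c.1)) c.2
   - angG G (I c.1) (radii G (rf u c.1)) c.2).
move=> <-; apply: eq_bigr => v _; congr (_ * _).
rewrite sumrB /fldu /fld /radii; ring.
Qed.

Lemma fldu_dissip u u' : (forall v, dom G (u v)) -> (forall v, dom G (u' v)) ->
  \sum_v (u' v - u v) * (fldu u' v - fldu u v) <= 0.
Proof.
move=> du du'; rewrite fldu_diff; apply: sumr_le0 => f _.
exact: (angG_dissip (IgtN1 f) (Ile1 f) (IPP f) (fun j => du (tv f j))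
  (fun j => du' (tv f j))).
Qed.

Lemma fldu_lip g : exists2 K, 0 <= K & forall u u',
  (forall v, dom G (u v)) -> (forall v, dom G (u' v)) ->
  (forall v, 1 + kap G * pG G (rho G (u v)) <= g) ->
  (forall v, 1 + kap G * pG G (rho G (u' v)) <= g) ->
  forall v, `|fldu u' v - fldu u v| <= K * \sum_w `|u' w - u w|.
Proof.
have H f : exists K, 0 <= K /\ forall (x x' : 'I_3 -> R), (forall j, dom G (x j)) -> (forall j, dom G (x' j)) ->
  (forall j, 1 + kap G * pG G (rho G (x j)) <= g) ->
  (forall j, 1 + kap G * pG G (rho G (x' j)) <= g) ->
  forall i, `|angG G (I f) (radii G x') i - angG G (I f) (radii G x) i| <= K * \sum_j `|x' j - x j|.
  by have [K K0 KP] := angG_lip G (IgtN1 f) (Ile1 f) (IPP f) g; exists K.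
have [Kf KP] := boolp.choice H.
have Kf0 f : 0 <= Kf f by case: (KP f).
exists (\sum_(c : F * 'I_3) Kf c.1 * 3) => [|u u' du du' gu gu' v].
  by apply: sumr_ge0 => c _; rewrite mulr_ge0.
set S := \sum_w `|u' w - u w|.
have uS w : `|u' w - u w| <= S.
  by rewrite /S (bigD1 w) //= lerDl sumr_ge0.
have S0 : 0 <= S by apply: sumr_ge0.
have -> : fldu u' v - fldu u v = \sum_(c | cvert tv c == v)
   (angG G (I c.1) (radii G (rf u' c.1)) c.2 - angG G (I c.1) (radii G (rf u c.1)) c.2).
  rewrite sumrB /fldu /fld /radii; ring.
apply: le_trans (ler_norm_sum _ _ _) _.
rewrite mulr_suml big_mkcond; apply: ler_sum => -[f i] _ /=.
case: ifP => _; last by rewrite !mulr_ge0.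
have [_ h] := KP f.
apply: le_trans (h _ _ (fun j => du (tv f j)) (fun j => du' (tv f j))
  (fun j => gu (tv f j)) (fun j => gu' (tv f j)) i) _.
rewrite -mulrA ler_wpM2l // (sum3 ord0).
by have := uS (tv f ord0); have := uS (tv f (nx ord0)); have := uS (tv f (nx (nx ord0))); lra.
Qed.

Lemma fldu_bound u v : (forall v, dom G (u v)) ->
  `|fldu u v| <= \sum_v `|k v - b v| + #|{: F * 'I_3}|%:R * pi.
Proof.
move=> du; apply: le_trans (ler_normD _ _) _; apply: lerD.
  by rewrite (bigD1 v) //= lerDl sumr_ge0.
apply: le_trans (ler_norm_sum _ _ _) _.
rewrite big_mkcond /=; apply: (@le_trans _ _ (\sum_(c : F * 'I_3) pi)); last first.
  by rewrite sumr_const cardT -cardE mulr_natl.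
apply: ler_sum => -[f i] _ /=; case: ifP => _; last exact: pi_ge0.
have r0 j : 0 < rho G (u (tv f j)) by exact: rho_gt0.
have a0 := angG_gt0 G (IgtN1 f) (Ile1 f) (IPP f) r0 i.
by rewrite ger0_norm ?ltW // (angG_ltpi G (IgtN1 f) (Ile1 f) (IPP f) r0 i).
Qed.

(** At most one of the three [EE] is below e / 2, where e is the least sum of two. The three
    differences add up to 0, so the square of one is at most twice the sum of the other two squares;
    hence the constant e / 6. *)
Lemma EE_quad f : exists2 e, 0 < e & forall x : 'I_3 -> R,
  e * \sum_i (x (nx i) - x (nx (nx i))) ^+ 2 <=
  \sum_i EE (I f) i * (x (nx i) - x (nx (nx i))) ^+ 2.
Proof.
pose a0 := EE (I f) ord0; pose a1 := EE (I f) (nx ord0); pose a2 := EE (I f) (nx (nx ord0)).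
have h0 : 0 <= a0 by exact: EE_ge0. have h1 : 0 <= a1 by exact: EE_ge0.
have h2 : 0 <= a2 by exact: EE_ge0.
have e0 : 0 < a0 + a1 by exact: EE_gt0. have e1 : 0 < a1 + a2 by exact: EE_gt0.
have e2 : 0 < a2 + a0.
  have h : 0 < EE (I f) (nx (nx ord0)) + EE (I f) (nx (nx (nx ord0))) by exact: EE_gt0.
  by rewrite nx3 in h.
pose e := Num.min (a0 + a1) (Num.min (a1 + a2) (a2 + a0)).
have ep : 0 < e by rewrite !lt_min e0 e1.
have l0 : e <= a0 + a1 by rewrite ge_min lexx.
have l1 : e <= a1 + a2 by rewrite !ge_min lexx orbT.
have l2 : e <= a2 + a0 by rewrite !ge_min lexx !orbT.
exists (e / 6); first by rewrite divr_gt0.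
move=> x; rewrite !(sum3 ord0) !nx3 -/a0 -/a1 -/a2.
move: (x ord0) (x (nx ord0)) (x (nx (nx ord0))) => x0 x1 x2.
have : 0 <= e * (x0 - x1 - (x1 - x2)) ^+ 2 by rewrite mulr_ge0 ?sqr_ge0 // ltW.
have : 0 <= e * (x1 - x2 - (x2 - x0)) ^+ 2 by rewrite mulr_ge0 ?sqr_ge0 // ltW.
have : 0 <= e * (x2 - x0 - (x0 - x1)) ^+ 2 by rewrite mulr_ge0 ?sqr_ge0 // ltW.
have q d (a b : R) : b <= a -> b * d ^+ 2 <= a * d ^+ 2.
  by move=> ab; rewrite ler_wpM2r ?sqr_ge0.
have [g0|g0] := leP (e / 2) a0; have [g1|g1] := leP (e / 2) a1.
- have := q (x1 - x2) _ _ g0; have := q (x2 - x0) _ _ g1; have := q (x0 - x1) _ _ h2.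
  rewrite mul0r; lra.
- have g2 : e / 2 <= a2 by lra.
  have := q (x1 - x2) _ _ g0; have := q (x2 - x0) _ _ h1; have := q (x0 - x1) _ _ g2.
  rewrite mul0r; lra.
- have g2 : e / 2 <= a2 by lra.
  have := q (x1 - x2) _ _ h0; have := q (x2 - x0) _ _ g1; have := q (x0 - x1) _ _ g2.
  rewrite mul0r; lra.
- lra.
Qed.

(** For mean zero, #|V| x_v is the sum of the differences x_v - x_w, which [connected_osc] bounds;
    Cauchy-Schwarz passes to squares. *)
Lemma poincare : exists2 C, 0 < C & forall x : V -> R, \sum_v x v = 0 ->
  \sum_v x v ^+ 2 <= C * \sum_f \sum_i (x (tv f (nx i)) - x (tv f (nx (nx i)))) ^+ 2.
Proof.
have [C C0 CP] := @connected_osc _ _ _ _ _ surf R.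
pose N := #|{: F * 'I_3}|%:R : R.
exists (#|V|%:R * (C ^+ 2 * N) + 1) => [|x x0].
  by rewrite ltr_wpDl // !mulr_ge0 ?exprn_ge0.
set Q := \sum_f _; pose S := \sum_f \sum_i `|x (tv f (nx i)) - x (tv f (nx (nx i)))|.
have Q0 : 0 <= Q by apply: sumr_ge0 => f _; apply: sumr_ge0 => i _; exact: sqr_ge0.
have SQ : S ^+ 2 <= N * Q.
  have := cauchy_schwarz1 (fun c : F * 'I_3 => `|x (tv c.1 (nx c.2)) - x (tv c.1 (nx (nx c.2)))|).
  rewrite /S /Q !pair_bigA /= => h; apply: le_trans h _.
  rewrite ler_wpM2l //; apply: ler_sum => c _.
  by rewrite real_normK ?num_real.
have S0 : 0 <= S by apply: sumr_ge0 => f _; exact: sumr_ge0.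
have xS v : x v ^+ 2 <= C ^+ 2 * N * Q.
  have V0 : 0 < #|V|%:R :> R by rewrite ltr0n; apply/card_gt0P; exists v.
  have h : `|#|V|%:R * x v| <= #|V|%:R * (C * S).
    have -> : #|V|%:R * x v = \sum_w (x v - x w).
      by rewrite sumrB x0 subr0 sumr_const cardT -cardE mulr_natl.
    apply: le_trans (ler_norm_sum _ _ _) _.
    apply: (@le_trans _ _ (\sum_(w : V) C * S)); first exact: ler_sum.
    by rewrite sumr_const cardT -cardE mulr_natl.
  rewrite normrM gtr0_norm // ler_pM2l // in h.
  rewrite -[x v ^+ 2]real_normK ?num_real //.
  apply: (@le_trans _ _ ((C * S) ^+ 2)).
    by rewrite lerXn2r ?nnegrE ?mulr_ge0.
  by rewrite exprMn -mulrA ler_wpM2l ?exprn_ge0.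
apply: (@le_trans _ _ (\sum_(v : V) C ^+ 2 * N * Q)); first exact: ler_sum.
rewrite sumr_const cardT -cardE -[leLHS]mulr_natl mulrDl mul1r.
by rewrite (mulrA #|V|%:R (C ^+ 2 * N) Q) lerDl.
Qed.

(** In the hyperbolic case the diagonal term suffices. In the Euclidean case only differences are
    controlled, and [poincare] needs the sums to agree. *)
Lemma fldu_coercive a bb : dom G bb -> exists2 c, 0 < c & forall u u',
  (forall v, a <= u v <= bb) -> (forall v, a <= u' v <= bb) ->
  (G = Euclidean -> \sum_v (u' v - u v) = 0) ->
  \sum_v (u' v - u v) * (fldu u' v - fldu u v) <= - c * \sum_v (u' v - u v) ^+ 2.
Proof.
move=> db.
have H f : exists c, 0 < c /\ forall (x x' : 'I_3 -> R), (forall j, a <= x j <= bb) ->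
  (forall j, a <= x' j <= bb) ->
  \sum_i (x' i - x i) * (angG G (I f) (radii G x') i - angG G (I f) (radii G x) i) <=
  - c * (\sum_i EE (I f) i * ((x' (nx i) - x (nx i)) - (x' (nx (nx i)) - x (nx (nx i)))) ^+ 2
     + kap G * \sum_i (x' i - x i) ^+ 2).
  by have [c c0 cP] := angG_coercive (IgtN1 f) (Ile1 f) (IPP f) a db; exists c.
have [cf cP] := boolp.choice H.
(* The inverse of 1 plus the sum of all inverses is a common positive lower bound. *)
have [c c0 cc] : exists2 c : R, 0 < c & forall f, c <= cf f.
  exists ((1 + \sum_f (cf f)^-1)^-1).
    rewrite invr_gt0 ltr_pwDl // sumr_ge0 // => f _.
    by have [h _] := cP f; rewrite invr_ge0 ltW.
  move=> f; have [h _] := cP f; rewrite -[leRHS]invrK lef_pV2 ?posrE ?invr_gt0 //.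
    rewrite (bigD1 f) //= addrCA lerDl addr_ge0 // sumr_ge0 // => g _.
    by have [h' _] := cP g; rewrite invr_ge0 ltW.
  by rewrite ltr_pwDl // sumr_ge0 // => g _; have [h' _] := cP g; rewrite invr_ge0 ltW.
have face f u u' : (forall v, a <= u v <= bb) -> (forall v, a <= u' v <= bb) ->
  \sum_i (u' (tv f i) - u (tv f i)) *
    (angG G (I f) (radii G (rf u' f)) i - angG G (I f) (radii G (rf u f)) i) <=
  - c * (\sum_i EE (I f) i * ((u' (tv f (nx i)) - u (tv f (nx i))) -
      (u' (tv f (nx (nx i))) - u (tv f (nx (nx i))))) ^+ 2
     + kap G * \sum_i (u' (tv f i) - u (tv f i)) ^+ 2).
  move=> hu hu'; have [_ h] := cP f.
  apply: le_trans (h _ _ (fun j => hu (tv f j)) (fun j => hu' (tv f j))) _.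
  rewrite !mulNr lerN2 ler_wpM2r // addr_ge0 ?mulr_ge0 ?kap_ge0 //; apply: sumr_ge0 => i _.
    by rewrite mulr_ge0 ?sqr_ge0 //; exact: EE_ge0.
  exact: sqr_ge0.
case GE : {-}G.
  exists c => // u u' hu hu' _.
  rewrite fldu_diff; apply: le_trans (ler_sum _ (fun f _ => face f u u' hu hu')) _.
  rewrite -mulr_sumr !mulNr lerN2 ler_wpM2l ?(ltW c0) //.
  rewrite big_split /= -mulr_sumr {1}GE /= mul1r.
  apply: (@le_trans _ _ (\sum_f \sum_i (u' (tv f i) - u (tv f i)) ^+ 2)); last first.
    rewrite lerDr; apply: sumr_ge0 => f _; apply: sumr_ge0 => i _.
    by rewrite mulr_ge0 ?sqr_ge0 //; exact: EE_ge0.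
  have := sum_corners tv predT (fun v => (u' v - u v) ^+ 2) (fun=> 1).
  rewrite /=; have -> : \sum_f \sum_i (u' (tv f i) - u (tv f i)) ^+ 2 * 1 =
    \sum_f \sum_i (u' (tv f i) - u (tv f i)) ^+ 2.
    by apply: eq_bigr => f _; apply: eq_bigr => i _; rewrite mulr1.
  move=> <-; apply: ler_sum => v _; rewrite ler_peMr ?sqr_ge0 //.
  have [c' cv] : exists c', cvert tv c' = v by case: surf.
  by rewrite (bigD1 c') /= ?cv // lerDl sumr_ge0.
have Hq f : exists e, 0 < e /\ forall x : 'I_3 -> R,
  e * \sum_i (x (nx i) - x (nx (nx i))) ^+ 2 <=
  \sum_i EE (I f) i * (x (nx i) - x (nx (nx i))) ^+ 2.
  by have [e e0 eP] := EE_quad f; exists e.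
have [ef eP] := boolp.choice Hq.
have [e e0 ee] : exists2 e : R, 0 < e & forall f, e <= ef f.
  exists ((1 + \sum_f (ef f)^-1)^-1).
    rewrite invr_gt0 ltr_pwDl // sumr_ge0 // => f _.
    by have [h _] := eP f; rewrite invr_ge0 ltW.
  move=> f; have [h _] := eP f; rewrite -[leRHS]invrK lef_pV2 ?posrE ?invr_gt0 //.
    rewrite (bigD1 f) //= addrCA lerDl addr_ge0 // sumr_ge0 // => g _.
    by have [h' _] := eP g; rewrite invr_ge0 ltW.
  by rewrite ltr_pwDl // sumr_ge0 // => g _; have [h' _] := eP g; rewrite invr_ge0 ltW.
have [C C0 CP] := poincare.
exists (c * (e / C)); first by rewrite mulr_gt0 // divr_gt0.
move=> u u' hu hu' /(_ GE) s0.
rewrite fldu_diff; apply: le_trans (ler_sum _ (fun f _ => face f u u' hu hu')) _.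
rewrite -mulr_sumr !mulNr lerN2 -mulrA ler_wpM2l ?(ltW c0) //.
have kE : kap G = 0 :> R by rewrite GE.
rewrite big_split /= -mulr_sumr kE mul0r addr0.
have := CP (fun v => u' v - u v) s0; set Q := \sum_f _ => h.
apply: (@le_trans _ _ (e * Q)).
  by rewrite -mulrA ler_wpM2l ?(ltW e0) // mulrC ler_pdivrMr // mulrC.
rewrite /Q mulr_sumr; apply: ler_sum => f _.
have [_ h'] := eP f; apply: le_trans (h' (fun j => u' (tv f j) - u (tv f j))).
by rewrite ler_wpM2r // sumr_ge0 // => i _; exact: sqr_ge0.
Qed.

Lemma angG_scale (J : 'I_3 -> R) (x : 'I_3 -> R) (c : R) i : 0 < c ->
  angG Euclidean J (fun j => c * x j) i = angG Euclidean J x i.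
Proof.
move=> c0; rewrite /angG /ang /Nang /nlen /=.
have m j : mlen 0 (fun j => (c * x j) ^+ 2 / 2) (fun j => c * x j) J j =
   c ^+ 2 * mlen 0 (fun j => x j ^+ 2 / 2) x J j.
  by rewrite /mlen; field.
rewrite !m !mul0r !addr0; move: (mlen 0 _ x J (nx i)) (mlen 0 _ x J (nx (nx i))) (mlen 0 _ x J i) => a a' a''.
have -> : c ^+ 2 * a * 2 * (c ^+ 2 * a' * 2) = (c ^+ 2) ^+ 2 * (a * 2 * (a' * 2)) by ring.
rewrite sqrtrM ?sqr_ge0 // sqrtr_sqr ger0_norm ?sqr_ge0 //.
rewrite -[X in acos X = _](_ : c ^+ 2 * (a + a' - a'') / (c ^+ 2 * Num.sqrt (a * 2 * (a' * 2))) = _); last first.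
  by congr (_ / _); ring.
by rewrite -mulf_div divff ?mul1r // gt_eqF // exprn_gt0.
Qed.

Lemma fld_scale r c : G = Euclidean -> 0 < c -> forall v, fieldk (fun v => c * r v) v = fieldk r v.
Proof.
move=> GE c0 v; rewrite /fld; congr (_ + _); apply: eq_bigr => -[f i] _ /=.
by rewrite GE angG_scale.
Qed.

End FieldEstimates.

(** * The flow *)

Section RealFunctions.
Local Open Scope classical_set_scope.
Context {R : realType}.
Implicit Types (h dh : R -> R) (a b t : R).

(** If h were positive at t, then after the last earlier time with h <= 0 it would be positive with
    nonpositive derivative. *)
Lemma stays_nonpos h dh : h 0 <= 0 ->
  (forall t, 0 <= t -> is_derive t 1 h (dh t)) ->
  (forall t, 0 <= t -> 0 <= h t -> dh t <= 0) ->
  forall t, 0 <= t -> h t <= 0.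
Proof.
move=> h0 dhP dh0 t t0; rewrite leNgt; apply/negP => ht.
pose S := [set s | 0 <= s <= t /\ h s <= 0].
have S0 : S 0 by split; rewrite ?lexx ?t0.
have Sup : has_sup S by split; [exists 0|exists t => s [/andP[]]].
pose s := sup S.
have ub x : S x -> x <= s by move=> Sx; exact: (sup_upper_bound Sup).
have s0 : 0 <= s by exact: ub.
have st : s <= t by apply: ge_sup; [exists 0|move=> x [/andP[]]].
have hs : h s <= 0.
  rewrite leNgt; apply/negP => hs.
  have cs := isd_cont (dhP s s0).
  have : \forall x \near s, 0 < h x by exact: (cvgr_gt _ cs _ hs).
  move=> /nbhs_ballP[e e0 he].
  have [x [xt hx] xs] := sup_adherent e0 Sup.
  have xs' : x <= s by apply: ub; split.
  have := he x; rewrite /ball /= ger0_norm ?subr_ge0 // => /(_ _)/=.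
  have -> : s - x < e by rewrite -/s in xs; lra.
  by move=> /(_ isT); rewrite ltNge hx.
have lts : s < t by rewrite lt_neqAle st andbT; apply/eqP => e; move: hs; rewrite e leNgt ht.
have [|c /andP[sc ct] e] := mvt (f := h) (df := dh) lts.
  by move=> x /andP[sx _]; apply: dhP; exact: le_trans sx.
have c0 : 0 <= c by rewrite (le_trans s0) // ltW.
have hc : 0 <= h c.
  rewrite leNgt; apply/negP => hc.
  have : c <= s by apply: ub; split; rewrite ?c0 ltW.
  by rewrite leNgt sc.
have : dh c * (t - s) <= 0 by rewrite mulr_le0_ge0 ?dh0 // subr_ge0.
by rewrite -e; lra.
Qed.

(** Over late intervals of length 1 the increment of h is a value of dh near d, and it is small
    because h converges. *)
Lemma limit_derive0 h dh (l d : R) : (forall t, 0 <= t -> is_derive t 1 h (dh t)) ->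
  h t @[t --> +oo] --> l -> dh t @[t --> +oo] --> d -> d = 0.
Proof.
move=> dhP hl dhd; apply/eqP; rewrite -normr_eq0 eq_le normr_ge0 andbT leNgt.
apply/negP => d0; have d4 : 0 < `|d| / 4 by rewrite divr_gt0.
have /cvgrPdist_lt/(_ _ d4)[A [_ hA]] := hl.
have /cvgrPdist_lt/(_ _ d4)[B [_ hB]] := dhd.
pose t := Num.max (Num.max A B) 0 + 1.
have tA : A < t by rewrite /t ltr_pwDr // !le_max lexx.
have tB : B < t by rewrite /t ltr_pwDr // !le_max lexx orbT.
have t0 : 0 <= t by rewrite /t addr_ge0 // le_max lexx orbT.
have t1 : t < t + 1 by rewrite ltrDl.
have [|c /andP[tc ct]] := mvt (f := h) (df := dh) t1.
  by move=> x /andP[tx _]; apply: dhP; exact: le_trans tx.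
rewrite (_ : t + 1 - t = 1) ?mulr1 => [e|]; last by ring.
have h1 := hA t tA; have h2 := hA (t + 1) (lt_trans tA t1).
have h3 := hB c (lt_trans tB tc).
rewrite -e in h3.
have : `|d| <= `|d - (h (t + 1) - h t)| + (`|l - h t| + `|l - h (t + 1)|).
  have e' : d = (d - (h (t + 1) - h t)) + ((l - h t) - (l - h (t + 1))) by ring.
  rewrite {1}e'; apply: le_trans (ler_normD _ _) _.
  by rewrite lerD2l; exact: ler_normB.
move: h1 h2 h3 d0; move: `|d| => D; lra.
Qed.

Lemma exp_decay h dh c : (forall t, 0 <= t -> is_derive t 1 h (dh t)) ->
  (forall t, 0 <= t -> dh t <= - c * h t) ->
  forall t, 0 <= t -> h t <= h 0 * expR (- c * t).
Proof.
move=> dhP dhc t t0.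
have D (s : R) : 0 <= s -> is_derive s 1 (fun s => h s * expR (c * s))
    (h s * (expR (c * s) * (c * 1)) + expR (c * s) * dh s).
  move=> s0; exact: (isdM (dhP s s0) (@isd_comp _ expR (fun s => c * s) _ _ _
    (is_derive_expR _) (isdcM c (is_derive_id s 1)))).
have := isd_nincr (f := fun s => h s * expR (c * s)) t0
  (fun s hs => D s (proj1 (andP hs))) => H.
have : h t * expR (c * t) <= h 0 * expR (c * 0).
  apply: H => s /andP[/ltW s0 _].
  have := dhc s s0; rewrite -(ler_pM2l (expR_gt0 (c * s))); lra.
by rewrite mulr0 expR0 mulr1 mulNr expRN -ler_pdivlMr ?invr_gt0 ?expR_gt0 // invrK.
Qed.

Lemma exp_bound_cvg h (l C c : R) : 0 < c ->
  (forall t, 0 <= t -> `|h t - l| <= C * expR (- c * t)) -> h t @[t --> +oo] --> l.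
Proof.
move=> c0 hb; apply/cvgrPdist_le => e e0; near=> t.
have t1 : 1 <= t by near: t; exact: nbhs_pinfty_ge.
have tC : `|C| / (c * e) <= t by near: t; apply: nbhs_pinfty_ge; exact: num_real.
have t0 : 0 < t by exact: lt_le_trans t1.
rewrite distrC; apply: le_trans (hb t (ltW t0)) _.
have ct : 0 < c * t by rewrite mulr_gt0.
have eC : `|C| <= e * (c * t).
  by move: tC; rewrite ler_pdivrMr ?mulr_gt0 //; lra.
rewrite mulNr expRN -[leLHS]/(C / expR (c * t)) ler_pdivrMr ?expR_gt0 //.
apply: le_trans (ler_norm C) (le_trans eC _).
by rewrite ler_pM2l //; have := expR_ge1Dx (c * t); lra.
Unshelve. all: by end_near. Qed.

End RealFunctions.

(** * The flow in the coordinate u: existence, uniqueness and limits *)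

Section Flow.
Local Open Scope classical_set_scope.
Context {R : realType} {V E F : finType} (tv : F -> 'I_3 -> V) (te : F -> 'I_3 -> E).
Variables (G : geom) (Th : E -> R) (k : V -> R).
Hypothesis surf : is_tri_surface tv te.
Hypotheses (Th_itv : forall e, 0 <= Th e < pi) (hC1 : C1 te Th).
Hypothesis curvk : curvature_vector tv te G (@tri_chi V E F) k.
Variable r0 : V -> R.
Hypothesis r0_gt0 : forall v, 0 < r0 v.
Implicit Types (u y z : V -> R) (v : V) (t : R).

Local Notation fieldu := (fldu tv te G Th k).
Local Notation fieldr := (fld tv te G Th k).
Local Notation u0 := (fun v => lam G (r0 v)).

Let k_lt v : k v < bangle tv te v. Proof. by case: curvk => h _; exact: h. Qed.

Definition log_flow (u : R -> V -> R) := u 0 = u0 /\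
  forall t v, 0 <= t -> dom G (u t v) /\ is_derive t 1 (fun s => u s v) (fieldu (u t) v).

(** In the hyperbolic case u must stay away from the end 0 of [dom], and the barrier provides this;
    a Euclidean flow is bounded later by its distance to an equilibrium. *)
Definition bounded_above (u : R -> V -> R) :=
  exists2 bb, dom G bb & G = Hyperbolic -> forall t v, 0 <= t -> u t v <= bb.

Lemma field_bound_ge0 : 0 <= \sum_v `|k v - bangle tv te v| + #|{: F * 'I_3}|%:R * pi.
Proof. by rewrite addr_ge0 ?sumr_ge0 // mulr_ge0 // pi_ge0. Qed.

Lemma log_flow_exists : exists2 u, log_flow u & bounded_above u.
Proof.
case GE : {-}G; last first.
  have du y v : dom G (y v) by rewrite GE.
  have [K K0 KP] := fldu_lip tv G k Th_itv hC1 1.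
  have kE : kap G = 0 :> R by rewrite GE.
  have [||Y Y0 YP] := ode_exists u0 K0 field_bound_ge0 (g := fieldu).
  - move=> y z v; rewrite distrC (eq_bigr (fun w => `|z w - y w|)) => [|w _]; last exact: distrC.
    by apply: KP => // w; rewrite kE mul0r addr0.
  - by move=> y v; apply: fldu_bound.
  exists Y; first by split => // t v t0; split => //; exact: YP.
  by exists 0; rewrite GE.
have [M M0 barrier] := fld_barrier Th_itv hC1 GE k_lt.
pose Mb := M + \sum_v r0 v; pose bb := lam G Mb.
have MMb : M <= Mb by rewrite lerDl sumr_ge0 // => v _; exact: ltW.
have Mb0 : 0 < Mb by exact: lt_le_trans MMb.
have db : dom G bb by exact: lam_dom.
(* Clipped at bb, the field is globally Lipschitz. The barrier makes it point downwards where bb is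
   reached, and the initial radii are at most Mb, so that the clip never acts on the solution. *)
pose clip y v := Num.min (y v) bb.
have clip_le y v : clip y v <= bb by rewrite ge_min lexx orbT.
have clip_dom y v : dom G (clip y v) by exact: dom_le (clip_le y v) db.
have clip_lip y z v : `|clip y v - clip z v| <= `|y v - z v|.
  rewrite /clip; case: (leP (y v) bb) => yb; case: (leP (z v) bb) => zb //.
  - rewrite ler0_norm ?ler0_norm; lra.
  - rewrite ger0_norm ?ger0_norm; lra.
  - by rewrite subrr normr0.
have clip_gam y v : 1 + kap G * pG G (rho G (clip y v)) <= 1 + kap G * pG G Mb.
  rewrite lerD2l ler_wpM2l ?kap_ge0 // pG_le //.
    by rewrite ltW // rho_gt0.
  by rewrite -(rhoK G Mb0) rho_le.
have [K K0 KP] := fldu_lip tv G k Th_itv hC1 (1 + kap G * pG G Mb).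
have [||Y Y0 YP] := ode_exists u0 K0 field_bound_ge0 (g := fun y => fieldu (clip y)).
- move=> y z v; apply: le_trans (KP (clip z) (clip y) _ _ _ _ v) _ => //.
  by rewrite ler_wpM2l //; apply: ler_sum => w _; exact: clip_lip.
- by move=> y v; apply: fldu_bound.
have Yb t v : 0 <= t -> Y t v <= bb.
  move=> t0; rewrite -subr_le0.
  apply: (stays_nonpos (h := fun t => Y t v - bb) (dh := fun t => fieldu (clip (Y t)) v)) t0.
  - by rewrite Y0 subr_le0 lam_le // /Mb (bigD1 v) //= addrCA lerDl addr_ge0 ?(ltW M0) //
      sumr_ge0 // => w _; exact: ltW.
  - move=> s s0; have := isdB (YP s v s0) (isdC bb s); rewrite subr0; exact.
  - move=> s s0; rewrite subr_ge0 => bY; apply/ltW/barrier => [w|].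
      exact: rho_gt0.
    by rewrite /clip (min_idPr bY) rhoK.
have clipY t : 0 <= t -> clip (Y t) = Y t.
  by move=> t0; apply/funext => v; rewrite /clip (min_idPl (Yb t v t0)).
exists Y; last by exists bb.
split=> // t v t0; rewrite -{1 2}(clipY t t0); split; first exact: clip_dom.
exact: YP.
Qed.

Section LogFlow.
Variable u : R -> V -> R.
Hypothesis flow_u : log_flow u.

Local Notation ru := (fun t v => rho G (u t v)).

Let u_dom t v : 0 <= t -> dom G (u t v).
Proof. by move=> t0; case: flow_u => _ /(_ t v t0)[]. Qed.

Let isd_u t v : 0 <= t -> is_derive t 1 (fun s => u s v) (fieldu (u t) v).
Proof. by move=> t0; case: flow_u => _ /(_ t v t0)[]. Qed.

Let u_at0 : u 0 = u0. Proof. by case: flow_u. Qed.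

Let ru_gt0 t v : 0 <= t -> 0 < ru t v.
Proof. by move=> t0; apply: rho_gt0; exact: u_dom. Qed.

Lemma isd_ru t v : 0 <= t -> is_derive t 1 (fun s => ru s v) (flow_rhs tv te G Th k (ru t) v).
Proof.
move=> t0; rewrite /flow_rhs (fldE tv te G k Th_itv) => [|w]; last exact: ru_gt0.
apply: is_derive_eq (@isd_comp _ (rho G) (fun s => u s v) _ _ _ (isd_rho (u_dom v t0)) (isd_u v t0)) _.
by rewrite mulrC.
Qed.

Lemma log_flow_sol : flow_sol_on tv te G Th k r0 +oo%E ru.
Proof.
split.
- by apply/funext => v; rewrite u_at0 rhoK.
- by move=> t t0 _ v; exact: ru_gt0.
- move=> v; apply: cvg_at_right_filter.
  rewrite -[X in _ --> X](rhoK G (r0_gt0 v)) -[lam G (r0 v)]/(u0 v) -u_at0.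
  exact: isd_cont (isd_ru v (lexx 0)).
- move=> t t0 _ v; have [d e] := isd_ru v (ltW t0).
  by split=> //; rewrite derive1E.
Qed.

Lemma log_flow_unique (T : \bar R) (s : R -> V -> R) : (0 < T)%E ->
  flow_sol_on tv te G Th k r0 T s ->
  forall t, 0 <= t -> (t%:E < T)%E -> s t = ru t.
Proof.
move=> T0 [s0 spos scv sd] t; rewrite le_eqVlt => /predU1P[<- _|t0 tT].
  by rewrite s0; apply/funext => v; rewrite u_at0 rhoK.
pose w x v := lam G (s x v).
have xT x : x <= t -> (x%:E < T)%E by move=> xt; apply: le_lt_trans tT; rewrite lee_fin.
have sp x v : 0 <= x -> x <= t -> 0 < s x v by move=> x0 xt; exact: (spos x x0 (xT x xt) v).
have wd x v : 0 <= x -> x <= t -> dom G (w x v).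
  by move=> x0 xt; apply: lam_dom; exact: sp.
have isd_w x v : 0 < x -> x <= t -> is_derive x 1 (fun x => w x v) (fieldu (w x) v).
  move=> x0 xt; have x0' := ltW x0.
  have [d e] := sd x x0 (xT x xt) v.
  have ds : is_derive x 1 (fun x => s x v) (flow_rhs tv te G Th k (s x) v).
    by split => //; rewrite -derive1E.
  apply: is_derive_eq (@isd_comp _ (lam G) (fun x => s x v) _ _ _ (isd_lam G (sp x v x0' xt)) ds) _.
  rewrite /flow_rhs (fldE tv te G k Th_itv) => [|y]; last exact: sp.
  rewrite -[X in _ * (_ * X)]/(sG G (s x v)) mulrCA mulVf ?mulr1; last first.
    by rewrite gt_eqF // sG_gt0 // sp.
  rewrite /fldu; congr (fld _ _ _ _ _ _ v); apply/funext => y.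
  by rewrite rhoK // sp.
(* The solution s is differentiable at positive times only, so h is compared between x > 0 and t;
   then x tends to 0, where h tends to 0. *)
pose h x := \sum_v (w x v - u x v) ^+ 2.
pose dh x := \sum_v 2 * ((w x v - u x v) * (fieldu (w x) v - fieldu (u x) v)).
have hd x : 0 < x -> x <= t -> is_derive x 1 h (dh x).
  move=> x0 xt; apply: isd_sum => v _.
  have D := isdB (isd_w x v x0 xt) (isd_u v (ltW x0)).
  by apply: is_derive_eq (isdM D D) _; ring.
have hle x : 0 < x -> x <= t -> h t <= h x.
  move=> x0 xt; apply: (isd_nincr (df := dh) xt) => y /andP[].
    by move=> xy yt; apply: hd => //; exact: lt_le_trans xy.
  move=> /(lt_trans x0)/ltW y0 /ltW yt; rewrite /dh -mulr_sumr pmulr_rle0 //.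
  by apply: fldu_dissip => // v; [exact: u_dom|exact: wd].
have h0 : h x @[x --> 0^'+] --> 0.
  rewrite [X in _ --> X](_ : 0 = \sum_v (u0 v - u0 v) * (u0 v - u0 v)); last first.
    by rewrite big1 // => v _; rewrite subrr mul0r.
  apply: cv_sum => v _.
  have c : (fun x => w x v - u x v) @ 0^'+ --> u0 v - u0 v.
    apply: cvB.
      apply: (cvK _ (scv v)); exact: isd_cont (isd_lam G (r0_gt0 v)).
    by apply: cvg_at_right_filter; rewrite -[u0 v]/(u0 v) -u_at0; exact: isd_cont (isd_u v (lexx 0)).
  by apply: (cv_near (cvM c c)); apply: nearW => x; rewrite expr2.
have ht : h t <= 0.
  apply: (cvgr_to_ge h0); near=> x; apply: hle.
    by near: x; exact: nbhs_right_gt.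
  by near: x; apply: nbhs_right_le.
have hv v : w t v = u t v.
  apply/eqP; rewrite -subr_eq0 -sqrf_eq0 eq_le sqr_ge0 andbT.
  apply: le_trans ht; rewrite /h (bigD1 v) //= lerDl sumr_ge0 // => y _.
  exact: sqr_ge0.
apply/funext => v; rewrite -hv rhoK //; exact: sp (ltW t0) (lexx t).
Unshelve. all: by end_near. Qed.

(** By Gauss-Bonnet the sum of the field vanishes. This invariant selects the scale of the limit. *)
Lemma log_sum_const t : G = Euclidean -> 0 <= t -> \sum_v u t v = \sum_v u0 v.
Proof.
move=> GE t0; rewrite -u_at0.
have D (x : R) : 0 <= x -> is_derive x 1 (fun x => \sum_v u x v) 0.
  move=> x0; apply: is_derive_eq (isd_sum (fun v _ => isd_u v x0)) _.
  rewrite (sum_fld_euc k surf Th_itv hC1 GE) => [|v]; last exact: ru_gt0.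
  by case: curvk => _; rewrite GE => ->; rewrite subrr.
apply/eqP; rewrite eq_le; apply/andP; split.
  by apply: (isd_nincr t0 (f := fun x => \sum_v u x v) (df := fun=> 0)) => // x /andP[x0 _]; exact: D.
rewrite -lerN2.
apply: (isd_nincr t0 (f := fun x => - \sum_v u x v) (df := fun=> - 0)) => [x /andP[x0 _]|x _].
  by apply: isdN; exact: D.
by rewrite oppr0.
Qed.

(** In u the velocity is the field itself, and it tends to its value at the limit; a convergent
    function whose derivative converges has derivative tending to 0. *)
Lemma limit_equilibrium (rs : V -> R) : converges_pos ru rs -> forall v, fieldr rs v = 0.
Proof.
move=> [rs0 cv] v.
apply: (@limit_derive0 _ (fun t => u t v) (fun t => fieldu (u t) v) (lam G (rs v))).
- by move=> t t0; exact: isd_u.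
- have c : lam G (ru t v) @[t --> +oo] --> lam G (rs v).
    by apply: (cvK _ (cv v)); exact: isd_cont (isd_lam G (rs0 v)).
  apply: (cv_near c); near=> t; apply: lamK; apply: u_dom.
  by near: t; exact: nbhs_pinfty_ge.
- apply: (fld_cvg Th_itv hC1 _ cv rs0); near=> t => y; apply: ru_gt0.
  by near: t; exact: nbhs_pinfty_ge.
Unshelve. all: by end_near. Qed.

Lemma limit_log_sum (rs : V -> R) : G = Euclidean -> converges_pos ru rs ->
  \sum_v lam G (rs v) = \sum_v u0 v.
Proof.
move=> GE [rs0 cv].
have c : (fun t => \sum_v u t v) @ +oo --> \sum_v lam G (rs v).
  apply: cv_sum => v _.
  have c : lam G (ru t v) @[t --> +oo] --> lam G (rs v).
    by apply: (cvK _ (cv v)); exact: isd_cont (isd_lam G (rs0 v)).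
  apply: (cv_near c); near=> t; apply: lamK; apply: u_dom.
  by near: t; exact: nbhs_pinfty_ge.
have c' : (fun t => \sum_v u t v) @ +oo --> \sum_v u0 v.
  apply: (cv_near (cvC (\sum_v u0 v))); near=> t.
  have t0 : 0 <= t by near: t; exact: nbhs_pinfty_ge.
  by rewrite log_sum_const.
exact: (cvg_unique _ c c').
Unshelve. all: by end_near. Qed.

Lemma exp_convergence (rs : V -> R) : bounded_above u ->
  (forall v, 0 < rs v) -> (forall v, fieldr rs v = 0) ->
  (G = Euclidean -> \sum_v lam G (rs v) = \sum_v u0 v) ->
  exists C c : R, 0 < C /\ 0 < c /\ forall t : R, 0 <= t -> forall v,
    `|ru t v - rs v| <= C * expR (- c * t).
Proof.
move=> [bb dbb ubb] rs0 rsE rssum; pose us v := lam G (rs v).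
have dus v : dom G (us v) by exact: lam_dom.
have fus v : fieldu us v = 0.
  by rewrite /fldu -[RHS](rsE v); congr (fld _ _ _ _ _ _ v); apply/funext => y; rewrite rhoK.
pose h t := \sum_v (u t v - us v) ^+ 2.
pose S t := \sum_v (u t v - us v) * (fieldu (u t) v - fieldu us v).
have hd t : 0 <= t -> is_derive t 1 h (2 * S t).
  move=> t0; rewrite /S mulr_sumr; apply: isd_sum => v _.
  have D := isdB (isd_u v t0) (isdC (us v) t).
  by apply: is_derive_eq (isdM D D) _; rewrite fus; ring.
have hE0 t v : (u t v - us v) ^+ 2 <= h t.
  by rewrite /h (bigD1 v) //= lerDl sumr_ge0 // => y _; exact: sqr_ge0.
have h_le t : 0 <= t -> h t <= h 0.
  move=> t0; apply: (isd_nincr (f := h) (df := fun t => 2 * S t) t0) => x /andP[x0 _].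
    exact: hd.
  rewrite pmulr_rle0 //; apply: fldu_dissip => // v.
  by apply: u_dom; exact: ltW.
have h0 : 0 <= h 0 by apply: sumr_ge0 => v _; exact: sqr_ge0.
(* The distance to the equilibrium does not grow, which confines u to a fixed box; a number whose
   square is at most h 0 is at most h 0 + 1. *)
pose A := \sum_v `|us v| + h 0 + 1.
have usA v : `|us v| <= \sum_v `|us v| by rewrite (bigD1 v) //= lerDl sumr_ge0.
have uA t v : 0 <= t -> `|u t v| <= A.
  move=> t0; have e := le_trans (hE0 t v) (h_le t t0).
  have := ler_normD (us v) (u t v - us v); rewrite addrC subrK.
  have := usA v; have : `|u t v - us v| <= h 0 + 1.
    have := sqr_ge0 (`|u t v - us v| - 1); rewrite -real_normK ?num_real // in e.
    move: e h0; move: (`|u t v - us v|) => x; nra.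
  rewrite /A; lra.
have usA' v : `|us v| <= A by have := usA v; rewrite /A; lra.
(* Coercivity needs an upper bound inside [dom]. A may lie outside it in the hyperbolic case, where
   the bound from [bounded_above] is used instead. *)
have [b db [ub usb]] : exists2 b, dom G b &
    (forall t v, 0 <= t -> u t v <= b) /\ (forall v, us v <= b).
  case GE : {-}G; last first.
    exists A; first by rewrite GE.
    split=> [t v t0|v]; first exact: le_trans (ler_norm _) (uA t v t0).
    exact: le_trans (ler_norm _) (usA' v).
  have M0 : 0 < 1 + \sum_v rs v by rewrite ltr_pwDl // sumr_ge0 // => v _; exact: ltW.
  exists (Num.max bb (lam G (1 + \sum_v rs v))).
    by case: leP => // _; exact: lam_dom.
  split=> [t v t0|v]; rewrite le_max ?ubb //.
  apply/orP; right; apply: lam_le => //.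
  by rewrite (bigD1 v) //= addrCA lerDl addr_ge0 // sumr_ge0 // => y _; exact: ltW.
have [c c0 cP] := fldu_coercive k surf Th_itv hC1 (- A) db.
(* The squared distance decays at the rate 2 c, hence the distance at the rate c; [rho_lipschitz]
   carries this over to the radii. *)
have decay t : 0 <= t -> h t <= h 0 * expR (- (2 * c) * t).
  move=> t0; apply: (exp_decay (dh := fun t => 2 * S t)) => // s s0.
  rewrite mulNr -mulrA -mulrN ler_pM2l // -mulNr; apply: cP.
  - by move=> v; rewrite usb andbT; have := usA' v; rewrite ler_norml => /andP[].
  - by move=> v; rewrite ub // andbT; have := uA s v s0; rewrite ler_norml => /andP[].
  - by move=> GE; rewrite sumrB log_sum_const // rssum // subrr.
pose L := sG G (rho G b).
have L0 : 0 < L by rewrite sG_gt0 // rho_gt0.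
exists (L * Num.sqrt (h 0) + 1), c; split; first by rewrite ltr_wpDl // mulr_ge0 ?sqrtr_ge0 // ltW.
split=> // t t0 v; rewrite -[rs v](rhoK G) //.
apply: le_trans (rho_lipschitz db (ub t v t0) (usb v)) _.
have uv : `|u t v - us v| <= Num.sqrt (h 0) * expR (- c * t).
  rewrite -(@ler_pXn2r _ 2) ?nnegrE ?mulr_ge0 ?sqrtr_ge0 ?expR_ge0 //.
  rewrite real_normK ?num_real // exprMn sqr_sqrtr // -expRM_natl.
  apply: le_trans (hE0 t v) (le_trans (decay t t0) _).
  by rewrite (_ : - (2 * c) * t = 2%:R * (- c * t)) //; ring.
have := expR_gt0 (- c * t); move: uv; rewrite -(ler_pM2l L0) /L; lra.
Qed.

End LogFlow.
Lemma normalized_equilibrium : attainable tv te Th k -> exists2 rs : V -> R,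
  (forall v, 0 < rs v) & (forall v, fieldr rs v = 0) /\
  (G = Euclidean -> \sum_v lam G (rs v) = \sum_v u0 v).
Proof.
move=> att; have [r rp rE] := equilibrium_exists surf Th_itv hC1 att curvk.
case GE : {-}G; first by exists r => //; split=> //; rewrite GE.
(* Scaling all radii by expR c adds c to every u_v and keeps the equilibrium; this c matches the sum
   preserved by the flow. *)
pose c := (\sum_v u0 v - \sum_v lam G (r v)) / #|V|%:R.
have V0 : #|V|%:R != 0 :> R.
  case: surf => _ _ _ _ [_ /card_gt0P[f _]]; rewrite pnatr_eq0 -lt0n.
  by apply/card_gt0P; exists (tv f ord0).
exists (fun v => expR c * r v) => [v|]; first by rewrite mulr_gt0 ?expR_gt0.
split=> [v|_]; first by rewrite fld_scale ?expR_gt0.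
transitivity (\sum_v (c + lam G (r v))).
  by apply: eq_bigr => v _; rewrite GE /= lnM ?posrE ?expR_gt0 // expRK.
rewrite big_split /= sumr_const cardT -cardE -[_ *+ _]mulr_natr /c divfK //.
by rewrite subrK.
Qed.

End Flow.

Theorem theorem4p1 (R : realType) (V E F : finType)
  (tv : F -> 'I_3 -> V) (te : F -> 'I_3 -> E) (g n : nat) :
  is_tri_surface tv te ->
  @tri_chi V E F = euler_char g n ->
  n = nbdry tv te ->
  forall Th : E -> R,
  (forall e, 0 <= Th e < pi) ->
  C1 te Th ->
  forall (G : geom) (k : V -> R),
  curvature_vector tv te G (euler_char g n) k ->
  forall r0 : V -> R, (forall v, 0 < r0 v) ->
  exists r : R -> V -> R,
    [/\ flow_sol_on tv te G Th k r0 +oo%E r,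
        (forall (T : \bar R) (s : R -> V -> R), (0 < T)%E ->
           flow_sol_on tv te G Th k r0 T s ->
           forall t : R, 0 <= t -> (t%:E < T)%E -> s t = r t),
        ((exists rs, converges_pos r rs) <-> attainable tv te Th k) &
        (forall rs : V -> R, converges_pos r rs ->
           [/\ (exists C lam : R, 0 < C /\ 0 < lam /\
                  forall t : R, 0 <= t -> forall v,
                    `|r t v - rs v| <= C * expR (- lam * t)),
               (forall f : F, forall i : 'I_3,
                  side_len tv te G Th rs (f, i) <
                    side_len tv te G Th rs (f, nx i) + side_len tv te G Th rs (f, nx (nx i))) &
               (forall v, curv tv te G Th rs v = k v)])].
Proof.
move=> surf chiE _ Th Th_itv hC1 G k; rewrite -chiE => curvk r0 r0_gt0.
have [u flow_u above_u] := log_flow_exists Th_itv hC1 curvk r0_gt0.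
pose r t v := rho G (u t v); exists r.
have sol : flow_sol_on tv te G Th k r0 +oo%E r by exact: log_flow_sol.
have expo rs := @exp_convergence _ _ _ _ tv te G Th k surf Th_itv hC1 curvk r0 u flow_u rs above_u.
split=> //.
- by move=> T s T0 sol_s t t0 tT; exact: (log_flow_unique Th_itv hC1 r0_gt0 flow_u T0 sol_s).
- split=> [[rs cv]|att].
    apply: (equilibrium_attainable surf Th_itv hC1 (proj1 cv)).
    exact: (limit_equilibrium Th_itv hC1 flow_u cv).
  have [rs rs0 [rsE rssum]] := normalized_equilibrium surf Th_itv hC1 curvk r0 att.
  have [C [c [C0 [c0 h]]]] := expo rs rs0 rsE rssum.
  exists rs; split=> // v; apply: (exp_bound_cvg c0) => t t0; exact: h.
- move=> rs cv; have rsE := limit_equilibrium Th_itv hC1 flow_u cv.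
  have rs0 := proj1 cv; split.
  + apply: expo => // GE; exact: (limit_log_sum surf Th_itv hC1 curvk flow_u GE cv).
  + by move=> f i; exact: side_len_triangle.
  + move=> v; apply/eqP; rewrite eq_sym -subr_eq0; apply/eqP.
    by rewrite (fldE tv te G k Th_itv v rs0).
Qed.
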